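(* Let $k$ be a field and let $Q$ be a quiver of type $\mathbb D_\infty$. If $M$ is an indecomposable representation in $\mathrm{rep}^+(Q)$, then (1) $M\cong M(w)$ with $w$ a string having no left infinite path, or (2) $M\cong N_{i,j}$ with $i\ge0$ and $j\ge1$, or (3) $M\cong N_{i,\infty}$ with $i\ge0$, and this case occurs if and only if $Q$ has right infinite paths.
   Context: $Q$ is of type $\mathbb D_\infty$ if, up to relabelling, its vertex set is $\{0,1,2,\dots\}$ and its underlying graph has exactly the edges $0-2$, $1-2$ and $x-(x+1)$ for $x\ge2$, with arbitrary orientation. A right infinite path has the form $a_0\to a_1\to\cdots$, a left infinite path the form $\cdots\to a_1\to a_0$. $\mathrm{rep}(Q)$ is the category of locally finite dimensional $k$-representations of $Q$ (each $M(x)$ finite dimensional). For a vertex $a$, $P_a$ is the representation with $P_a(x)$ the $k$-space with basis the set of paths from $a$ to $x$ (including the trivial path if $x=a$), an arrow $\alpha$ acting by $\rho\mapsto\alpha\rho$. $\mathrm{rep}^+(Q)$ is the category of finitely presented representations: those $M$ with an exact sequence $0\to P_1\to P_0\to M\to0$, $P_0,P_1$ finite direct sums of representations $P_a$. Indecomposable objects of $\mathrm{rep}^+(Q)$ are determined up to isomorphism by their dimension vector. Strings. An edge of $Q$ is an arrow or a formal inverse of an arrow (with starting and ending points interchanged). A walk is either trivial (one for each vertex) or a finite, right infinite, left infinite or double infinite product $\cdots c_{i+1}c_i\cdots$ of edges such that the ending point of $c_i$ is the starting point of $c_{i+1}$; it is reduced if $c_{i+1}\ne c_i^{-1}$ for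 all $i$. For a reduced walk $w$, $Q(w)$ is the full subquiver of $Q$ generated by the vertices appearing in $w$; $w$ is a string if $Q(w)$ contains at least one and at most finitely many sink or source vertices; $w$ has no left infinite path if $Q(w)$ contains none. $M(w)$ is the representation with $M(w)(x)=k$ if $x$ appears in $w$ and $0$ otherwise, $M(w)(\alpha)=\mathrm{id}$ if $\alpha$ or $\alpha^{-1}$ appears in $w$ and $0$ otherwise. For integers $i\ge0$, $j\ge1$, $N_{i,j}$ denotes the finite dimensional indecomposable representation in $\mathrm{rep}^+(Q)$ with dimension vector $1$ at the vertices $0$ and $1$; $2$ at the $i$ vertices $2,\dots,i+1$; $1$ at the $j$ vertices $i+2,\dots,i+j+1$; and $0$ at all vertices $x>i+j+1$. In case $Q$ has infinite paths, for $i\ge0$, $N_{i,\infty}$ denotes the sincere indecomposable representation in $\mathrm{rep}(Q)$ with dimension vector $1$ at the vertices $0$ and $1$; $2$ at the $i$ vertices $2,\dots,i+1$; and $1$ at all vertices $x\ge i+2$. *)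

(* Defs.v *)
From HB Require Import structures.
From mathcomp Require Import all_boot all_order all_algebra.
From mathcomp Require Import boolp classical_sets functions cardinality.
From mathcomp Require Import freeg.

Set Implicit Arguments.
Unset Strict Implicit.
Unset Printing Implicit Defensive.

Import GRing.Theory.
Local Open Scope classical_set_scope.
Local Open Scope ring_scope.

Record quiver := Quiver {
  vertex : Type;
  arrow : Type;
  src : arrow -> vertex;
  tgt : arrow -> vertex }.

Section Quivers.
Variable Q : quiver.

(* The ends of the e-th edge of the graph D_infty: the edges 0 - 2, 1 - 2 and
   x - (x+1) for x >= 2 are numbered 0, 1 and x respectively. *)
Definition Dinf_edge (e : nat) : nat * nat :=
  if e == 0%N then (0%N, 2%N) else (e, e.+1).

(* Q is of type D_infty, its vertices being relabelled 0, 1, 2, ... by v. *)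
Definition Dinf_labelling (v : nat -> vertex Q) : Prop :=
  bijective v /\
  exists2 a : nat -> arrow Q, bijective a &
    forall e, let: (x, y) := Dinf_edge e in
      (src (a e) = v x /\ tgt (a e) = v y) \/
      (src (a e) = v y /\ tgt (a e) = v x).

Definition is_sink (x : vertex Q) : Prop := forall a : arrow Q, src a <> x.
Definition is_source (x : vertex Q) : Prop := forall a : arrow Q, tgt a <> x.

Definition has_right_infinite_path : Prop :=
  exists p : nat -> arrow Q, forall n, tgt (p n) = src (p n.+1).
Definition has_left_infinite_path : Prop :=
  exists p : nat -> arrow Q, forall n, tgt (p n.+1) = src (p n).
Definition has_infinite_path : Prop :=
  has_right_infinite_path \/ has_left_infinite_path.

Definition full_subquiver (A : set (vertex Q)) : quiver :=
  @Quiver {x : vertex Q | A x} {a : arrow Q | A (src a) /\ A (tgt a)}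
    (fun a => exist _ (src (sval a)) (proj1 (svalP a)))
    (fun a => exist _ (tgt (sval a)) (proj2 (svalP a))).

Inductive qpath (a : vertex Q) : vertex Q -> Type :=
| qpath_nil : qpath a a
| qpath_cons (b : arrow Q) (p : qpath a (src b)) : qpath a (tgt b).

Inductive edge := Fwd of arrow Q | Inv of arrow Q.

Definition edge_start (c : edge) : vertex Q :=
  match c with Fwd a => src a | Inv a => tgt a end.
Definition edge_end (c : edge) : vertex Q :=
  match c with Fwd a => tgt a | Inv a => src a end.
Definition edge_inv (c : edge) : edge :=
  match c with Fwd a => Inv a | Inv a => Fwd a end.

(* Walks are products ... c_{i+1} c_i ... whose factors are traversed by
   increasing index. [FinWalk c s] has first factor c and then those of s;
   the factors of [LeftInfWalk f] are ..., f 2, f 1, f 0 in order of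
   traversal. *)
Inductive walk :=
| TrivWalk of vertex Q
| FinWalk of edge & seq edge
| RightInfWalk of nat -> edge
| LeftInfWalk of nat -> edge
| DoubleInfWalk of int -> edge.

Definition edges_of (w : walk) : set edge :=
  match w with
  | TrivWalk _ => set0
  | FinWalk c s => [set d | exists s1 s2, c :: s = s1 ++ d :: s2]
  | RightInfWalk f | LeftInfWalk f => range f
  | DoubleInfWalk f => range f
  end.

(* d is traversed immediately after c *)
Definition consecutive (w : walk) (c d : edge) : Prop :=
  match w with
  | TrivWalk _ => False
  | FinWalk c0 s => exists s1 s2, c0 :: s = s1 ++ [:: c, d & s2]
  | RightInfWalk f => exists n, c = f n /\ d = f n.+1
  | LeftInfWalk f => exists n, c = f n.+1 /\ d = f n
  | DoubleInfWalk f => exists n : int, c = f n /\ d = f (n + 1)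
  end.

Definition is_walk (w : walk) : Prop :=
  forall c d, consecutive w c d -> edge_end c = edge_start d.

Definition reduced_walk (w : walk) : Prop :=
  forall c d, consecutive w c d -> d <> edge_inv c.

Definition vertices_of (w : walk) : set (vertex Q) :=
  match w with
  | TrivWalk x => [set x]
  | _ => [set x | exists2 c, edges_of w c & x = edge_start c \/ x = edge_end c]
  end.

End Quivers.

Arguments qpath_nil {Q a}.

Definition walk_quiver (Q : quiver) (w : walk Q) : quiver :=
  full_subquiver (vertices_of w).

Definition is_string (Q : quiver) (w : walk Q) : Prop :=
  [/\ is_walk w, reduced_walk w &
      let S := [set x : vertex (walk_quiver w) | is_sink x \/ is_source x] in
      S !=set0 /\ finite_set S].

Definition no_left_infinite_path (Q : quiver) (w : walk Q) : Prop :=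
  ~ has_left_infinite_path (walk_quiver w).

Section FreeModule.
Variables (k : fieldType) (T U : choiceType) (f : T -> U).

Definition freeg_map (D : {freeg T / k}) : {freeg U / k} :=
  fglift (fun t => << f t >>) D.

Lemma freeg_map_linear : linear freeg_map.
Proof.
have addf : additive freeg_map by exact: lift_is_additive.
have add D E : freeg_map (D + E) = freeg_map D + freeg_map E.
  have opp G : freeg_map (- G) = - freeg_map G.
    by rewrite -[- G]add0r addf -[X in freeg_map X](subrr 0) addf subrr sub0r.
  by rewrite -{1}[E]opprK addf opp opprK.
have map0 : freeg_map 0 = 0 by rewrite -(subrr 0) addf subrr.
move=> c D E; rewrite add; congr (_ + _).
rewrite -[D in LHS]freeg_sumE -[D in RHS]freeg_sumE; elim: (dom D) => [|z r IH].
  by rewrite !big_nil scaler0 map0 scaler0.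
rewrite !big_cons scalerDr !add IH scalerDr; congr (_ + _).
have -> : c *: << coeff z D *g z >> = << c * coeff z D *g z >> :> {freeg T / k}.
  by apply/eqP/freeg_eqP => y; rewrite coeffZ !coeffU mulrA.
by rewrite /freeg_map !liftU scalerA.
Qed.

HB.instance Definition _ :=
  GRing.isLinear.Build k {freeg T / k} {freeg U / k} *:%R freeg_map
    freeg_map_linear.

End FreeModule.

Record rep (k : fieldType) (Q : quiver) := Rep {
  space : vertex Q -> lmodType k;
  rmap : forall a : arrow Q, {linear space (src a) -> space (tgt a)} }.

Section Representations.
Variables (k : fieldType) (Q : quiver).
Implicit Types M N : rep k Q.

Record rep_hom M N := RepHom {
  hmap : forall x, {linear space M x -> space N x};
  _ : forall a u, hmap (tgt a) (rmap M a u) = rmap N a (hmap (src a) u) }.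

Definition rep_iso M N : Prop :=
  exists f : rep_hom M N, forall x, bijective (hmap f x).

Definition is_zero_rep M : Prop := forall x (u : space M x), u = 0.

Definition zero_rep : rep k Q :=
  @Rep k Q (fun _ => 'rV[k]_0) (fun _ => \0).

Section DirectSum.
Variables (M N : rep k Q) (a : arrow Q).

Definition dsum_map (u : space M (src a) * space N (src a)) :
    space M (tgt a) * space N (tgt a) :=
  (rmap M a u.1, rmap N a u.2).

Lemma dsum_map_linear : linear dsum_map.
Proof. by move=> c u v; rewrite /dsum_map /= !linearP. Qed.

HB.instance Definition _ :=
  GRing.isLinear.Build k (space M (src a) * space N (src a))%type
    (space M (tgt a) * space N (tgt a))%type *:%R dsum_map dsum_map_linear.

End DirectSum.

Definition dsum M N : rep k Q :=
  @Rep k Q (fun x => (space M x * space N x)%type : lmodType k) (@dsum_map M N).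

Definition indecomposable M : Prop :=
  ~ is_zero_rep M /\
  forall X Y : rep k Q, rep_iso M (dsum X Y) -> is_zero_rep X \/ is_zero_rep Y.

Definition has_dim (V : lmodType k) (n : nat) : Prop :=
  exists f : {linear V -> 'rV[k]_n}, bijective f.

Definition locally_finite_dim M : Prop :=
  forall x, exists n, has_dim (space M x) n.

(* P_a: the space at x is free on the set of paths from a to x. *)
Definition proj_rep (a : vertex Q) : rep k Q :=
  @Rep k Q (fun x => {freeg {classic qpath a x} / k} : lmodType k)
    (fun b => @freeg_map k {classic qpath a (src b)} {classic qpath a (tgt b)}
                (@qpath_cons Q a b)).

Definition proj_sum (s : seq (vertex Q)) : rep k Q :=
  foldr (fun a M => dsum (proj_rep a) M) zero_rep s.

Definition rep_plus M : Prop :=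
  locally_finite_dim M /\
  exists (s1 s0 : seq (vertex Q))
         (f : rep_hom (proj_sum s1) (proj_sum s0)) (g : rep_hom (proj_sum s0) M),
    forall x, [/\ injective (hmap f x),
                  (forall u, hmap g x u = 0 <-> range (hmap f x) u) &
                  (forall m, exists u, hmap g x u = m)].

(* M(w): 'rV_b for a boolean b is k if b holds and 0 otherwise; likewise
   multiplication by [pid_mx b] is the identity if b holds (both ends of the
   arrow being then k) and 0 otherwise. *)
Definition string_rep (w : walk Q) : rep k Q :=
  @Rep k Q
    (fun x => 'rV[k]_(`[< vertices_of w x >]) : lmodType k)
    (fun a => mulmxr (pid_mx `[< edges_of w (Fwd a) \/ edges_of w (Inv a) >])).

Definition has_dim_vector (v : nat -> vertex Q) M (d : nat -> nat) : Prop :=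
  forall x, has_dim (space M (v x)) (d x).

Definition dimN (i j x : nat) : nat :=
  if (x < 2)%N then 1 else if (x < i + 2)%N then 2
  else if (x < i + j + 2)%N then 1 else 0.

Definition dimN_infty (i x : nat) : nat :=
  if (x < 2)%N then 1 else if (x < i + 2)%N then 2 else 1.

Definition some_rep (P : rep k Q -> Prop) : rep k Q :=
  if pselect (exists N, P N) is left PN then sval (cid PN) else zero_rep.

(* N_{i,j} and N_{i,infty} are specified, up to isomorphism, by being
   indecomposable with a given dimension vector. *)
Definition N_rep (v : nat -> vertex Q) (i j : nat) : rep k Q :=
  some_rep (fun N => [/\ rep_plus N, indecomposable N &
                         has_dim_vector v N (dimN i j)]).

Definition N_infty (v : nat -> vertex Q) (i : nat) : rep k Q :=
  some_rep (fun N => [/\ locally_finite_dim N, indecomposable N &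
                         has_dim_vector v N (dimN_infty i)]).

(* N_{i,infty} is only considered when Q has infinite paths. *)
Definition iso_N_infty (v : nat -> vertex Q) (i : nat) M : Prop :=
  has_infinite_path Q /\ rep_iso M (N_infty v i).

End Representations.

Arguments string_rep k {Q} w.
Arguments N_rep k {Q} v i j.
Arguments N_infty k {Q} v i.

(* Main.v *)
(* Arrange a representation around the vertex 2 and call a map good if it is
   surjective when it points away from 2 and injective when it points towards 2.
   A map which is not good splits off a summand supported beyond it, so an
   indecomposable M living near 2 has only good maps. Then the spaces on the tail
   are subquotients of V = M(2) by members of a chain of subspaces, the spaces at
   0 and 1 amount to two further subspaces U0, U1 of V, and the endomorphisms of M
   are those of V preserving the chain, U0 and U1. A direct argument with
   idempotents shows that dim V = 1, which gives the strings and the N_{0,j}, or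
   that dim V = 2 and U0, U1 and the proper members of the chain are three distinct
   lines, which gives the N_{i,j} with i > 0; lines being permuted transitively,
   the dimension vector determines M. A finite presentation forces the maps on the
   tail to be eventually bijective and eventually to point to infinity unless M
   vanishes there. Conversely N_{i,infty} is finitely presented if Q has a right
   infinite path, because it is an iterated extension of simples and of one P_a. *)
From HB Require Import structures.
From mathcomp Require Import all_boot all_order all_algebra zify.
From mathcomp Require Import boolp classical_sets functions cardinality.
From mathcomp Require Import freeg.
Require Import Defs.

Set Implicit Arguments.
Unset Strict Implicit.
Unset Printing Implicit Defensive.

Import GRing.Theory.
Local Open Scope ring_scope.

(** * Chains of subspaces and representations around a root *)

(** Indecomposability is used only as the absence of nontrivial idempotent endomorphisms, so each
    case of the classification amounts to exhibiting an idempotent on one space and extending it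
    over the tree. The obstacle is the infinite tail. A presentation makes its maps bijective from
    some n on, so only the finitely many steps before n constrain an endomorphism at 2, and the
    chain of subspaces is a finite list. Dimensions determine the representation because, once all
    maps are good, the dimensions and the orientation fix the rank of every member of the chain, and
    the chains of two representations can be matched member by member. N_{i,infty} is specified
    among locally finite representations only, so for it bijectivity far out is deduced from
    indecomposability instead of a presentation. Its explicit model uses the two coordinate lines
    and the diagonal of k^2, for every orientation. *)

Section Chains.
Variables (k : fieldType) (n : nat).
Implicit Types (C : seq 'M[k]_n) (A B U e : 'M[k]_n).

Definition is_chain C :=
  {in C &, forall A B, (A <= B)%MS || (B <= A)%MS}.

(** An endomorphism with image in [A] that kills [B] preserves every member of [C]. Adjoining the
    full and the zero space guarantees that both sides of the cut are inhabited. *)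
Lemma chain_cut C (P : pred 'M[k]_n) : is_chain C -> P 1%:M -> ~~ P 0 ->
  exists A B, [/\ A \in 1%:M :: C, P A, B \in 0 :: C, ~~ P B &
    {in C, forall X, (P X -> (A <= X)%MS) /\ (~~ P X -> (X <= B)%MS)}].
Proof.
move=> + P1 P0; elim: C => [|X C IH] chC.
  by exists 1%:M, 0; rewrite !mem_head.
have [|A [B [AC PA BC PB AB]]] := IH.
  by move=> Y Z YC ZC; apply: chC; rewrite inE (YC, ZC) orbT.
have cmp Y : Y \in C -> (X <= Y)%MS || (Y <= X)%MS.
  by move=> YC; apply: chC; rewrite inE ?eqxx ?YC ?orbT.
have [PX|PX] := boolP (P X).
  have {cmp} : (X <= A)%MS || (A <= X)%MS.
    by move: AC; rewrite inE => /orP[/eqP->|/cmp//]; rewrite submx1.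
  case/orP=> XA; [exists X|exists A]; exists B.
    split=> //; rewrite ?inE ?eqxx ?orbT //.
      by move: BC; rewrite inE => /orP[->|->]; rewrite ?orbT.
    move=> Y; rewrite inE => /orP[/eqP->|YC]; first by rewrite PX.
    by have [PY QY] := AB Y YC; split=> // /PY; apply: submx_trans.
  split=> //.
  - by move: AC; rewrite !inE => /orP[->|->]; rewrite ?orbT.
  - by move: BC; rewrite !inE => /orP[->|->]; rewrite ?orbT.
  by move=> Y; rewrite inE => /orP[/eqP->|/AB//]; rewrite PX.
have {cmp} : (B <= X)%MS || (X <= B)%MS.
  move: BC; rewrite inE => /orP[/eqP->|/cmp]; first by rewrite sub0mx.
  by rewrite orbC.
case/orP=> XB; exists A; [exists X|exists B].
  split=> //; rewrite ?inE ?eqxx ?orbT //.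
    by move: AC; rewrite inE => /orP[->|->]; rewrite ?orbT.
  move=> Y; rewrite inE => /orP[/eqP->|YC]; first by rewrite (negPf PX).
  have [PY QY] := AB Y YC; split=> // /QY YB; exact: submx_trans XB.
split=> //.
- by move: AC; rewrite !inE => /orP[->|->]; rewrite ?orbT.
- by move: BC; rewrite !inE => /orP[->|->]; rewrite ?orbT.
by move=> Y; rewrite inE => /orP[/eqP->|/AB//]; rewrite (negPf PX).
Qed.

Lemma mulmx0_sub m1 m2 p (A : 'M[k]_(m1, n)) (B : 'M_(m2, n)) (f : 'M_(n, p)) :
  (A <= B)%MS -> B *m f = 0 -> A *m f = 0.
Proof. by case/submxP=> D -> Bf; rewrite -mulmxA Bf mulmx0. Qed.

(** The functional is a coordinate of the quotient by [B] at which [z] does not vanish, rescaled. *)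
Lemma separating_functional m (z : 'rV[k]_n) (B : 'M_(m, n)) :
  ~~ (z <= B)%MS -> exists2 f : 'cV[k]_n, B *m f = 0 & z *m f = 1%:M.
Proof.
rewrite submxE => /eqP nz.
have /existsP[j nzj] : [exists j, (z *m cokermx B) 0 j != 0].
  apply: contra_notT nz => /existsPn z0; apply/rowP=> j; rewrite [RHS]mxE.
  by apply/eqP; have := z0 j; rewrite negbK.
exists (((z *m cokermx B) 0 j)^-1 *: (cokermx B *m delta_mx j 0)).
  by rewrite -scalemxAr (mulmxA B) mulmx_coker mul0mx scaler0.
move: nzj; set w := z *m _ => nzj.
rewrite -scalemxAr (mulmxA z) -/w -colE [col j w]mx11_scalar scale_scalar_mx;
  clearbody w.
by rewrite mxE mulVf.
Qed.

Lemma rank1_idempotent (z : 'rV[k]_n) (f : 'cV[k]_n) : z *m f = 1%:M ->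
  f *m z *m (f *m z) = f *m z /\ \rank (f *m z) = 1%N.
Proof.
move=> zf; rewrite mulmxA -(mulmxA f) zf mulmx1; split=> //.
apply/eqP; rewrite eqn_leq; apply/andP; split.
  exact: leq_trans (mxrankM_maxr _ _) (rank_leq_row _).
rewrite lt0n mxrank_eq0; apply/eqP=> fz0; have: z *m (f *m z) *m f = 0.
  by rewrite fz0 mulmx0 mul0mx.
by rewrite mulmxA zf mul1mx zf => /eqP; rewrite oner_eq0.
Qed.

Lemma stable_rank1 m (B : 'M_(m, n)) (z : 'rV[k]_n) (f : 'cV[k]_n) :
  (z <= B)%MS \/ B *m f = 0 -> stablemx B (f *m z).
Proof.
rewrite mulmxA => -[zB|->]; last by rewrite mul0mx sub0mx.
exact: submx_trans (submxMl _ _) zB.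
Qed.

(** The chain is cut where its members begin to meet [Z]. A nonzero vector of [Z] in the least such
    member lies outside the greatest member below the cut, so a functional separates the two. *)
Lemma idempotent_into C m (Z : 'M[k]_(m, n)) : is_chain C -> Z != 0 ->
  exists e, [/\ e *m e = e, \rank e = 1%N, (e <= Z)%MS &
                {in C, forall X, stablemx X e}].
Proof.
move=> chC nZ; have [||A [B [_ PA _ PB AB]]] :=
  chain_cut (P := fun X => (Z :&: X)%MS != 0) chC.
- by apply: contra nZ => /eqP Z0; rewrite -submx0 -Z0 sub_capmx submx_refl submx1.
- by rewrite negbK capmx0.
case/rowV0Pn: PA => z; rewrite sub_capmx => /andP[zZ zA] nz.
have [|f fB fz] := @separating_functional _ z B.
  apply: contra nz => zB; move: PB; rewrite negbK => /eqP ZB.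
  by rewrite -(submx0 z) -ZB sub_capmx zZ.
have [ee re] := rank1_idempotent fz; exists (f *m z); split=> //.
  exact: submx_trans (submxMl _ _) zZ.
move=> X XC; apply: stable_rank1; have [PX QX] := AB X XC.
have [/PX AX|/QX XB] := boolP ((Z :&: X)%MS != 0).
  by left; apply: submx_trans AX.
by right; apply: mulmx0_sub XB fB.
Qed.

(** Dual of [idempotent_into]: the chain is cut where its members begin to span everything together
    with [I]. The functional kills [I] and the greatest member below the cut; the line is taken in
    the least member above it. *)
Lemma idempotent_killing C m (I : 'M[k]_(m, n)) : is_chain C -> ~~ row_full I ->
  exists e, [/\ e *m e = e, \rank e = 1%N, I *m e = 0 &
                {in C, forall X, stablemx X e}].
Proof.
move=> chC nI; have [||A [B [_ PA _ PB AB]]] :=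
  chain_cut (P := fun X => row_full (I + X)%MS) chC.
- by rewrite -sub1mx addsmxSr.
- by rewrite -sub1mx addsmx0 sub1mx.
move: PB; rewrite -sub1mx => /row_subPn[i ni].
have [f fIB fi] := separating_functional ni.
have fI : I *m f = 0 by apply: mulmx0_sub fIB; rewrite addsmxSl.
have fB : B *m f = 0 by apply: mulmx0_sub fIB; rewrite addsmxSr.
have nA : ~~ (A <= kermx f)%MS.
  apply/negP=> fA; have: (1%:M <= kermx f)%MS.
    rewrite (submx_trans (B := (I + A)%MS)) ?sub1mx //.
    by rewrite addsmx_sub fA andbT; apply/sub_kermxP.
  move/sub_kermxP; rewrite mul1mx => f0; move: fi; rewrite f0 mulmx0.
  by move/esym/eqP; rewrite oner_eq0.
case/row_subPn: nA => j; rewrite sub_kermx => nj.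
have nj0 : (row j A *m f) 0 0 != 0.
  by apply: contra nj => /eqP w0; apply/eqP/matrixP=> a b; rewrite !ord1 w0 mxE.
pose z := ((row j A *m f) 0 0)^-1 *: row j A.
have zA : (z <= A)%MS by rewrite scalemx_sub ?row_sub.
have fz : z *m f = 1%:M.
  apply/matrixP=> a b; rewrite !ord1 -scalemxAl mxE mulVf //.
  by rewrite !mxE.
have [ee re] := rank1_idempotent fz; exists (f *m z); split=> //.
  by rewrite mulmxA fI mul0mx.
move=> X XC; apply: stable_rank1; have [PX QX] := AB X XC.
have [/PX AX|/QX XB] := boolP (row_full (I + X)%MS).
  by left; apply: submx_trans AX.
by right; apply: mulmx0_sub XB fB.
Qed.

(** Three distinct lines in a plane, the basis being normalised so that the third one is the
    diagonal. Besides it, [C] may contain zero and the whole plane. *)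
Definition three_lines C (U0 U1 : 'M[k]_n) (u0 u1 : 'rV[k]_n) :=
  [/\ row_free (col_mx u0 u1), row_full (col_mx u0 u1),
      (U0 :=: u0)%MS /\ (U1 :=: u1)%MS, exists2 A, A \in C & \rank A = 1%N &
      {in C, forall X, \rank X = 1%N -> (X :=: (u0 + u1)%R)%MS}].

(* A chain together with two further subspaces forms a poset of width three
   whose indecomposable representations have dimension at most 2. *)
Lemma idempotent_two_subspaces C (U0 U1 : 'M[k]_n) : (0 < n)%N -> is_chain C ->
  exists e, [/\ e *m e = e, e != 0, stablemx U0 e /\ stablemx U1 e,
     {in C, forall X, stablemx X e} &
     \rank e = 1%N \/
     (e = 1%:M -> exists u0 u1, three_lines C U0 U1 u0 u1)].
Proof.
move=> n0 chC.
have rk1 e : \rank e = 1%N -> e != 0.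
  by move=> re; rewrite -mxrank_eq0 re.
(* A common line of [U0] and [U1], or a functional vanishing on both, gives an idempotent of rank
   one; afterwards the two are complementary. *)
have [/eqP U01|nU] := boolP ((U0 :&: U1)%MS == 0); last first.
  have [e [ee re eU eC]] := idempotent_into chC nU.
  exists e; split; [by []|exact: rk1| |exact: eC|by left].
  by split; apply: submx_trans (submxMl _ _) (submx_trans eU _);
     rewrite (capmxSl, capmxSr).
have [fU|nU] := boolP (row_full (U0 + U1)%MS); last first.
  have [e [ee re eU eC]] := idempotent_killing chC nU.
  have e0 (U : 'M_n) : (U <= U0 + U1)%MS -> U *m e = 0.
    by move=> UU; apply: mulmx0_sub UU eU.
  exists e; split; [by []|exact: rk1| |exact: eC|by left].
  by rewrite !e0 ?addsmxSl ?addsmxSr ?sub0mx.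
have n1 : 1%:M != 0 :> 'M[k]_n by rewrite -mxrank_eq0 mxrank1 -lt0n.
have [|A [B [AC PA _ _ AB]]] := chain_cut (P := fun X => X != 0) chC n1.
  by rewrite eqxx.
have minA X : X \in C -> X != 0 -> (A <= X)%MS by move=> /AB[+ _]; apply.
(* If the least nonzero member [A] meets one of the complements, projection onto a common vector,
   killing the other complement, preserves the chain because all nonzero members contain [A]. *)
have line (U V : 'M_n) : (U :&: V)%MS = 0 -> row_full (U + V)%MS ->
    (A :&: U)%MS != 0 -> exists e, [/\ e *m e = e, \rank e = 1%N,
    stablemx U e, stablemx V e & {in C, forall X, stablemx X e}].
  move=> UV _ /rowV0Pn[z]; rewrite sub_capmx => /andP[zA zU] nz.
  have [|f fV fz] := @separating_functional _ z V.
    by apply: contra nz => zV; rewrite -submx0 -UV sub_capmx zU.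
  have [ee re] := rank1_idempotent fz; exists (f *m z); split=> //.
  - by apply: stable_rank1; left.
  - by apply: stable_rank1; right.
  move=> X XC; have [->|nX] := eqVneq X 0; first by rewrite stable0mx.
  by apply: stable_rank1; left; apply: submx_trans (minA X XC nX).
have [/eqP AU0|nA] := boolP ((A :&: U0)%MS == 0); last first.
  have [e [ee re e0 e1 eC]] := line U0 U1 U01 fU nA.
  by exists e; split; [by []|exact: rk1|by []|exact: eC|by left].
have [/eqP AU1|nA] := boolP ((A :&: U1)%MS == 0); last first.
  have [||e [ee re e1 e0 eC]] := line U1 U0 _ _ nA.
  - by rewrite capmxC.
  - by rewrite addsmxC.
  by exists e; split; [by []|exact: rk1|by []|exact: eC|by left].
(* Since [A] meets neither [U0] nor [U1], both components of a nonzero vector of [A] are nonzero and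
   lie outside [A]. *)
have /rowV0Pn[x xA nx] := PA.
pose p0 := proj_mx U0 U1; pose p1 := proj_mx U1 U0.
have U10 : (U1 :&: U0)%MS = 0 by rewrite capmxC.
have xU : (x <= U0 + U1)%MS by rewrite submx_full.
pose u0 := x *m p0; pose u1 := x *m p1.
have u0U : (u0 <= U0)%MS by apply: proj_mx_sub.
have u1U : (u1 <= U1)%MS by apply: proj_mx_sub.
have xE : u0 + u1 = x by rewrite /u0 /u1 add_proj_mx.
have [u0p0 u0p1] : u0 *m p0 = u0 /\ u0 *m p1 = 0.
  by split; [apply: proj_mx_id | apply: proj_mx_0].
have [u1p1 u1p0] : u1 *m p1 = u1 /\ u1 *m p0 = 0.
  by split; [apply: proj_mx_id | apply: proj_mx_0].
have U0p1 : U0 *m p1 = 0 by apply: proj_mx_0.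
have U1p0 : U1 *m p0 = 0 by apply: proj_mx_0.
have p01 (X : 'M_n) : X *m p0 + X *m p1 = X.
  by rewrite add_proj_mx // submx_full.
clearbody u0 u1 p0 p1.
have nu (u : 'rV_n) (U : 'M_n) : (u <= U)%MS -> (A :&: U)%MS = 0 ->
    u != 0 -> ~~ (u <= A)%MS.
  by move=> uU AU; apply: contra => uA; rewrite -submx0 -AU sub_capmx uA.
have nu0 : u0 != 0.
  apply: contraTneq xA => u00; move: xE; rewrite u00 add0r => u1x.
  by apply: (nu x U1); rewrite // -[X in (X <= _)%MS]u1x.
have nu1 : u1 != 0.
  apply: contraTneq xA => u10; move: xE; rewrite u10 addr0 => u0x.
  by apply: (nu x U0); rewrite // -[X in (X <= _)%MS]u0x.
have u0A : ~~ (u0 <= A)%MS by apply: nu AU0 nu0.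
have AC' : A \in C.
  by move: AC u0A; rewrite inE => /orP[/eqP->|//]; rewrite submx1.
(* The chain is cut by membership of [u0]. The functional [f] is 1 at [u0] and kills the lower side,
   hence [x], so it is -1 at [u1]. *)
have [||A1 [B1 [A1C PA1 B1C PB1 AB1]]] :=
  chain_cut (P := fun X => (u0 <= X)%MS) chC.
- by rewrite submx1.
- by rewrite submx0.
have xB1 : (x <= B1)%MS by apply: submx_trans xA _; have [_] := AB1 A AC'; apply.
have [f fB fu0] := separating_functional PB1.
have fx : x *m f = 0 by apply: mulmx0_sub xB1 fB.
have fu1 : u1 *m f = - 1%:M.
  by apply/eqP; rewrite -subr_eq0 opprK -fu0 -mulmxDl addrC xE fx.
(* A projection onto the plane of [u0] and [u1]; the sign makes [u1] fixed. On members below the cut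
   both coordinates agree, so the image lies in the line of [x]; nonzero members above it contain
   both [u0] and [u1]. *)
pose e := p0 *m f *m u0 - p1 *m f *m u1.
have eu0 : u0 *m e = u0.
  by rewrite mulmxBr !mulmxA u0p0 u0p1 !mul0mx fu0 mul1mx subr0.
have eu1 : u1 *m e = u1.
  by rewrite mulmxBr !mulmxA u1p0 u1p1 !mul0mx fu1 mulNmx mul1mx sub0r opprK.
have eB1 (X : 'M_n) : (X <= B1)%MS -> X *m e = X *m p0 *m f *m x.
  move=> XB; have E : X *m p1 *m f = - (X *m p0 *m f).
    apply/eqP; rewrite -addr_eq0 -mulmxDl addrC p01.
    by rewrite (mulmx0_sub XB fB).
  by rewrite mulmxBr !mulmxA E mulNmx opprK -mulmxDr xE.
exists e; split.
- by rewrite {1}/e mulmxBl -!mulmxA eu0 eu1 /e !mulmxA.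
- by apply: contra nu0 => /eqP e0; rewrite -eu0 e0 mulmx0.
- rewrite !mulmxBr !mulmxA U0p1 U1p0 !mul0mx subr0 sub0r eqmx_opp.
  by split; rewrite (submx_trans (submxMl _ _)).
- move=> X XC; have [PX QX] := AB1 X XC; rewrite mulmxBr !mulmxA.
  have [->|nX] := eqVneq X 0; first by rewrite !mul0mx subr0 sub0mx.
  have xX : (x <= X)%MS by apply: submx_trans xA (minA _ XC nX).
  have [u0X|/QX XB] := boolP (u0 <= X)%MS.
    rewrite addmx_sub ?eqmx_opp //.
      exact: submx_trans (submxMl _ _) u0X.
    apply: submx_trans (submxMl _ _) _.
    by rewrite -(addKr u0 u1) xE addmx_sub ?eqmx_opp.
  have := eB1 X XB; rewrite mulmxBr !mulmxA => ->.
  exact: submx_trans (submxMl _ _) xX.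
(* If this plane is everything, then [A], being below the cut, equals its image under [e] and is the
   line of [x]; a member of rank one contains [A]. *)
right=> e1; exists u0, u1.
have full : row_full (col_mx u0 u1).
  rewrite -sub1mx -e1 -addsmxE addmx_sub ?eqmx_opp //.
    by rewrite (submx_trans (submxMl _ _)) ?addsmxSl.
  by rewrite (submx_trans (submxMl _ _)) ?addsmxSr.
have free : row_free (col_mx u0 u1).
  rewrite -row_leq_rank -addsmxE mxrank_disjoint_sum ?rank_rV ?nu0 ?nu1 //.
  by apply/eqP; rewrite -submx0 -U01 capmxS.
have Ue m (V : 'M_(m, n)) : V *m e = V by rewrite e1 mulmx1.
split=> //.
- split; apply/eqmxP; rewrite (u0U, u1U) andbT -[X in (X <= _)%MS]Ue mulmxBr !mulmxA.
    by rewrite U0p1 !mul0mx subr0 submxMl.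
  by rewrite U1p0 !mul0mx sub0r eqmx_opp submxMl.
- exists A => //; apply/eqP; rewrite eqn_leq lt0n mxrank_eq0 PA andbT.
  rewrite -(Ue _ A) eB1; last by have [_] := AB1 A AC'; apply.
  exact: leq_trans (mxrankM_maxr _ _) (rank_leq_row _).
move=> X XC rX; have nX : X != 0 by rewrite -mxrank_eq0 rX.
have xX := submx_trans xA (minA X XC nX).
apply/eqmxP; rewrite xE andbC.
by rewrite -(mxrank_leqif_eq xX) rX rank_rV nx.
Qed.
End Chains.

(** * Single maps seen from the root *)

Section Steps.
Variables (k : fieldType) (m n : nat).

(* A linear map between a space of dimension m and a space of dimension n which
   is further away from the root; rows are vectors, matrices act on the right. *)
Inductive step := Out of 'M[k]_(m, n) | In of 'M[k]_(n, m).
Implicit Types (s : step) (f : 'M[k]_m) (g : 'M[k]_n).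

Definition is_out s := if s is Out _ then true else false.

Definition good s := match s with Out G => row_full G | In G => row_free G end.

Definition bij s :=
  match s with
  | Out G => row_full G && row_free G
  | In G => row_full G && row_free G
  end.

Definition step_hom s s' f g : Prop :=
  match s, s' with
  | Out G, Out G' => f *m G' = G *m g
  | In G, In G' => g *m G' = G *m f
  | _, _ => False
  end.

Definition push s s' f : 'M[k]_n :=
  match s, s' with
  | Out G, Out G' => pinvmx G *m f *m G'
  | In G, In G' => G *m f *m pinvmx G'
  | _, _ => 0
  end.

(** A good step identifies the outer space with the quotient by the flag ([Out]) or with the flag
    itself ([In]). Taking [<<_>>] gives both cases the same square type. *)
Definition flag s : 'M[k]_m :=
  match s with Out G => kermx G | In G => <<G>>%MS end.

Definition transport s (D : 'M[k]_n) : 'M[k]_m :=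
  match s with Out G => kermx (G *m cokermx D) | In G => <<D *m G>>%MS end.

Definition pullback s (C : seq 'M[k]_n) : seq 'M[k]_m :=
  flag s :: map (transport s) C.

Definition maps_chain p (f : 'M[k]_p) : rel (seq 'M[k]_p) :=
  all2 (fun A A' => (A *m f <= A')%MS).

Lemma maps_chain_stable p (f : 'M[k]_p) (C : seq 'M[k]_p) :
  {in C, forall X, stablemx X f} -> maps_chain f C C.
Proof.
elim: C => //= X C IH XC; rewrite (XC X) ?mem_head //=.
by apply: IH => Y YC; apply: XC; rewrite inE YC orbT.
Qed.

Lemma sub_preimage p (W : 'M[k]_(p, m)) (G : 'M_(m, n)) (D : 'M_n) :
  (W <= kermx (G *m cokermx D))%MS = (W *m G <= D)%MS.
Proof. by rewrite sub_kermx mulmxA submxE. Qed.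

Lemma flag_sub_transport s D :
  (transport s D <= flag s)%MS || (flag s <= transport s D)%MS.
Proof.
case: s => G /=; last by rewrite !genmxE submxMl.
by rewrite sub_preimage mulmx_ker sub0mx orbT.
Qed.

Lemma transportS s (D D' : 'M_n) : (D <= D')%MS -> (transport s D <= transport s D')%MS.
Proof.
case: s => G /= DD; last by rewrite !genmxE submxMr.
by rewrite sub_preimage (submx_trans _ DD) // -sub_preimage.
Qed.

(** Preimages contain the kernel and images of subspaces lie in the image, so the new flag is
    comparable with every transported member. *)
Lemma pullback_chain s C : is_chain C -> is_chain (pullback s C).
Proof.
move=> chC A B; rewrite !inE =>
  /orP[/eqP->|/mapP[D DC ->]] /orP[/eqP->|/mapP[D' DC' ->]].
- by rewrite submx_refl.
- by rewrite orbC flag_sub_transport.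
- by rewrite flag_sub_transport.
by have /orP[] := chC D D' DC DC' => /(transportS s) ->; rewrite ?orbT.
Qed.

(** Respecting the flags makes [f] descend to the quotients or restrict to the subspaces; the
    transported members record the conditions still to be met further out. *)
Lemma push_hom s s' f C C' : good s -> good s' -> is_out s = is_out s' ->
  maps_chain f (pullback s C) (pullback s' C') ->
  step_hom s s' f (push s s' f) /\ maps_chain (push s s' f) C C'.
Proof.
case: s s' => [] G [] // G' /= gG gG' _ /andP[ff fC].
  have Gf : G *m (pinvmx G *m f *m G') = f *m G'.
    have : ((1%:M - G *m pinvmx G) *m f <= kermx G')%MS.
      apply: submx_trans ff; rewrite submxMr //; apply/sub_kermxP.
      by rewrite mulmxBl mul1mx -mulmxA mulVpmx // mulmx1 subrr.
    move/sub_kermxP; rewrite !mulmxBl mul1mx !mulmxA => /eqP.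
    by rewrite subr_eq0 => /eqP ->.
  split; first by rewrite Gf.
  elim: C C' fC {ff} => [|D C IH] [|D' C'] //= /andP[fD /IH ->]; rewrite andbT.
  rewrite 2!(mulmxA D) -sub_preimage; apply: submx_trans fD; rewrite submxMr //.
  by rewrite sub_preimage -mulmxA mulVpmx // mulmx1.
split.
  rewrite mulmxKpV //; move: ff; rewrite genmxE.
  by apply: submx_trans; rewrite submxMr // genmxE.
elim: C C' fC {ff} => [|D C IH] [|D' C'] //= /andP[fD /IH ->]; rewrite andbT.
move: fD; rewrite genmxE => fD.
have /submxP[Y YE] : (D *m G *m f <= D' *m G')%MS.
  by apply: submx_trans fD; rewrite submxMr // genmxE.
by rewrite 2!(mulmxA D) YE (mulmxA Y) mulmxKp // submxMl.
Qed.

Lemma bij_good s : bij s -> good s.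
Proof. by case: s => G /= /andP[]. Qed.

Lemma bij_dim s : bij s -> m = n.
Proof.
case: s => G /= /andP[]; rewrite -col_leq_rank -row_leq_rank => a b; apply/eqP.
  by rewrite eqn_leq (leq_trans b (rank_leq_col _)) (leq_trans a (rank_leq_row _)).
by rewrite eqn_leq (leq_trans b (rank_leq_col _)) (leq_trans a (rank_leq_row _)).
Qed.

Lemma good_dim s : good s -> (n <= m)%N.
Proof.
case: s => G /=; rewrite -?col_leq_rank -?row_leq_rank => /leq_trans; apply.
  exact: rank_leq_row.
exact: rank_leq_col.
Qed.

Lemma good_bij s : good s -> m = n -> bij s.
Proof.
case: s => G /= gG e; rewrite gG ?andbT //=.
  rewrite -row_leq_rank; apply: leq_trans (_ : (n <= _)%N); first by rewrite e.
  by rewrite col_leq_rank.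
rewrite -col_leq_rank; apply: leq_trans (_ : (n <= _)%N); first by rewrite e.
by rewrite row_leq_rank.
Qed.

(** The flag of a bijective step is zero or everything and puts no condition on [f]. *)
Lemma push_bij s s' f : bij s -> bij s' -> is_out s = is_out s' ->
  step_hom s s' f (push s s' f).
Proof.
move=> bs bs' o; have [] // :=
  @push_hom s s' f [::] [::] (bij_good bs) (bij_good bs') o.
case: s s' bs bs' o => [] G [] G' //= /andP[fu fr] /andP[fu' fr'] _.
  by move: fr; rewrite -kermx_eq0 => /eqP->; rewrite mul0mx sub0mx.
by rewrite andbT submx_full // -sub1mx genmxE sub1mx.
Qed.

Lemma step_hom_uniq s s' f g g' : good s -> good s' ->
  step_hom s s' f g -> step_hom s s' f g' -> g = g'.
Proof.
case: s s' => [] G [] G' //= gG gG' h; first by rewrite h; apply: row_full_inj.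
by rewrite -h => /esym; apply: row_free_inj.
Qed.

Lemma step_hom_unit s s' f g : good s -> good s' ->
  step_hom s s' f g -> f \in unitmx -> g \in unitmx.
Proof.
rewrite -row_free_unit -row_full_unit.
case: s s' => [] G [] G' //= gG gG' h; rewrite -row_leq_rank -col_leq_rank => fu.
  apply: leq_trans (mxrankM_maxr G g); rewrite -h.
  rewrite eqmxMfull; last by rewrite -col_leq_rank.
  by rewrite col_leq_rank.
apply: leq_trans (mxrankM_maxl g G'); rewrite h mxrankMfree.
  by rewrite row_leq_rank.
by rewrite -row_leq_rank.
Qed.

Lemma step_hom_comp s s' s'' f g f' g' : step_hom s s' f g -> step_hom s' s'' f' g' ->
  step_hom s s'' (f *m f') (g *m g').
Proof.
case: s s' s'' => [] G [] G' [] G'' //= h h'.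
  by rewrite -mulmxA h' mulmxA h mulmxA.
by rewrite -mulmxA h' mulmxA h mulmxA.
Qed.

Lemma step_hom0 s : step_hom s s 0 0.
Proof. by case: s => G /=; rewrite !mulmx0 !mul0mx. Qed.

Lemma step_hom_scalar s a : step_hom s s a%:M a%:M.
Proof. by case: s => G /=; rewrite scalar_mxC. Qed.

Lemma step_hom_dim0 s s' f g : is_out s = is_out s' -> m = 0%N \/ n = 0%N ->
  step_hom s s' f g.
Proof.
by case: s s' => [] G [] G' //= _ mn; apply/matrixP=> i j;
   have := ltn_ord i; have := ltn_ord j; case: mn => {2}->.
Qed.

Lemma rank_flag s : good s -> \rank (flag s) = if is_out s then (m - n)%N else n.
Proof.
case: s => G /=; rewrite -?col_leq_rank -?row_leq_rank => gG.
  rewrite mxrank_ker; congr (_ - _)%N; apply/eqP.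
  by rewrite eqn_leq gG rank_leq_col.
by rewrite mxrank_gen; apply/eqP; rewrite eqn_leq gG rank_leq_row.
Qed.

Lemma rank_transport s D : good s ->
  \rank (transport s D) = if is_out s then (m - (n - \rank D))%N else \rank D.
Proof.
case: s => G /= gG; last by rewrite mxrank_gen mxrankMfree.
by rewrite mxrank_ker eqmxMfull // mxrank_coker.
Qed.

(** For good steps the ranks depend only on dimensions and orientation; this is how a dimension
    vector controls the chains. *)
Lemma rank_pullback s s' C C' : good s -> good s' -> is_out s = is_out s' ->
  map mxrank C = map mxrank C' ->
    map mxrank (pullback s C) = map mxrank (pullback s' C').
Proof.
move=> gs gs' o CC /=; rewrite !rank_flag // o; congr (_ :: _).
elim: C C' CC => [|D C IH] [|D' C'] //= [DD /IH->]; congr (_ :: _).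
by rewrite !rank_transport // o DD.
Qed.

End Steps.

(** * Systems of maps on the tree and the consequences of rigidity *)

Section Systems.
Variables (k : fieldType) (d : nat -> nat).

(* The arms are the steps from the vertex 2 to the vertices 0 and 1. *)
Record system := System {
  tail : forall x, step k (d x) (d x.+1);
  arm0 : step k (d 2) (d 0);
  arm1 : step k (d 2) (d 1) }.
Implicit Types (S : system) (f g : forall x, 'M[k]_(d x)).

Definition system_hom S S' f :=
  [/\ forall x, (2 <= x)%N -> step_hom (tail S x) (tail S' x) (f x) (f x.+1),
      step_hom (arm0 S) (arm0 S') (f 2) (f 0) &
      step_hom (arm1 S) (arm1 S') (f 2) (f 1)].

Definition same_orientation S S' :=
  [/\ forall x, (2 <= x)%N -> is_out (tail S x) = is_out (tail S' x),
      is_out (arm0 S) = is_out (arm0 S') & is_out (arm1 S) = is_out (arm1 S')].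

Definition good_from S r := forall x, (r <= x)%N -> good (tail S x).
Definition bij_from S r := forall x, (r <= x)%N -> bij (tail S x).
Definition good_system S :=
  [/\ good_from S 2, good (arm0 S) & good (arm1 S)].

(** The conditions that the next [m] steps impose on an endomorphism, expressed as subspaces of the
    space at [x] itself. *)
Fixpoint tail_chain S m x : seq 'M[k]_(d x) :=
  if m is m'.+1 then pullback (tail S x) (tail_chain S m' x.+1) else [::].

Lemma tail_chain_chain S m x : is_chain (tail_chain S m x).
Proof. by elim: m x => [|m IH] x //=; apply/pullback_chain/IH. Qed.

Lemma rank_tail_chain S S' m x : (2 <= x)%N -> good_from S x -> good_from S' x ->
  same_orientation S S' ->
  map mxrank (tail_chain S m x) = map mxrank (tail_chain S' m x).
Proof.
move=> x2 + + [o _ _]; elim: m x x2 => //= m IH x x2 gS gS'.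
apply: rank_pullback; [exact: gS|exact: gS'|exact: o|].
by apply: IH => [|y /ltnW|y /ltnW]; [exact: leqW|exact: gS|exact: gS'].
Qed.

Fixpoint extend S S' r f x : 'M[k]_(d x) :=
  if x is y.+1 return 'M_(d x) then
    if (r <= y)%N then push (tail S y) (tail S' y) (extend S S' r f y) else f y.+1
  else f 0.

Lemma extend_le S S' r f x : (x <= r)%N -> extend S S' r f x = f x.
Proof. by case: x => //= y; rewrite ltnNge => /negPf->. Qed.

Lemma extendS S S' r f x : (r <= x)%N ->
  extend S S' r f x.+1 = push (tail S x) (tail S' x) (extend S S' r f x).
Proof. by move=> /= ->. Qed.

(** The invariant is that the map at [x] respects the chain of the steps between [x] and [n]. This
    list loses one entry at each push and is empty from [n] on, where steps are bijective. *)
Lemma extend_hom S S' r n f : (2 <= r)%N -> good_from S r -> good_from S' r ->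
  bij_from S n -> bij_from S' n -> same_orientation S S' ->
  maps_chain (f r) (tail_chain S (n - r) r) (tail_chain S' (n - r) r) ->
  forall x, (r <= x)%N -> step_hom (tail S x) (tail S' x)
    (extend S S' r f x) (extend S S' r f x.+1).
Proof.
move=> r2 gS gS' bS bS' [o _ _] fr.
have key x : (r <= x)%N ->
    maps_chain (extend S S' r f x) (tail_chain S (n - x) x) (tail_chain S' (n - x) x) ->
  step_hom (tail S x) (tail S' x) (extend S S' r f x) (extend S S' r f x.+1) /\
  maps_chain (extend S S' r f x.+1) (tail_chain S (n - x.+1) x.+1)
    (tail_chain S' (n - x.+1) x.+1).
  move=> rx; rewrite extendS //; have ox := o x (leq_trans r2 rx).
  have [xn|nx] := ltnP x n.
    by rewrite -(subnSK xn) /=; apply: push_hom; [exact: gS|exact: gS'|].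
  have -> : (n - x.+1 = 0)%N by apply/eqP; rewrite subn_eq0 leqW.
  by split=> //; apply: push_bij; [exact: bS|exact: bS'|].
move=> x rx; apply: (proj1 (key x rx _)).
elim: x rx => [|x IH]; first by rewrite leqn0 => /eqP r0; rewrite r0 in r2.
rewrite leq_eqVlt => /orP[/eqP <-|rx]; first by rewrite extend_le.
by apply: (proj2 (key x rx _)); apply: IH.
Qed.

Lemma tail_hom_uniq S S' r f g : good_from S r -> good_from S' r ->
  (forall x, (r <= x)%N -> step_hom (tail S x) (tail S' x) (f x) (f x.+1)) ->
  (forall x, (r <= x)%N -> step_hom (tail S x) (tail S' x) (g x) (g x.+1)) ->
  f r = g r -> forall x, (r <= x)%N -> f x = g x.
Proof.
move=> gS gS' hf hg fg; elim=> [|x IH]; first by rewrite leqn0 => /eqP r0; subst r.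
rewrite leq_eqVlt => /orP[/eqP rx|rx]; first by subst r.
apply: step_hom_uniq (hf x rx) _; [exact: gS|exact: gS'|].
by rewrite (IH rx); apply: hg.
Qed.

Lemma system_hom_uniq S S' f g : good_system S -> good_system S' ->
  system_hom S S' f -> system_hom S S' g -> f 2 = g 2 -> forall x, f x = g x.
Proof.
move=> [gS g0 g1] [gS' g0' g1'] [hf hf0 hf1] [hg hg0 hg1] fg [|[|x]].
- by apply: step_hom_uniq hf0 _ => //; rewrite fg.
- by apply: step_hom_uniq hf1 _ => //; rewrite fg.
- exact: tail_hom_uniq gS gS' hf hg fg _ _.
Qed.

Lemma tail_hom_unit S S' r f : good_from S r -> good_from S' r ->
  (forall x, (r <= x)%N -> step_hom (tail S x) (tail S' x) (f x) (f x.+1)) ->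
  f r \in unitmx -> forall x, (r <= x)%N -> f x \in unitmx.
Proof.
move=> gS gS' hf fr; elim=> [|x IH]; first by rewrite leqn0 => /eqP r0; subst r.
rewrite leq_eqVlt => /orP[/eqP rx|rx]; first by subst r.
by apply: step_hom_unit (hf x rx) (IH rx); [exact: gS|exact: gS'].
Qed.

Lemma tail_hom_idem S r f : good_from S r ->
  (forall x, (r <= x)%N -> step_hom (tail S x) (tail S x) (f x) (f x.+1)) ->
  f r *m f r = f r -> forall x, (r <= x)%N -> f x *m f x = f x.
Proof.
move=> gS hf fr; apply: (@tail_hom_uniq S S r (fun x => f x *m f x) f) => //.
by move=> x rx; apply: step_hom_comp (hf x rx) (hf x rx).
Qed.

(** The values beyond 2 are placeholders, overwritten by [extend]. *)
Definition set_root (e : 'M[k]_(d 2)) S S' x : 'M[k]_(d x) :=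
  match x return 'M[k]_(d x) with
  | 0 => push (arm0 S) (arm0 S') e
  | 1 => push (arm1 S) (arm1 S') e
  | 2 => e
  | _ => 0
  end.

Lemma root_hom S S' n e : good_system S -> good_system S' ->
  bij_from S n -> bij_from S' n -> same_orientation S S' ->
  maps_chain e (tail_chain S (n - 2) 2) (tail_chain S' (n - 2) 2) ->
  (flag (arm0 S) *m e <= flag (arm0 S'))%MS ->
  (flag (arm1 S) *m e <= flag (arm1 S'))%MS ->
  exists2 f, system_hom S S' f & f 2 = e.
Proof.
move=> [gS g0 g1] [gS' g0' g1'] bS bS' oS ec e0 e1.
have [o o0 o1] := oS.
exists (extend S S' 2 (set_root e S S')) => //; split.
- exact: (@extend_hom S S' 2 n).
- by have [] // := @push_hom _ _ _ (arm0 S) (arm0 S') e [::] [::] g0 g0' o0;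
     rewrite /= e0.
- by have [] // := @push_hom _ _ _ (arm1 S) (arm1 S') e [::] [::] g1 g1' o1;
     rewrite /= e1.
Qed.

(** The form in which indecomposability of a representation is used for its system. *)
Definition rigid S := forall f, (forall x, f x *m f x = f x) -> system_hom S S f ->
  (forall x, f x = 0) \/ (forall x, f x = 1%:M).

Definition at_vertex r (e : 'M[k]_(d r)) x : 'M[k]_(d x) :=
  if x == r then conform_mx 0 e else 0.

Lemma at_vertexE r (e : 'M[k]_(d r)) : at_vertex e r = e.
Proof. by rewrite /at_vertex eqxx conform_mx_id. Qed.

Lemma at_vertexN r (e : 'M[k]_(d r)) x : x != r -> at_vertex e x = 0.
Proof. by rewrite /at_vertex => /negPf->. Qed.

Lemma dim_eq0 m : 1%:M = 0 :> 'M[k]_m -> m = 0%N.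
Proof. by move=> e; have := mxrank1 k m; rewrite e mxrank0. Qed.

(** Failure of surjectivity gives an [e] killing the image, failure of injectivity one with image in
    the kernel. Either is compatible with zero on the root side, and preserving [C] lets it extend
    outwards. *)
Lemma bad_step_idempotent m n (s : step k m n) (C : seq 'M[k]_n) :
  is_chain C -> ~~ good s ->
  exists e, [/\ e *m e = e, \rank e = 1%N, step_hom s s 0 e &
                {in C, forall X, stablemx X e}].
Proof.
move=> chC; case: s => G /= bG.
  have [e [ee re Ge eC]] := idempotent_killing chC bG.
  by exists e; rewrite mul0mx Ge.
rewrite -kermx_eq0 in bG.
have [e [ee re /sub_kermxP Ge eC]] := idempotent_into chC bG.
by exists e; rewrite mulmx0 Ge.
Qed.

(** The idempotent lives at the leaf alone; rigidity makes it the identity, so all other spaces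
    vanish. *)
Lemma rigid_arm0 S : rigid S -> ~~ good (arm0 S) ->
  d 0 = 1%N /\ forall x, x != 0%N -> d x = 0%N.
Proof.
move=> rS bad; have chC : is_chain ([::] : seq 'M[k]_(d 0)) by [].
have [e [ee re e0 _]] := bad_step_idempotent chC bad.
have e2 x : (2 <= x)%N -> at_vertex e x = 0.
  by move=> x2; apply: at_vertexN; case: x x2 => [|[]].
have [x||f0|f1] := rS (at_vertex e).
- by have [->|nx] := eqVneq x 0%N; rewrite ?at_vertexE // at_vertexN ?mulmx0.
- split; rewrite ?at_vertexE ?(e2 2%N) // ?at_vertexN //; try exact: step_hom0.
  by move=> x x2; rewrite !e2 ?leqW //; apply: step_hom0.
- by move: re; rewrite -(at_vertexE e) f0 mxrank0.
split; first by rewrite -(mxrank1 k (d _)) -f1 at_vertexE.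
by move=> x nx; apply: dim_eq0; rewrite -f1 at_vertexN.
Qed.

Lemma rigid_arm1 S : rigid S -> ~~ good (arm1 S) ->
  d 1 = 1%N /\ forall x, x != 1%N -> d x = 0%N.
Proof.
move=> rS bad; have chC : is_chain ([::] : seq 'M[k]_(d 1)) by [].
have [e [ee re e0 _]] := bad_step_idempotent chC bad.
have e2 x : (2 <= x)%N -> at_vertex e x = 0.
  by move=> x2; apply: at_vertexN; case: x x2 => [|[]].
have [x||f0|f1] := rS (at_vertex e).
- by have [->|nx] := eqVneq x 1%N; rewrite ?at_vertexE // at_vertexN ?mulmx0.
- split; rewrite ?at_vertexE ?(e2 2%N) // ?at_vertexN //; try exact: step_hom0.
  by move=> x x2; rewrite !e2 ?leqW //; apply: step_hom0.
- by move: re; rewrite -(at_vertexE e) f0 mxrank0.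
split; first by rewrite -(mxrank1 k (d _)) -f1 at_vertexE.
by move=> x nx; apply: dim_eq0; rewrite -f1 at_vertexN.
Qed.

(** The steps beyond [x] being good, the idempotent at [x.+1] extends outwards and is zero at all
    vertices up to [x]. *)
Lemma rigid_tail S n x : rigid S -> (2 <= x)%N -> ~~ good (tail S x) ->
  good_from S x.+1 -> bij_from S n ->
  d x.+1 = 1%N /\ forall y, (y <= x)%N -> d y = 0%N.
Proof.
move=> rS x2 bad gS bS; set r := x.+1.
have chC := @tail_chain_chain S (n - r) r.
have [e [ee re e0 eC]] := bad_step_idempotent chC bad.
pose f := extend S S r (at_vertex e).
have fr : f r = e by rewrite /f extend_le // at_vertexE.
have fl y : (y < r)%N -> f y = 0.
  by move=> yr; rewrite /f extend_le 1?ltnW // at_vertexN // neq_ltn yr.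
have hf y : (r <= y)%N -> step_hom (tail S y) (tail S y) (f y) (f y.+1).
  apply: (@extend_hom S S r n) => //; first exact: leqW.
  by rewrite at_vertexE; apply: maps_chain_stable.
have [y||f0|f1] := rS f.
- have [yr|ry] := ltnP y r; first by rewrite fl ?mulmx0.
  by apply: tail_hom_idem gS hf _ _ ry; rewrite fr.
- split.
  + move=> y y2; have [yx|yx|->] := ltngtP y x.
    * have -> : f y = 0 by apply: fl; rewrite ltnS ltnW.
      by rewrite fl //; apply: step_hom0.
    * exact: hf.
    * by rewrite fr fl.
  + by rewrite !fl ?ltnS //; apply: step_hom0.
  + by rewrite !fl ?ltnS // 1?ltnW //; apply: step_hom0.
- by move: re; rewrite -fr f0 mxrank0.
split; first by rewrite -/r -re -fr f1 mxrank1.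
by move=> y yx; apply: dim_eq0; rewrite -f1 fl.
Qed.

Lemma good_dim_le S x y : good_from S x -> (x <= y)%N -> (d y <= d x)%N.
Proof.
move=> gS; elim: y => [|y IH]; first by rewrite leqn0 => /eqP->.
rewrite leq_eqVlt => /orP[/eqP->//|xy].
exact: leq_trans (good_dim (gS y xy)) (IH xy).
Qed.

Variant rigid_spec S n : Prop :=
| RigidArm r of (r < 2)%N & d r = 1%N & (forall x, x != r -> d x = 0%N)
| RigidTail r of (2 < r)%N & d r = 1%N & (forall x, (x < r)%N ->
  d x = 0%N) & good_from S r
| RigidThin of good_system S & d 2 = 1%N
| RigidPlane u0 u1 of good_system S &
    three_lines (tail_chain S (n - 2) 2) (flag (arm0 S)) (flag (arm1 S)) u0 u1.

Lemma rigidP S n : rigid S -> (exists x, d x != 0) -> bij_from S n -> rigid_spec S n.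
Proof.
move=> rS [z nz] bS.
have [gS|] := boolP [forall x : 'I_n, (2 <= x)%N ==> good (tail S x)]; last first.
  move=> /forallPn[x0 /=]; rewrite negb_imply => bad0.
  have exP : exists x, (x < n)%N && ((2 <= x)%N && ~~ good (tail S x)).
    by exists x0; rewrite ltn_ord.
  (* The last bad step is the one whose idempotent can be extended outwards. *)
  have [x /andP[xn /andP[x2 bx]] xmax] := ex_maxnP exP (m := n) (fun i h =>
    ltnW (proj1 (andP h))).
  have gx : good_from S x.+1.
    move=> y xy; have [yn|ny] := ltnP y n; last by apply: bij_good; apply: bS.
    apply/negPn/negP => by'; have := xmax y; rewrite yn by' (leq_trans x2 (ltnW xy)).
    by move/(_ isT); rewrite leqNgt xy.
  have [dr dl] := rigid_tail rS x2 bx gx bS.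
  by apply: (@RigidTail _ _ x.+1) => //.
have {}gS : good_from S 2.
  move=> x x2; have [xn|nx] := ltnP x n; last by apply: bij_good; apply: bS.
  by move/forallP: gS => /(_ (Ordinal xn)) /implyP; apply.
have [g0|b0] := boolP (good (arm0 S)); last first.
  by have [d0 dx] := rigid_arm0 rS b0; apply: (@RigidArm _ _ 0).
have [g1|b1] := boolP (good (arm1 S)); last first.
  by have [d0 dx] := rigid_arm1 rS b1; apply: (@RigidArm _ _ 1).
have gsS : good_system S by [].
have d2 : (0 < d 2)%N.
  rewrite lt0n; apply: contra nz => /eqP d20; rewrite -leqn0 -d20.
  case: z => [|[|z]]; [exact: good_dim g0|exact: good_dim g1|exact: good_dim_le gS _].
have [e [ee ne [e0 e1] eC rk]] := idempotent_two_subspaces (flag (arm0 S))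
  (flag (arm1 S)) d2 (@tail_chain_chain S (n - 2) 2).
have [|f hf f2] := root_hom gsS gsS bS bS _ (maps_chain_stable eC) e0 e1;
  first by split.
(* Both [f] and its square extend [e], so uniqueness of extensions makes [f] idempotent
   everywhere. *)
have hff : system_hom S S (fun x => f x *m f x).
  by case: hf => hf h0 h1; split=> [x x2||];
     [exact: (step_hom_comp (hf x x2) (hf x x2))|exact: (step_hom_comp h0 h0)|exact:
       (step_hom_comp h1 h1)].
have [x|//|f0|f1] := rS f.
- by apply: (system_hom_uniq gsS gsS hff hf); rewrite f2.
- by move: ne; rewrite -f2 f0 eqxx.
case: rk => [re|]; first by apply: RigidThin => //; rewrite -(mxrank1 k (d 2)) -f1 f2.
by rewrite -f2 f1 => /(_ erefl)[u0 [u1 L]]; apply: RigidPlane L.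
Qed.

Lemma maps_chain_rank p (f : 'M[k]_p) (C C' : seq 'M[k]_p) :
  map mxrank C = map mxrank C' ->
  (forall A A', A \in C -> A' \in C' -> \rank A = \rank A' -> (A *m f <= A')%MS) ->
  maps_chain f C C'.
Proof.
elim: C C' => [|A C IH] [|A' C'] //= [AA CC] h; rewrite h ?mem_head //=.
by apply: IH => // B B' BC BC'; apply: h; rewrite inE (BC, BC') orbT.
Qed.

Lemma sub_rank_line p (A A' : 'M[k]_p) : (p <= 1)%N -> \rank A = \rank A' ->
  (A <= A')%MS.
Proof.
move=> p1 AA; have [/eqP|] := eqVneq (\rank A) 0%N.
  by rewrite mxrank_eq0 => /eqP->; rewrite sub0mx.
rewrite -lt0n AA => r0; apply: submx_full; rewrite -col_leq_rank.
exact: leq_trans p1 r0.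
Qed.

(** At the first nonzero vertex both spaces are lines and corresponding chain members have equal
    rank, so the identity there respects the chains and extends. *)
Lemma tail_iso S S' r n : (2 < r)%N -> d r = 1%N ->
  (forall x, (x < r)%N -> d x = 0%N) -> good_from S r -> good_from S' r ->
  bij_from S n -> bij_from S' n -> same_orientation S S' ->
  exists2 f, system_hom S S' f & forall x, f x \in unitmx.
Proof.
move=> r2 dr dl gS gS' bS bS' oS; have [o o0 o1] := oS.
pose f := extend S S' r (fun x => 1%:M).
have hf x : (r <= x)%N -> step_hom (tail S x) (tail S' x) (f x) (f x.+1).
  apply: (@extend_hom S S' r n) => //; first exact: ltnW.
  apply: maps_chain_rank; first by apply: rank_tail_chain => //; apply: ltnW.
  by move=> A A' _ _ AA; rewrite mulmx1; apply: sub_rank_line; rewrite ?dr.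
exists f.
  split=> [x x2||]; last by apply: step_hom_dim0 => //; left; apply: dl.
    have [rx|xr] := leqP r x; first exact: hf.
    by apply: step_hom_dim0; [apply: o|left; apply: dl].
  by apply: step_hom_dim0 => //; left; apply: dl.
move=> x; have [rx|xr] := leqP r x.
  by apply: tail_hom_unit gS gS' hf _ _ rx; rewrite /f extend_le // unitmx1.
by rewrite /f extend_le ?unitmx1 // ltnW.
Qed.

Lemma root_iso S S' n e : good_system S -> good_system S' ->
  bij_from S n -> bij_from S' n -> same_orientation S S' -> e \in unitmx ->
  (forall A A', A \in tail_chain S (n - 2) 2 -> A' \in tail_chain S' (n - 2) 2 ->
     \rank A = \rank A' -> (A *m e <= A')%MS) ->
  (flag (arm0 S) *m e <= flag (arm0 S'))%MS ->
  (flag (arm1 S) *m e <= flag (arm1 S'))%MS ->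
  exists2 f, system_hom S S' f & forall x, f x \in unitmx.
Proof.
move=> gsS gsS' bS bS' oS ue eC e0 e1; have [gS g0 g1] := gsS; have [gS' g0' g1'] :=
  gsS'.
have [|f hf f2] := root_hom gsS gsS' bS bS' oS _ e0 e1.
  by apply: maps_chain_rank => //; apply: rank_tail_chain.
exists f => //; have [h h0 h1] := hf; rewrite -f2 in ue.
move=> [|[|x]]; [exact: step_hom_unit h0 ue|exact: step_hom_unit h1 ue|].
exact: tail_hom_unit gS gS' h ue _ _.
Qed.

Lemma thin_iso S S' n : good_system S -> good_system S' ->
  bij_from S n -> bij_from S' n -> same_orientation S S' -> d 2 = 1%N ->
  exists2 f, system_hom S S' f & forall x, f x \in unitmx.
Proof.
move=> gsS gsS' bS bS' oS d2; have [gS g0 g1] := gsS; have [gS' g0' g1'] := gsS'.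
have [o o0 o1] := oS.
apply: (root_iso (e := 1%:M)) bS bS' oS _ _ _ _ => //; first exact: unitmx1.
- by move=> A A' _ _ AA; rewrite mulmx1; apply: sub_rank_line; rewrite ?d2.
- by rewrite mulmx1; apply: sub_rank_line; rewrite ?d2 // !rank_flag // o0.
- by rewrite mulmx1; apply: sub_rank_line; rewrite ?d2 // !rank_flag // o1.
Qed.

Lemma three_lines_dim p (C : seq 'M[k]_p) U0 U1 u0 u1 : three_lines C U0 U1 u0 u1 ->
  [/\ p = 2%N, \rank U0 = 1%N & \rank U1 = 1%N].
Proof.
case; rewrite -row_leq_rank -col_leq_rank => fr fu [E0 E1] _ _; rewrite E0 E1 {E0 E1}.
have p2 : p = 2%N.
  apply/eqP; rewrite eqn_leq (leq_trans fu (rank_leq_row _)).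
  exact: leq_trans fr (rank_leq_col _).
move: fr; rewrite -addsmxE => /leq_trans/(_ (mxrank_adds_leqif u0 u1).1).
by have := rank_leq_row u0; have := rank_leq_row u1; split=> //; lia.
Qed.

(** The change of basis matching [u0], [u1] with [u0'], [u1'] also matches the diagonals; members of
    rank 0 and 2 cause no obstruction. *)
Lemma plane_iso S S' n u0 u1 u0' u1' : good_system S -> good_system S' ->
  bij_from S n -> bij_from S' n -> same_orientation S S' ->
  three_lines (tail_chain S (n - 2) 2) (flag (arm0 S)) (flag (arm1 S)) u0 u1 ->
  three_lines (tail_chain S' (n - 2) 2) (flag (arm0 S')) (flag (arm1 S')) u0' u1' ->
  exists2 f, system_hom S S' f & forall x, f x \in unitmx.
Proof.
move=> gsS gsS' bS bS' oS L L'.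
have [d2 _ _] := three_lines_dim L.
have [fr fu [F0 F1] _ FL] := L; have [fr' fu' [F0' F1'] _ FL'] := L'.
pose e := pinvmx (col_mx u0 u1) *m col_mx u0' u1'.
have : col_mx u0 u1 *m e = col_mx u0' u1' by rewrite mulmxA mulmxVp ?mul1mx.
have ue : col_mx u0 u1 *m e = col_mx u0' u1' -> e \in unitmx.
  move=> E; rewrite -row_full_unit -col_leq_rank; apply:
    leq_trans (mxrankM_maxr (col_mx u0 u1) e).
  by rewrite E col_leq_rank.
clearbody e => E; have {}ue := ue E.
move: E; rewrite mul_col_mx => /eq_col_mx[e0 e1].
apply: (root_iso (e := e)) bS bS' oS _ _ _ _ => //.
- move=> A A' AC AC' AA.
  have [/eqP|r0] := eqVneq (\rank A) 0%N.
    by rewrite mxrank_eq0 => /eqP->; rewrite mul0mx sub0mx.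
  have [r1|r1] := eqVneq (\rank A) 1%N.
    rewrite (eqmxMr e (FL A AC r1)) (FL' A' AC') -?AA //.
    by rewrite mulmxDl e0 e1 submx_refl.
  apply: submx_full; rewrite -col_leq_rank -AA.
  by apply: leq_trans (_ : (2 <= _)%N); [rewrite d2|case: (\rank A) r0 r1 => [|[]]].
- by rewrite (eqmxMr e F0) e0 F0'.
- by rewrite (eqmxMr e F1) e1 F1'.
Qed.

(** With dimensions 0 and 2 only, every flag has rank 0 or 2 and transport keeps it so. Hence a line
    in the chain forces a one-dimensional space on the tail. *)
Lemma rank_tail_chain_neq1 S m x : good_from S x ->
  (forall y, (x <= y)%N -> (d y <= 2)%N /\ d y != 1%N) ->
  {in tail_chain S m x, forall A, \rank A != 1%N}.
Proof.
elim: m x => [|m IH] x gS dx A //=.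
have gx := gS x (leqnn x).
have [a1 a2] := dx x (leqnn x); have [b1 b2] := dx x.+1 (leqnSn x).
rewrite inE => /orP[/eqP->|/mapP[D DC ->]].
  by rewrite rank_flag //; case: ifP => _; lia.
have {}IH := IH x.+1 (fun y h => gS y (ltnW h)) (fun y h => dx y (ltnW h)) D DC.
have := rank_leq_row D; rewrite rank_transport //; case: ifP => _; lia.
Qed.

Lemma bij_from_dim S n x : bij_from S n -> (n <= x)%N -> d x = d n.
Proof.
move=> bS; elim: x => [|x IH]; first by rewrite leqn0 => /eqP->.
rewrite leq_eqVlt => /orP[/eqP->//|nx].
by rewrite -(IH nx); apply/esym/bij_dim/(bS x nx).
Qed.

Lemma plane_dims S n u0 u1 : good_system S -> bij_from S n ->
  three_lines (tail_chain S (n - 2) 2) (flag (arm0 S)) (flag (arm1 S)) u0 u1 ->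
  [/\ d 0 = 1%N, d 1 = 1%N, d 2 = 2%N & exists2 x, (2 <= x)%N & d x = 1%N].
Proof.
move=> [gS g0 g1] bS L; have [d2 r0 r1] := three_lines_dim L.
split=> //.
- have := rank_flag g0; rewrite r0; have := good_dim g0; case: (is_out _); lia.
- have := rank_flag g1; rewrite r1; have := good_dim g1; case: (is_out _); lia.
have [_ _ _ [A AC rA] _] := L.
have nchain : ~ {in tail_chain S (n - 2) 2, forall A, \rank A != 1%N}.
  by move/(_ A AC); rewrite rA.
(* Dimensions are constant from [n] on and [n.+2] is at least 2, so testing the vertices below
   [n.+3] settles the whole tail. *)
have [x /andP[x2 /eqP dx] | all1] :=
    @pickP 'I_n.+3 (fun x => (2 <= x)%N && (d x == 1%N)); first by exists x.
case: nchain; apply: (rank_tail_chain_neq1 gS) => y y2.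
split; first by rewrite -d2; apply: good_dim_le gS y2.
have ne z : (z < n.+3)%N -> (2 <= z)%N -> d z != 1%N.
  by move=> zn z2; have := all1 (Ordinal zn); rewrite /= z2 /= => ->.
have [yn|ny] := ltnP y n.+3; first exact: ne.
rewrite (bij_from_dim bS) -1?(@bij_from_dim S n n.+2 bS); try lia.
by apply: ne.
Qed.

End Systems.

(** * Representations by matrices *)

Lemma linear_inverse (k : fieldType) (U V : lmodType k) (f : {linear U -> V}) :
  bijective f -> exists g : {linear V -> U}, cancel f g /\ cancel g f.
Proof.
case=> g fg gf.
have lin : linear g by move=> c x y; apply: (can_inj fg); rewrite linearP !gf.
pose gL : {linear V -> U} := HB.pack g (GRing.isLinear.Build k V U *:%R g lin).
by exists gL; split=> x; [apply: fg|apply: gf].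
Qed.

Lemma has_dim_unique (k : fieldType) (V : lmodType k) m n :
  has_dim V m -> has_dim V n -> m = n.
Proof.
have key p q : has_dim V p -> has_dim V q -> (p <= q)%N.
  move=> [f bf] [g bg]; have [f' [ff' f'f]] := linear_inverse bf.
  have inj (u : 'rV_p) : u *m lin1_mx (g \o f') = 0 -> u = 0.
    rewrite mul_rV_lin1 /= => e; rewrite -(f'f u) -[RHS](linear0 f); congr (f _).
    by apply: (bij_inj bg); rewrite e linear0.
  have : row_free (lin1_mx (g \o f')).
    by apply: inj_row_free.
  by rewrite -row_leq_rank => /leq_trans; apply; apply: rank_leq_col.
by move=> hm hn; apply/eqP; rewrite eqn_leq !key.
Qed.

Lemma row_dim0 (k : fieldType) n : (forall u : 'rV[k]_n, u = 0) -> n = 0%N.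
Proof.
case: n => // n /(_ (const_mx 1)) /rowP/(_ ord0).
by rewrite !mxE => /eqP; rewrite oner_eq0.
Qed.

Section Reps.
Variables (k : fieldType) (Q : quiver).
Implicit Types (M N L : rep k Q) (D : vertex Q -> nat).

Local Notation mats D := (forall b : arrow Q, 'M[k]_(D (src b), D (tgt b))).

Lemma rep_iso_refl M : rep_iso M M.
Proof.
by exists (@RepHom k Q M M (fun x => idfun) (fun a u => erefl)) => x; exists id.
Qed.

Lemma rep_iso_trans M N L : rep_iso M N -> rep_iso N L -> rep_iso M L.
Proof.
move=> [[f hf] bf] [[g hg] bg].
have h a u : (g (tgt a) \o f (tgt a)) (rmap M a u) = rmap L a ((g (src a) \o f (src
  a)) u).
  by rewrite /= hf hg.
by exists (@RepHom k Q M L (fun x => g x \o f x) h) => x; exact: bij_comp (bg x) (bf x).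
Qed.

Lemma rep_iso_sym M N : rep_iso M N -> rep_iso N M.
Proof.
move=> [[f hf] /= bf].
pose g x := sval (cid (linear_inverse (bf x))).
have [fg gf] : (forall x, cancel (f x) (g x)) /\ (forall x, cancel (g x) (f x)).
  by split=> x; rewrite /g; case: cid => ? [].
have h a u : g (tgt a) (rmap N a u) = rmap M a (g (src a) u).
  by apply: (can_inj (fg _)); rewrite gf hf gf.
by exists (@RepHom k Q N M g h) => x; exists (f x); [apply: gf|apply: fg].
Qed.

Lemma rep_iso_dim M N x n : rep_iso M N -> has_dim (space N x) n ->
  has_dim (space M x) n.
Proof.
by move=> [f bf] [g bg]; exists (g \o hmap f x); exact: bij_comp bg (bf x).
Qed.

Lemma indecomposable_iso M N : rep_iso M N -> indecomposable M -> indecomposable N.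
Proof.
move=> MN [nz dec]; split=> [zN|X Y NXY].
  apply: nz => x u; case: MN => f /(_ x) bf; apply: (bij_inj bf).
  by rewrite [RHS]zN [LHS]zN.
by apply: dec; apply: rep_iso_trans NXY.
Qed.

Definition mxrep (D : vertex Q -> nat) (F : mats D) : rep k Q :=
  @Rep k Q (fun x => 'rV[k]_(D x) : lmodType k) (fun b => mulmxr (F b)).

Lemma has_dim_mxrep D (F : mats D) x : has_dim (space (@mxrep D F) x) (D x).
Proof. by exists idfun; exists id. Qed.

Lemma mxrepP M : locally_finite_dim M -> exists D F, rep_iso M (@mxrep D F).
Proof.
move=> lM; pose D x := sval (cid (lM x)).
have dD x : has_dim (space M x) (D x) by rewrite /D; case: cid.
pose f x := sval (cid (dD x)).
have bf x : bijective (f x) by rewrite /f; case: cid.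
pose g x := sval (cid (linear_inverse (bf x))).
have fg x : cancel (f x) (g x) by rewrite /g; case: cid => ? [].
pose F b := lin1_mx (f (tgt b) \o rmap M b \o g (src b)).
have h b u : f (tgt b) (rmap M b u) = rmap (mxrep F) b (f (src b) u).
  by rewrite /= mul_rV_lin1 /= fg.
by exists D, F, (@RepHom k Q M (mxrep F) f h) => x; apply: bf.
Qed.

Definition mxrep_hom (D D' : vertex Q -> nat)
    (F : mats D)
    (F' : mats D')
    (f : forall x, 'M[k]_(D x, D' x)) :=
  forall b, f (src b) *m F' b = F b *m f (tgt b).

Lemma mxrep_iso D (F F' : mats D) (f : forall x, 'M[k]_(D x)) : mxrep_hom F F' f ->
  (forall x, f x \in unitmx) ->
  rep_iso (mxrep F) (mxrep F').
Proof.
move=> hf uf.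
have h b u : mulmxr (f (tgt b)) (rmap (mxrep F) b u) = rmap (mxrep F') b (mulmxr (f
  (src b)) u).
  by rewrite /= -!mulmxA hf.
exists (@RepHom k Q (mxrep F) (mxrep F') (fun x => mulmxr (f x)) h) => x /=.
by exists (mulmx^~ (invmx (f x))) => u /=; rewrite (mulmxK, mulmxKV).
Qed.

(** Write [e = C *m R]: the outer factors of [C *m R *m C *m R = C *m R] can be cancelled. *)
Lemma idempotent_base n (e : 'M[k]_n) : e *m e = e -> row_base e *m col_base e = 1%:M.
Proof.
have := mulmx_base e; have := row_base_free e; have := col_base_full e.
move: (col_base e) (row_base e) => C R fC fR CR ee.
apply: (row_full_inj fC); apply: (row_free_inj fR).
by rewrite mulmx1 CR !mulmxA CR -mulmxA CR.
Qed.

Lemma idempotent_col_base n (e : 'M[k]_n) : e *m e = e -> e *m col_base e = col_base e.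
Proof.
move=> /idempotent_base; have := mulmx_base e.
move: (col_base e) (row_base e) => C R CR RC.
by rewrite -[RHS]mulmx1 -RC (mulmxA C) CR.
Qed.

Lemma orthogonal_base n (e e' : 'M[k]_n) : e *m e' = 0 -> row_base e *m col_base e' = 0.
Proof.
have := mulmx_base e; have := col_base_full e.
have := mulmx_base e'; have := row_base_free e'.
move: (col_base e) (row_base e) (col_base e') (row_base e') =>
  C R C' R' fR' CR' fC CR ee.
apply: (row_full_inj fC); apply: (row_free_inj fR').
by rewrite mulmx0 mul0mx !mulmxA CR -mulmxA CR'.
Qed.

Definition pair_mx m n p (A : 'M[k]_(m, n)) (B : 'M[k]_(m, p)) (u : 'rV[k]_m) :
  ('rV[k]_n * 'rV[k]_p)%type := (u *m A, u *m B).

Lemma pair_mx_linear m n p A B : linear (@pair_mx m n p A B).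
Proof. by move=> c u v; rewrite /pair_mx !mulmxDl -!scalemxAl. Qed.

HB.instance Definition _ m n p A B :=
  GRing.isLinear.Build k 'rV[k]_m ('rV[k]_n * 'rV[k]_p)%type *:%R (@pair_mx m n p A B)
    (pair_mx_linear A B).

(** The image of [e] as a representation: for row vectors [row_base] is the inclusion of the image
    and [col_base] the projection onto it. *)
Definition corner D (F : mats D) (e : forall x, 'M[k]_(D x)) : rep k Q :=
  mxrep (D := fun x => \rank (e x))
    (fun b => row_base (e (src b)) *m F b *m col_base (e (tgt b))).

Lemma idempotent_decomposition D (F : mats D) (e : forall x, 'M[k]_(D x)) :
  (forall x, e x *m e x = e x) ->
  mxrep_hom F F e ->
  rep_iso (mxrep F) (dsum (corner F e) (corner F (fun x => 1%:M - e x))).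
Proof.
move=> ee he; pose e' x := 1%:M - e x.
have he' : mxrep_hom F F e'.
  by move=> b; rewrite /e' mulmxBl mulmxBr mul1mx mulmx1 he.
have oe x : e x *m e' x = 0 by rewrite /e' mulmxBr mulmx1 ee subrr.
have oe' x : e' x *m e x = 0 by rewrite /e' mulmxBl mul1mx ee subrr.
have ee' x : e' x *m e' x = e' x by rewrite {2}/e' mulmxBr mulmx1 oe' subr0.
have sp (f : forall x, 'M[k]_(D x)) b : (forall x, f x *m f x = f x) ->
    mxrep_hom F F f ->
    col_base (f (src b)) *m (row_base (f (src b)) *m F b *m col_base (f (tgt b))) =
    F b *m col_base (f (tgt b)).
  move=> ff hf; rewrite 2!(mulmxA (col_base _)) mulmx_base hf -(mulmxA (F b)).
  by congr (_ *m _); apply: idempotent_col_base.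
have h b u : pair_mx (col_base (e (tgt b))) (col_base (e' (tgt b))) (rmap (mxrep F) b
  u) =
    rmap (dsum (corner F e) (corner F e')) b
      (pair_mx (col_base (e (src b))) (col_base (e' (src b))) u).
  by rewrite /= /dsum_map /pair_mx /= -!(mulmxA u) (sp e) // (sp e').
exists (@RepHom k Q (mxrep F) (dsum (corner F e) (corner F e'))
  (fun x => pair_mx (col_base (e x)) (col_base (e' x))) h) => x /=.
exists (fun p => p.1 *m row_base (e x) + p.2 *m row_base (e' x)) => [u|[p q]].
  by rewrite /= -!(mulmxA u) !mulmx_base -mulmxDr /e' addrC subrK mulmx1.
rewrite /pair_mx /= !mulmxDl -!(mulmxA p) -!(mulmxA q) !idempotent_base // !mulmx1.
by rewrite !orthogonal_base // !mulmx0 addr0 add0r.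
Qed.

Lemma indecomposable_idempotent D (F : mats D) (e : forall x, 'M[k]_(D x)) :
  indecomposable (mxrep F) ->
  (forall x, e x *m e x = e x) -> mxrep_hom F F e ->
  (forall x, e x = 0) \/ (forall x, e x = 1%:M).
Proof.
move=> [_ dec] ee he.
have z (f : forall x, 'M[k]_(D x)) : is_zero_rep (corner F f) -> forall x, f x = 0.
  by move=> zf x; apply/eqP; rewrite -mxrank_eq0; apply/eqP; apply: row_dim0 (zf x).
case: (dec _ _ (idempotent_decomposition ee he)) => [/z|/z h]; [by left|right].
by move=> x; apply/esym/eqP; rewrite -subr_eq0 h.
Qed.

(** A decomposition produces the idempotent projecting onto its first summand. *)
Lemma idempotent_indecomposable D (F : mats D) : (exists x, D x <> 0%N) ->
  (forall e, (forall x, e x *m e x = e x) -> mxrep_hom F F e ->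
    (forall x, e x = 0) \/ (forall x, e x = 1%:M)) ->
  indecomposable (mxrep F).
Proof.
move=> [x0 nx0] H; split.
  by move=> z; apply: nx0; apply: row_dim0 (z x0).
move=> X Y [[f hf] /= bf].
pose g x := sval (cid (linear_inverse (bf x))).
have fg x : cancel (f x) (g x) by rewrite /g; case: cid => ? [].
have gf x : cancel (g x) (f x) by rewrite /g; case: cid => ? [].
pose p x u := g x ((f x u).1, 0).
have lin x : linear (p x).
  move=> c u v; rewrite /p -linearP; congr (g x _); rewrite linearP.
  by apply/pair_equal_spec; rewrite /= scaler0 addr0.
pose pL x : {linear 'rV_(D x) -> 'rV_(D x)} :=
  HB.pack (p x) (GRing.isLinear.Build k _ _ *:%R (p x) (lin x)).
pose e x := lin1_mx (pL x).
have eE x u : u *m e x = p x u by rewrite mul_rV_lin1.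
have ee x : e x *m e x = e x.
  by apply/row_matrixP => i; rewrite !rowE mulmxA !eE /p gf.
have he : mxrep_hom F F e.
  move=> b; apply/row_matrixP => i; rewrite !rowE !mulmxA !eE /p.
  apply: (can_inj (fg _)); rewrite gf.
  have := hf b (g (src b) ((f (src b) (delta_mx 0 i)).1, 0)); rewrite /= => ->.
  rewrite gf /dsum_map /= linear0; congr (_, _).
  by have := hf b (delta_mx 0 i); rewrite /= => ->.
have [e0|e1] := H e ee he; [left|right] => x u.
  have := eE x (g x (u, 0)); rewrite e0 mulmx0 /p gf /= => /esym/(congr1 (f x)).
  by rewrite gf linear0 => -[].
have := eE x (g x (0, u)); rewrite e1 mulmx1 /p gf /= => /(can_inj (gf x)).
by case.
Qed.

(* Junk unless b joins p and q. *)
Definition edge_step (D : vertex Q -> nat) (F : mats D)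
    (b : arrow Q) (p q : vertex Q) : step k (D p) (D q) :=
  match pselect (src b = p /\ tgt b = q) with
  | left E => Out (castmx (congr1 D (proj1 E), congr1 D (proj2 E)) (F b))
  | right _ =>
    match pselect (src b = q /\ tgt b = p) with
    | left E => In (castmx (congr1 D (proj1 E), congr1 D (proj2 E)) (F b))
    | right _ => Out 0
    end
  end.

Definition joins (b : arrow Q) p q :=
  (src b = p /\ tgt b = q) \/ (src b = q /\ tgt b = p).

Lemma joins_sym b p q : joins b p q -> joins b q p.
Proof. by case; [right|left]. Qed.

Lemma edge_step_orientation D (F F' : mats D) b p q :
  is_out (@edge_step D F b p q) = is_out (@edge_step D F' b p q).
Proof. by rewrite /edge_step; case: pselect => // ?; case: pselect. Qed.

Lemma edge_step_hom D (F F' : mats D) b p q (f : forall x, 'M[k]_(D x)) : joins b p q ->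
  (step_hom (edge_step F b p q) (edge_step F' b p q) (f p) (f q) <->
   f (src b) *m F' b = F b *m f (tgt b)).
Proof.
rewrite /joins /edge_step; case: pselect => [[E1 E2] _|n1].
  by case: q / E2; case: p / E1; rewrite /= !castmx_id.
case: pselect => [[E1 E2] _|n2 []//].
by case: p / E2 {n1}; case: q / E1; rewrite /= !castmx_id; split=> ->.
Qed.

Lemma edge_step_good D (F : mats D) b p q : joins b p q ->
  (src b = p -> tgt b = q -> row_full (F b)) ->
  (src b = q -> tgt b = p -> row_free (F b)) -> good (edge_step F b p q).
Proof.
rewrite /joins /edge_step; case: pselect => [[E1 E2] _ h _|n1].
  by move: (h E1 E2) => {h}; case: q / E2; case: p / E1; rewrite /= castmx_id.
case: pselect => [[E1 E2] _ _ h|n2 []//].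
by move: (h E1 E2) => {h n1}; case: p / E2; case: q / E1; rewrite /= castmx_id.
Qed.

Lemma edge_step_good_bij D (F : mats D) b p q : joins b p q ->
  D q = 0%N \/ row_full (F b) && row_free (F b) -> good (edge_step F b p q).
Proof.
move=> J h; apply: edge_step_good J _ _ => s t; case: h => [D0|/andP[]//].
  by rewrite -col_leq_rank; move: (\rank _) => r; rewrite t D0.
by rewrite -row_leq_rank; move: (\rank _) => r; rewrite s D0.
Qed.

Lemma edge_step_bij D (F : mats D) b p q : joins b p q ->
  bij (@edge_step D F b p q) = row_full (F b) && row_free (F b).
Proof.
rewrite /joins /edge_step; case: pselect => [[E1 E2] _|n1].
  by case: q / E2; case: p / E1; rewrite /= !castmx_id.
case: pselect => [[E1 E2] _|n2 []//].
by case: p / E2 {n1}; case: q / E1; rewrite /= !castmx_id.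
Qed.

Section Labelled.
Variables (v : nat -> vertex Q) (a : nat -> arrow Q).
Hypotheses (v_bij : bijective v) (a_bij : bijective a).
Hypothesis a_joins : forall e,
  joins (a e) (v (Dinf_edge e).1) (v (Dinf_edge e).2).

Definition rep_system D (F : mats D) :
    system k (fun x => D (v x)) :=
  @System k (fun x => D (v x)) (fun x => edge_step F (a x) (v x) (v x.+1))
    (edge_step F (a 0) (v 2) (v 0)) (edge_step F (a 1) (v 2) (v 1)).

Lemma tail_joins x : (2 <= x)%N -> joins (a x) (v x) (v x.+1).
Proof. by case: x => [|x] // _; apply: (a_joins x.+1). Qed.

Lemma arm0_joins : joins (a 0) (v 2) (v 0).
Proof. exact/joins_sym/(a_joins 0). Qed.

Lemma arm1_joins : joins (a 1) (v 2) (v 1).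
Proof. exact/joins_sym/(a_joins 1). Qed.

Lemma rep_system_orientation D (F F' : mats D) :
  same_orientation (@rep_system D F) (@rep_system D F').
Proof. by split=> [x _||]; apply: edge_step_orientation. Qed.

Lemma rep_system_hom D (F F' : mats D) (f : forall x, 'M[k]_(D x)) :
  system_hom (rep_system F) (rep_system F') (fun x => f (v x)) <-> mxrep_hom F F' f.
Proof.
have [w vK wK] := a_bij; split.
  move=> [h h0 h1] b; rewrite -(wK b); case: (w b) => [|[|x]].
  - by apply/(edge_step_hom _ _ _ arm0_joins)/h0.
  - by apply/(edge_step_hom _ _ _ arm1_joins)/h1.
  - by apply/(edge_step_hom _ _ _ (@tail_joins x.+2 isT))/h.
move=> h; split=> [x x2||].
- by apply/(edge_step_hom _ _ _ (tail_joins x2))/h.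
- by apply/(edge_step_hom _ _ _ arm0_joins)/h.
- by apply/(edge_step_hom _ _ _ arm1_joins)/h.
Qed.

(** Systems are indexed by labels and representations by vertices; a cast along [v (w z) = z] passes
    between them. *)
Lemma lift_family D (f : forall x, 'M[k]_(D (v x))) :
  exists g : forall z, 'M[k]_(D z), forall x, g (v x) = f x.
Proof.
have [w vK wK] := v_bij.
exists (fun z => castmx (congr1 D (wK z), congr1 D (wK z)) (f (w z))) => x.
move: (wK (v x)); rewrite vK => E.
by rewrite (Prop_irrelevance E erefl) castmx_id.
Qed.

Lemma all_vertices (P : vertex Q -> Prop) : (forall x, P (v x)) -> forall z, P z.
Proof. by have [w _ wK] := v_bij => h z; rewrite -(wK z). Qed.

Lemma indecomposable_rigid D (F : mats D) : indecomposable (mxrep F) ->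
  rigid (@rep_system D F).
Proof.
move=> ind f ff hf; have [g gf] := lift_family f.
have fE : f = fun x => g (v x) by apply/functional_extensionality_dep => x; rewrite gf.
rewrite fE in ff hf *.
have [||g0|g1] := indecomposable_idempotent (e := g) ind.
- exact: all_vertices.
- by apply/rep_system_hom.
- by left.
- by right.
Qed.

Lemma system_iso D (F F' : mats D) (f : forall x, 'M[k]_(D (v x))) :
  system_hom (@rep_system D F) (@rep_system D F') f ->
  (forall x, f x \in unitmx) -> rep_iso (mxrep F) (mxrep F').
Proof.
move=> hf uf; have [g gf] := lift_family f.
have fE : f = fun x => g (v x) by apply/functional_extensionality_dep => x; rewrite gf.
rewrite fE in uf hf.
apply: (@mxrep_iso D F F' g); first exact/rep_system_hom.
exact: all_vertices.
Qed.

End Labelled.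

End Reps.

(** * Finitely presented representations on the tail *)

Lemma bijective_of T U (f : T -> U) : injective f -> (forall y, exists x, f x = y) ->
  bijective f.
Proof.
move=> inj /choice[g fg]; exists g => // x.
by apply: inj; rewrite fg.
Qed.

Section FreeModules.
Variables (k : fieldType) (T : choiceType).

Lemma freegUZ (c : k) (t : T) : << c *g t >> = c *: << t >> :> {freeg T / k}.
Proof. by apply/eqP/freeg_eqP => y; rewrite coeffZ !coeffU mul1r. Qed.

Lemma freeg_linear_ext (V : lmodType k) (f g : {linear {freeg T / k} -> V}) :
  (forall t, f << t >> = g << t >>) -> f =1 g.
Proof.
move=> fg D; rewrite -[D]freeg_sumE !linear_sum; apply: eq_bigr => t _.
by rewrite freegUZ !linearZ /= fg.
Qed.

Lemma freeg_lift (V : lmodType k) (f : T -> V) :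
  exists L : {linear {freeg T / k} -> V}, forall t, L << t >> = f t.
Proof.
pose F : {freeg T / k} -> V := fglift f.
have addf : zmod_morphism F by exact: lift_is_additive.
have F0 : F 0 = 0 by rewrite -(subrr 0) addf subrr.
have addF D E : F (D + E) = F D + F E.
  have opp G : F (- G) = - F G by rewrite -[- G]add0r addf F0 sub0r.
  by rewrite -{1}[E]opprK addf opp opprK.
have scaleF c (D : {freeg T / k}) : F (c *: D) = c *: F D.
  rewrite -[D in LHS]freeg_sumE -[D in RHS]freeg_sumE; elim: (dom D) => [|t r IH].
    by rewrite !big_nil scaler0 F0 scaler0.
  rewrite !big_cons scalerDr !addF IH scalerDr; congr (_ + _).
  by rewrite freegUZ scalerA -!freegUZ /F !liftU scalerA.
have Lin : linear F by move=> c D E; rewrite addF scaleF.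
pose L : {linear {freeg T / k} -> V} :=
  HB.pack F (GRing.isLinear.Build k {freeg T / k} V *:%R F Lin).
by exists L => t; rewrite /= /F liftU scale1r.
Qed.

End FreeModules.

Lemma freeg_mapU (k : fieldType) (T U : choiceType) (f : T -> U) t :
  @freeg_map k T U f << t >> = << f t >>.
Proof. by rewrite /freeg_map liftU scale1r. Qed.

Lemma freeg_map_bij (k : fieldType) (T U : choiceType) (f : T -> U) :
  bijective f -> bijective (@freeg_map k T U f).
Proof.
case=> g fg gf; exists (@freeg_map k U T g) => D.
  by apply: (freeg_linear_ext (f := freeg_map g \o freeg_map f) (g := idfun)) => t;
     rewrite /= !freeg_mapU fg.
by apply: (freeg_linear_ext (f := freeg_map f \o freeg_map g) (g := idfun)) => t;
   rewrite /= !freeg_mapU gf.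
Qed.

Lemma freeg_empty (k : fieldType) (T : choiceType) : (T -> False) ->
  forall D : {freeg T / k}, D = 0.
Proof. by move=> e D; apply/eqP/freeg_eqP => t; case: (e t). Qed.

(** An instance of the five lemma. *)
Lemma cokernel_bij (k : fieldType) (A B M A' B' M' : lmodType k)
    (d : {linear A -> B}) (g : {linear B -> M})
    (d' : {linear A' -> B'}) (g' : {linear B' -> M'})
    (fA : {linear A -> A'}) (fB : {linear B -> B'}) (h : {linear M -> M'}) :
  (forall u, fB (d u) = d' (fA u)) -> (forall u, h (g u) = g' (fB u)) ->
  (forall u, g u = 0 <-> range d u) -> (forall m, exists u, g u = m) ->
  (forall u, g' u = 0 <-> range d' u) -> (forall m, exists u, g' u = m) ->
  bijective fA -> bijective fB -> bijective h.
Proof.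
move=> cd cg ex sg ex' sg' [fA' _ fAK] [fB' fBK fBK'].
apply: bijective_of.
  move=> m m' e; have {e} : h (m - m') = 0 by rewrite linearB e subrr.
  move=> hm; apply/eqP; rewrite -subr_eq0; move: hm.
  have [u <-] := sg (m - m'); rewrite cg => /ex'[w _ dw].
  apply/eqP/ex; exists (fA' w) => //.
  by apply: (can_inj fBK); rewrite cd fAK dw.
move=> m'; have [u' <-] := sg' m'; exists (g (fB' u')).
by rewrite cg fBK'.
Qed.

(** * Paths and the behaviour of the P_a on the tail *)

Section Paths.
Variables (k : fieldType) (Q : quiver).

Lemma rep_plus_iso (M N : rep k Q) : rep_iso M N -> rep_plus M -> rep_plus N.
Proof.
move=> MN [lM [s1 [s0 [f [g ex]]]]]; split.
  by move=> x; have [n dn] := lM x; exists n; apply: rep_iso_dim (rep_iso_sym MN) dn.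
have [[h hh] /= bh] := MN; case: g ex => g hg /= ex.
have hcomp a u : (h (tgt a) \o g (tgt a)) (rmap (proj_sum k s0) a u) =
    rmap N a ((h (src a) \o g (src a)) u) by rewrite /= hg hh.
exists s1, s0, f, (@RepHom k Q (proj_sum k s0) N (fun x => h x \o g x) hcomp) => x.
have [i e s] := ex x; split=> //= [u|m].
  rewrite -e; split=> [|->]; last by rewrite linear0.
  by rewrite -[X in _ = X -> _](linear0 (h x)) => /(bij_inj (bh x)).
have [h' _ hK] := bh x; have [u gu] := s (h' m); exists u.
by rewrite gu hK.
Qed.

(** Packing the last arrow with the remaining path reduces injectivity of [qpath_cons] to equality
    of dependent pairs, which classical decidability of equality of arrows resolves. *)
Definition path_last (a z : vertex Q) (p : qpath a z) :
    option {b : arrow Q & qpath a (src b)} :=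
  match p with
  | qpath_nil => None
  | qpath_cons b p => Some (existT (fun b => qpath a (src b)) b p)
  end.

Lemma qpath_cons_inj a b : injective (@qpath_cons Q a b).
Proof.
move=> p q /(congr1 (@path_last a (tgt b))) [].
apply: Eqdep_dec.inj_pair2_eq_dec => x y.
by case: (pselect (x = y)); [left|right].
Qed.

(** The transports keep the endpoint a variable, so that the case analysis applies when it is of the
    form [tgt b]. *)
Lemma qpathP a z (p : qpath a z) :
  (exists E : a = z, p = eq_rect a (qpath a) qpath_nil z E) \/
  (exists b (q : qpath a (src b)) (E : tgt b = z),
     p = eq_rect (tgt b) (qpath a) (@qpath_cons Q a b q) z E).
Proof.
case: p => [|b p]; first by left; exists erefl.
by right; exists b, p, erefl.
Qed.

Lemma qpath_cons_bij (a : vertex Q) (b : arrow Q) : a <> tgt b ->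
  (forall b' (q : qpath a (src b')), tgt b' = tgt b -> b' = b) ->
  bijective (@qpath_cons Q a b : {classic qpath a (src b)} ->
    {classic qpath a (tgt b)}).
Proof.
move=> ab ub; apply: bijective_of; first exact: qpath_cons_inj.
move=> p; have [[E _]//|[b' [q [E ->]]]] := qpathP p.
have e := ub b' q E; subst b'; exists q.
by rewrite (Prop_irrelevance E erefl).
Qed.

Lemma proj_rep_bij (a : vertex Q) (b : arrow Q) : a <> tgt b ->
  (forall b' (q : qpath a (src b')), tgt b' = tgt b -> b' = b) ->
  bijective (rmap (proj_rep k a) b).
Proof. by move=> ab ub; apply/freeg_map_bij/qpath_cons_bij. Qed.

Lemma proj_sum_bij (T : Type) (v : T -> vertex Q) (s : seq T) (P : T -> Prop) (b :
  arrow Q) :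
  (forall y, P y -> bijective (rmap (proj_rep k (v y)) b)) ->
  List.Forall P s -> bijective (rmap (proj_sum k (map v s)) b).
Proof.
move=> h; elim: s => [|y s IH] Ps.
  by exists (fun _ => 0) => u; apply/rowP => -[].
have [g1 K1 K1'] := h y (List.Forall_inv Ps).
have [g2 K2 K2'] := IH (List.Forall_inv_tail Ps).
exists (fun u => (g1 u.1, g2 u.2)) => -[u1 u2]; rewrite /= /dsum_map /=.
  by rewrite K1 K2.
by rewrite K1' K2'.
Qed.

Lemma proj_sum_zero (T : Type) (v : T -> vertex Q) (s : seq T) (P : T -> Prop) (x :
  vertex Q) :
  (forall y, P y -> qpath (v y) x -> False) ->
  List.Forall P s -> forall u : space (proj_sum k (map v s)) x, u = 0.
Proof.
move=> h; elim: s => [|y s IH] Ps; first by move=> u; apply/rowP => -[].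
move=> [u1 u2]; congr (_, _); last by apply: IH; apply: List.Forall_inv_tail Ps.
exact: (@freeg_empty k {classic qpath (v y) x} (h y (List.Forall_inv Ps))).
Qed.

Section Labelled.
Variables (v : nat -> vertex Q) (a : nat -> arrow Q).
Hypotheses (v_bij : bijective v) (a_bij : bijective a).
Hypothesis a_joins : forall e,
  joins (a e) (v (Dinf_edge e).1) (v (Dinf_edge e).2).

Definition outward x := src (a x) = v x /\ tgt (a x) = v x.+1.
Definition inward x := src (a x) = v x.+1 /\ tgt (a x) = v x.

Lemma outward_or_inward x : (0 < x)%N -> outward x \/ inward x.
Proof. by case: x => // x _; apply: (a_joins x.+1). Qed.

Lemma v_inj : injective v. Proof. exact: bij_inj. Qed.
Lemma a_inj : injective a. Proof. exact: bij_inj. Qed.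

Lemma arrowE b : exists e, b = a e.
Proof. by have [w _ K] := a_bij; exists (w b); rewrite K. Qed.

(** The only edge between the vertices up to [x] and the others is number [x], and it points
    inwards. *)
Lemma inward_trap x y z : (2 <= x)%N -> inward x -> (y <= x)%N ->
  qpath (v y) z -> exists2 y', (y' <= x)%N & z = v y'.
Proof.
move=> x2 [s t] yx; elim=> [|b p [y' y'x sb]]; first by exists y.
have [e E] := arrowE b; subst b; have := a_joins e; rewrite /Dinf_edge.
case: (eqVneq e 0%N) => [e0|ne] [] [/= s' t'].
- by exists 2%N.
- by exists 0%N.
- exists e.+1 => //; move: s'; rewrite sb => /v_inj ye; subst y'.
  rewrite ltn_neqAle y'x andbT; apply/eqP => ex; subst e.
  by move: s; rewrite sb => /v_inj; lia.
- exists e => //; move: s'; rewrite sb => /v_inj; lia.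
Qed.

(** Every path from [v y] to [v x.+1] ends with [a x]: the only other arrow that could end there is
    an inward [a x.+1], whose source is out of reach by [inward_trap]. *)
Lemma outward_bij x y : (2 <= x)%N -> outward x -> (y <= x)%N ->
  bijective (rmap (proj_rep k (v y)) (a x)).
Proof.
move=> x2 [s t] yx; apply: proj_rep_bij.
  by rewrite t => /v_inj; lia.
move=> b q; have [e E] := arrowE b; subst b; rewrite t => te.
have := a_joins e; rewrite /Dinf_edge.
case: (eqVneq e 0%N) => [e0|ne] [] [/= s' t']; move: t'; rewrite te => /v_inj e1.
- by lia.
- by lia.
- by congr a; lia.
have ie : inward e by split=> //; rewrite te e1.
have [||y' y'e] := inward_trap _ ie _ q; try lia.
by rewrite s' => /v_inj; lia.
Qed.

(** Beyond the vertices of the two projectives, an inward edge makes everything further out vanish,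
    while an outward edge acts bijectively on both projectives and hence on the cokernel. *)
Lemma rep_plus_tail (M : rep k Q) : rep_plus M -> exists2 n, (2 <= n)%N &
  (forall y, (n <= y)%N -> forall u : space M (v y), u = 0) \/
  (forall x, (n <= x)%N -> outward x /\ bijective (rmap M (a x))).
Proof.
have [w vK wK] := v_bij.
have sE s : s = map v (map w s) by elim: s => //= z s <-; rewrite wK.
move=> [_ [s1 [s0 [f [g ex]]]]]; move: f g ex; rewrite (sE s1) (sE s0).
set s1' := map w s1; set s0' := map w s0 => f g ex.
have [n0 n0P] : exists n, List.Forall (fun y => (y <= n)%N) (s1' ++ s0').
  elim: (s1' ++ s0') => [|y s [n IH]]; first by exists 0%N; constructor.
  exists (maxn y n); constructor; first exact: leq_maxl.
  by apply: List.Forall_impl IH => z zn; apply: leq_trans zn (leq_maxr _ _).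
pose n := maxn n0 2; have nn0 : (n0 <= n)%N := leq_maxl _ _.
have n2 : (2 <= n)%N := leq_maxr _ _.
have bnd x : (n <= x)%N -> List.Forall (fun y => (y <= x)%N) s1' /\
    List.Forall (fun y => (y <= x)%N) s0'.
  by move=> nx; apply/List.Forall_app; apply: List.Forall_impl n0P => z; lia.
have [[x nx ix]|no_in] := pselect (exists2 x, (n <= x)%N & inward x).
  exists x.+1; first by lia.
  left=> y xy u; have [_ _ /(_ u)[u' <-]] := ex (v y).
  rewrite (_ : u' = 0) ?linear0 //; apply: proj_sum_zero (proj2 (bnd x nx)) _ => z zx p.
  have [|y' y'x /v_inj] := inward_trap _ ix zx p; lia.
exists n => //; right=> x nx; have x2 := leq_trans n2 nx.
have ox : outward x.
  by have [|//|ix] := @outward_or_inward x; [lia|case: no_in; exists x].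
split=> //; have [b1 b0] := bnd x nx.
have [i ex1 s] := ex (src (a x)); have [i' ex1' s'] := ex (tgt (a x)).
case: f g ex ex1 s ex1' s' {i i'} => f hf [g hg] /= ex ex1 s ex1' s'.
apply: (@cokernel_bij k _ _ _ _ _ _ (f (src (a x))) (g (src (a x))) (f (tgt (a x)))
  (g (tgt (a x))) (rmap (proj_sum k (map v s1')) (a x)) (rmap (proj_sum k (map v
    s0')) (a x))).
- by move=> u; rewrite hf.
- by move=> u; rewrite hg.
- exact: ex1.
- exact: s.
- exact: ex1'.
- exact: s'.
- by apply: proj_sum_bij b1 => y yx; apply: outward_bij.
- by apply: proj_sum_bij b0 => y yx; apply: outward_bij.
Qed.

Lemma mulmxr_bij m n (A : 'M[k]_(m, n)) :
  bijective (mulmxr A : 'rV[k]_m -> 'rV[k]_n) -> row_full A && row_free A.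
Proof.
case=> g gK Kg; apply/andP; split.
  rewrite -sub1mx; apply/row_subP => i; rewrite -(Kg (row i 1%:M)).
  exact: submxMl.
apply: inj_row_free => u /= uA; apply: (can_inj gK).
by rewrite /= uA mul0mx.
Qed.

Lemma rep_plus_bij_from (D : vertex Q -> nat) (F : forall b, 'M[k]_(D (src b),
  D (tgt b))) :
  rep_plus (mxrep F) -> exists n, [/\ (2 <= n)%N, bij_from (rep_system v a F) n &
    (forall y, (n <= y)%N -> D (v y) = 0%N) \/ (forall x, (n <= x)%N -> outward x)].
Proof.
move=> /rep_plus_tail[n n2 [Z|O]]; exists n; split=> //.
- move=> x nx; rewrite /= edge_step_bij; last by apply: (tail_joins a_joins); lia.
  have D0 y : (n <= y)%N -> D (v y) = 0%N by move=> ny; apply: row_dim0 (Z y ny).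
  have [s t] : D (src (a x)) = 0%N /\ D (tgt (a x)) = 0%N.
    by have [|[->->]|[->->]] := @outward_or_inward x; rewrite ?D0 //; lia.
  by rewrite -col_leq_rank -row_leq_rank; move: (\rank _) => r; rewrite s t.
- by left=> y ny; apply: row_dim0 (Z y ny).
- move=> x nx; rewrite /= edge_step_bij; last by apply: (tail_joins a_joins); lia.
  by apply: mulmxr_bij; apply: (proj2 (O x nx)).
- by right=> x nx; apply: (proj1 (O x nx)).
Qed.

End Labelled.
End Paths.

(** * Projective presentations *)

Definition linear_of (k : fieldType) (U V : lmodType k) (f : U -> V) (lin : linear f) :
  {linear U -> V} := HB.pack f (GRing.isLinear.Build k U V *:%R f lin).

Lemma freeg_ind (k : fieldType) (T : choiceType) (P : {freeg T / k} -> Prop) :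
  P 0 -> (forall c D E, P D -> P E -> P (c *: D + E)) -> (forall t, P << t >>) ->
  forall D, P D.
Proof.
move=> P0 PD P1 D; rewrite -[D]freeg_sumE; elim: (dom D) => [|t r IH].
  by rewrite big_nil.
by rewrite big_cons freegUZ; apply: PD.
Qed.

Section Homs.
Variables (k : fieldType) (Q : quiver).
Implicit Types A B L M N P X Y : rep k Q.

Lemma hmapE M N (f : rep_hom M N) a u :
  hmap f (tgt a) (rmap M a u) = rmap N a (hmap f (src a) u).
Proof. by case: f. Qed.

Definition mkhom M N (h : forall x, space M x -> space N x) (lin : forall x,
  linear (h x))
    (com : forall a u, h (tgt a) (rmap M a u) = rmap N a (h (src a) u)) : rep_hom M N :=
  @RepHom k Q M N (fun x => linear_of (lin x)) com.

Lemma hcomp_subproof L M N (g : rep_hom M N) (f : rep_hom L M) a u :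
  (hmap g (tgt a) \o hmap f (tgt a)) (rmap L a u) =
  rmap N a ((hmap g (src a) \o hmap f (src a)) u).
Proof. by rewrite /= !hmapE. Qed.

Definition hcomp L M N (g : rep_hom M N) (f : rep_hom L M) : rep_hom L N :=
  @RepHom k Q L N (fun x => hmap g x \o hmap f x) (hcomp_subproof g f).

Section Copair.
Variables (A B M : rep k Q) (f : rep_hom A M) (g : rep_hom B M).

Definition copair_fun x (u : space A x * space B x) : space M x :=
  hmap f x u.1 + hmap g x u.2.

Lemma copair_linear x : linear (@copair_fun x).
Proof.
by move=> c u w; rewrite /copair_fun /= !linearP scalerDr addrACA.
Qed.

Lemma copair_com a u :
  @copair_fun (tgt a) (rmap (dsum A B) a u) = rmap M a (@copair_fun (src a) u).
Proof. by rewrite /copair_fun /= !hmapE linearD. Qed.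

Definition copair : rep_hom (dsum A B) M :=
  @mkhom (dsum A B) M copair_fun copair_linear copair_com.

End Copair.

Section Pair.
Variables (M A B : rep k Q) (f : rep_hom M A) (g : rep_hom M B).

Definition pair_fun x (u : space M x) : space A x * space B x := (hmap f x u,
  hmap g x u).

Lemma pair_linear x : linear (@pair_fun x).
Proof. by move=> c u w; rewrite /pair_fun !linearP. Qed.

Lemma pair_com a u :
  @pair_fun (tgt a) (rmap M a u) = rmap (dsum A B) a (@pair_fun (src a) u).
Proof. by rewrite /pair_fun /= /dsum_map /= !hmapE. Qed.

Definition pair_hom : rep_hom M (dsum A B) :=
  @mkhom M (dsum A B) pair_fun pair_linear pair_com.

End Pair.

Lemma exists_fst A B : exists p : rep_hom (dsum A B) A, forall x u, hmap p x u = u.1.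
Proof.
have lin x : linear (fun u : space A x * space B x => u.1) by [].
by exists (@mkhom (dsum A B) A (fun x u => u.1) lin (fun _ _ => erefl)).
Qed.

Lemma exists_snd A B : exists p : rep_hom (dsum A B) B, forall x u, hmap p x u = u.2.
Proof.
have lin x : linear (fun u : space A x * space B x => u.2) by [].
by exists (@mkhom (dsum A B) B (fun x u => u.2) lin (fun _ _ => erefl)).
Qed.

Lemma exists_zero M N : exists z : rep_hom M N, forall x u, hmap z x u = 0.
Proof.
have lin x : linear (fun u : space M x => 0 : space N x).
  by move=> c u w; rewrite scaler0 addr0.
have com a u : (fun x (u : space M x) => 0 : space N x) (tgt a) (rmap M a u) =
    rmap N a ((fun x (u : space M x) => 0 : space N x) (src a) u) by rewrite linear0.
by exists (@mkhom M N (fun x u => 0) lin com).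
Qed.

Lemma exists_id M : exists i : rep_hom M M, forall x u, hmap i x u = u.
Proof. by exists (@RepHom k Q M M (fun x => idfun) (fun a u => erefl)). Qed.

Lemma exists_inl A B : exists p : rep_hom A (dsum A B), forall x u, hmap p x u = (u, 0).
Proof.
have [i iE] := exists_id A; have [z zE] := exists_zero A B.
by exists (pair_hom i z) => x u; rewrite /= /pair_fun iE zE.
Qed.

Lemma exists_inr A B : exists p : rep_hom B (dsum A B), forall x u, hmap p x u = (0, u).
Proof.
have [i iE] := exists_id B; have [z zE] := exists_zero B A.
by exists (pair_hom z i) => x u; rewrite /= /pair_fun iE zE.
Qed.

Lemma rep_iso_of M N (f : rep_hom M N) (g : forall x, space N x -> space M x) :
  (forall x, cancel (hmap f x) (g x)) -> (forall x, cancel (g x) (hmap f x)) ->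
    rep_iso M N.
Proof. by move=> fg gf; exists f => x; exists (g x); [apply: fg|apply: gf]. Qed.

Lemma dsum_iso A A' B B' : rep_iso A A' -> rep_iso B B' ->
  rep_iso (dsum A B) (dsum A' B').
Proof.
move=> [f bf] [g bg].
have [i iE] := exists_inl A' B'; have [j jE] := exists_inr A' B'.
exists (copair (hcomp i f) (hcomp j g)) => x.
have [f' fK fK'] := bf x; have [g' gK gK'] := bg x.
exists (fun u => (f' u.1, g' u.2)) => -[u w] /=.
  by rewrite /copair_fun /= iE jE /= addr0 add0r fK gK.
rewrite /copair_fun /= iE jE fK' gK'.
by apply/pair_equal_spec; rewrite /= addr0 add0r.
Qed.

Lemma dsum_assoc A B M : rep_iso (dsum A (dsum B M)) (dsum (dsum A B) M).
Proof.
have [p pE] := exists_fst A (dsum B M); have [q qE] := exists_snd A (dsum B M).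
have [p' pE'] := exists_fst B M; have [q' qE'] := exists_snd B M.
apply: (rep_iso_of (f := pair_hom (pair_hom p (hcomp p' q)) (hcomp q' q))
  (g := fun x u => (u.1.1, (u.1.2, u.2)))) => x.
  by move=> [u [w t]]; rewrite /= /pair_fun /= /pair_fun /= pE qE pE' qE'.
by move=> [[u w] t]; rewrite /= /pair_fun /= /pair_fun /= pE qE pE' qE'.
Qed.

Definition projective P := exists s, rep_iso (proj_sum k s) P.

Lemma dsum0 Z M : is_zero_rep Z -> rep_iso M (dsum Z M).
Proof.
move=> zZ; have [i iE] := exists_inr Z M.
apply: (rep_iso_of (f := i) (g := fun x u => u.2)) => x u; first by rewrite iE.
by rewrite iE; case: u => z u; rewrite (zZ _ z).
Qed.

Lemma zero_rep_is_zero : is_zero_rep (zero_rep k Q).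
Proof. by move=> x u; apply/rowP => -[]. Qed.

Lemma projective_dsum P P' : projective P -> projective P' -> projective (dsum P P').
Proof.
move=> [s sP] [t tP]; exists (s ++ t); apply: rep_iso_trans (dsum_iso sP tP) =>
  {P P' sP tP}.
elim: s => [|a s IH] /=; first by apply: dsum0; apply: zero_rep_is_zero.
apply: rep_iso_trans (dsum_assoc _ _ _).
exact: dsum_iso (rep_iso_refl _) IH.
Qed.

Lemma rep_iso_projective P P' : rep_iso P P' -> projective P -> projective P'.
Proof. by move=> PP' [s sP]; exists s; apply: rep_iso_trans sP PP'. Qed.

Lemma projective_proj_sum s : projective (proj_sum k s).
Proof. by exists s; apply: rep_iso_refl. Qed.

Lemma projective_proj_rep a : projective (proj_rep k a).
Proof.
exists [:: a]; have [p pE] := exists_fst (proj_rep k a) (zero_rep k Q).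
apply: (rep_iso_of (f := p) (g := fun x u => (u, 0))) => x u; rewrite pE //.
by case: u => u z /=; rewrite (zero_rep_is_zero z).
Qed.

Section Yoneda.
Variables (a : vertex Q) (M : rep k Q) (m : space M a).

Fixpoint path_act z (p : qpath a z) : space M z :=
  match p with
  | qpath_nil => m
  | qpath_cons b p => rmap M b (path_act p)
  end.

Lemma yoneda : exists f : rep_hom (proj_rep k a) M,
  forall z (p : qpath a z), hmap f z << (p : {classic qpath a z}) >> = path_act p.
Proof.
pose h z := sval (cid (freeg_lift (k := k) (fun p : {classic qpath a z} =>
  path_act p))).
have hE z (p : {classic qpath a z}) : h z << p >> = path_act p by rewrite /h; case: cid.
have com b u : h (tgt b) (rmap (proj_rep k a) b u) = rmap M b (h (src b) u).
  apply: (freeg_linear_ext (f := h (tgt b) \o rmap (proj_rep k a) b)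
    (g := rmap M b \o h (src b))) => p.
  by rewrite /= freeg_mapU !hE.
by exists (@RepHom k Q (proj_rep k a) M h com).
Qed.

End Yoneda.

Lemma yoneda_eq a M (f : rep_hom (proj_rep k a) M) z (p : qpath a z) :
  hmap f z << (p : {classic qpath a z}) >> =
  path_act (hmap f a << (qpath_nil : {classic qpath a a}) >>) p.
Proof.
elim: p => //= b p <-.
have := @hmapE _ _ f b << (p : {classic qpath a (src b)}) >> => /= <-.
by rewrite freeg_mapU.
Qed.

Lemma yoneda_ext a M (f g : rep_hom (proj_rep k a) M) :
  hmap f a << (qpath_nil : {classic qpath a a}) >> =
  hmap g a << (qpath_nil : {classic qpath a a}) >> -> forall z, hmap f z =1 hmap g z.
Proof.
move=> e z; apply: freeg_linear_ext => p.
by rewrite (yoneda_eq f) e -(yoneda_eq g).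
Qed.

(** On one [P_a] it suffices to lift the image of the trivial path; finite sums follow by
    induction. *)
Lemma projective_lift P X Y (g : rep_hom X Y) (h : rep_hom P Y) : projective P ->
  (forall z u, exists w, hmap g z w = hmap h z u) ->
  exists l : rep_hom P X, forall z u, hmap g z (hmap l z u) = hmap h z u.
Proof.
move=> [s sP]; suff H : forall h : rep_hom (proj_sum k s) Y,
    (forall z u, exists w, hmap g z w = hmap h z u) ->
    exists l : rep_hom (proj_sum k s) X, forall z u, hmap g z (hmap l z u) = hmap h z u.
  move=> hg; have [i bi] := sP; have [j bj] := rep_iso_sym sP.
  have [l lE] : exists l : rep_hom (proj_sum k s) X,
      forall z u, hmap g z (hmap l z u) = hmap (hcomp h i) z u by apply: H => z u;
        apply: hg.
  have [j' jK] : exists j' : rep_hom P (proj_sum k s), forall z u,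
    hmap i z (hmap j' z u) = u.
    case: i bi {lE} => f hf /= bf.
    pose f' x := sval (cid (linear_inverse (bf x))).
    have fK x : cancel (f x) (f' x) by rewrite /f'; case: cid => ? [].
    have Kf x : cancel (f' x) (f x) by rewrite /f'; case: cid => ? [].
    have com a u : f' (tgt a) (rmap P a u) = rmap (proj_sum k s) a (f' (src a) u).
      by apply: (can_inj (fK _)); rewrite Kf hf Kf.
    by exists (@RepHom k Q P (proj_sum k s) f' com).
  by exists (hcomp l j') => z u; rewrite /= lE /= jK.
elim: s {P h sP} => [|a s IH] h hg.
  have [l lE] := exists_zero (zero_rep k Q) X; exists l => z u.
  by rewrite lE (zero_rep_is_zero u) !linear0.
have [i iE] := exists_inl (proj_rep k a) (proj_sum k s).
have [j jE] := exists_inr (proj_rep k a) (proj_sum k s).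
have [l2 l2E] := IH (hcomp h j) (fun z u => hg z _).
have [w wE] := hg a (hmap i a << (qpath_nil : {classic qpath a a}) >>).
have [l1 l1E] := yoneda w.
have l1g z u : hmap g z (hmap l1 z u) = hmap (hcomp h i) z u.
  by apply: (@yoneda_ext a Y (hcomp g l1) (hcomp h i)); rewrite /= l1E.
exists (copair l1 l2) => z [u1 u2]; rewrite /= /copair_fun /= linearD l1g l2E /=.
rewrite -linearD iE jE; congr (hmap h z _).
by apply/pair_equal_spec; rewrite /= addr0 add0r.
Qed.

Definition exact_at (X Y Z : rep k Q) (f : rep_hom X Y) (g : rep_hom Y Z) x :=
  [/\ injective (hmap f x), (forall u, hmap g x u = 0 <-> exists w, hmap f x w = u) &
      (forall m, exists u, hmap g x u = m)].

(** The presentation part of [rep_plus], with the projectives taken up to isomorphism so that direct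
    sums of them may be used directly. *)
Definition presentable M := exists P1 P0 (f : rep_hom P1 P0) (g : rep_hom P0 M),
  [/\ projective P1, projective P0 & forall x, exact_at f g x].

Lemma presentable_iso M N : rep_iso M N -> presentable M -> presentable N.
Proof.
move=> [h bh] [P1 [P0 [f [g [p1 p0 ex]]]]]; exists P1, P0, f, (hcomp h g); split=> // x.
have [i e s] := ex x; split=> //= [u|m].
  rewrite -e; split=> [|->]; last by rewrite linear0.
  by rewrite -[X in _ = X -> _](linear0 (hmap h x)) => /(bij_inj (bh x)).
have [h' _ hK] := bh x; have [u gu] := s (h' m); exists u.
by rewrite gu hK.
Qed.

Lemma presentable_rep_plus M : locally_finite_dim M -> presentable M -> rep_plus M.
Proof.
move=> lM [P1 [P0 [f [g [[s1 iso1] [s0 iso0] ex]]]]]; split=> //.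
have [i1 b1] := iso1; have [j0 c0] := rep_iso_sym iso0; have [i0 b0] := iso0.
have {j0 c0} [j jK] : exists j : rep_hom P0 (proj_sum k s0), forall z u,
  hmap i0 z (hmap j z u) = u.
  have [id idE] := exists_id P0.
  have [|j jE] := @projective_lift P0 (proj_sum k s0) P0 i0 id (ex_intro _ s0 iso0).
    by move=> z u; have [i' _ K] := b0 z; exists (i' u); rewrite idE K.
  by exists j => z u; rewrite jE idE.
exists s1, s0, (hcomp j (hcomp f i1)), (hcomp g i0) => x; have [i e s] := ex x;
  split=> /=.
- by move=> u w /= /(congr1 (hmap i0 x)); rewrite !jK => /i /(bij_inj (b1 x)).
- move=> u; rewrite e; split.
    move=> [w fw]; have [i1' _ K] := b1 x; exists (i1' w) => //=; rewrite K fw.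
    by apply: (bij_inj (b0 x)); rewrite jK.
  by move=> [w _ <-] /=; exists (hmap i1 x w); rewrite jK.
- move=> m; have [u <-] := s m; exists (hmap j x u).
  by rewrite jK.
Qed.

(** The horseshoe lemma: [h] lifts the cover of [B] to [M], and [l] measures by how much [h] fails
    to kill the relations of [B]. Subtracting [l] in the new differential corrects this. *)
Lemma presentable_extension A M B (i : rep_hom A M) (p : rep_hom M B) :
  (forall x, exact_at i p x) -> presentable A -> presentable B -> presentable M.
Proof.
move=> ex [P1 [P0 [f [g [p1 p0 e]]]]] [P1' [P0' [f' [g' [p1' p0' e']]]]].
have [|h hE] := @projective_lift P0' M B p g' p0'.
  by move=> z u; have [_ _] := ex z; apply.
have [|l lE] := @projective_lift P1' P0 M (hcomp i g) (hcomp h f') p1'.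
  move=> z u /=; have [_ exz _] := ex z; have [_ _ sz] := e z.
  have /exz[w <-] : hmap p z (hmap h z (hmap f' z u)) = 0.
    by rewrite hE; have [_ ez _] := e' z; apply/ez; exists u.
  by have [t <-] := sz w; exists t.
have lin x : linear (fun u : space P1 x * space P1' x =>
    (hmap f x u.1 - hmap l x u.2, hmap f' x u.2) : space P0 x * space P0' x).
  move=> c u w; rewrite /= !linearP; apply/pair_equal_spec; split=> //=.
  by rewrite scalerDr addrACA.
have com a u : (fun x (u : space P1 x * space P1' x) =>
    (hmap f x u.1 - hmap l x u.2, hmap f' x u.2) : space P0 x * space P0' x) (tgt a)
      (rmap (dsum P1 P1') a u) =
    rmap (dsum P0 P0') a ((fun x (u : space P1 x * space P1' x) =>
    (hmap f x u.1 - hmap l x u.2, hmap f' x u.2) : space P0 x * space P0' x) (src a) u).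
  by rewrite /= /dsum_map /= !hmapE linearB.
exists (dsum P1 P1'), (dsum P0 P0'), (@mkhom (dsum P1 P1') (dsum P0 P0') _ lin com),
  (copair (hcomp i g) h).
split; [exact: projective_dsum|exact: projective_dsum|move=> x].
have [ii ie _] := ex x; have [fi fe fs] := e x; have [fi' fe' fs'] := e' x.
have pi0 u : hmap p x (hmap i x u) = 0 by apply/ie; exists u.
have gf0 u : hmap g x (hmap f x u) = 0 by apply/fe; exists u.
split=> /=.
- move=> [u1 u2] [w1 w2] /= /pair_equal_spec[e1 /fi' e2]; subst w2.
  by move/addIr/fi: e1 => ->.
- move=> [u1 u2]; rewrite /copair_fun /=; split.
    move=> E; have /fe'[w2 w2E] : hmap g' x u2 = 0.
      by rewrite -hE; move/(congr1 (hmap p x)): E; rewrite linearD pi0 add0r linear0.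
    have /fe[w1 w1E] : hmap g x (u1 + hmap l x w2) = 0.
      apply: ii; rewrite linear0 !linearD -E; congr (_ + _).
      by have := lE x w2; rewrite /= w2E.
    by exists (w1, w2); rewrite /= w1E addrK w2E.
  move=> [[w1 w2] /= /pair_equal_spec[<- <-]].
  have /= <- := lE x w2.
  by rewrite !linearB gf0 linear0 sub0r addNr.
- move=> m; have [u2 u2E] := fs' (hmap p x m).
  have /ie[t tE] : hmap p x (m - hmap h x u2) = 0 by rewrite linearB hE u2E subrr.
  have [u1 u1E] := fs t; exists (u1, u2).
  by rewrite /copair_fun /= u1E tE subrK.
Qed.

Lemma presentable_dsum A B : presentable A -> presentable B -> presentable (dsum A B).
Proof.
have [i iE] := exists_inl A B; have [p pE] := exists_snd A B.
apply: (@presentable_extension A (dsum A B) B i p) => x; split.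
- by move=> u w; rewrite !iE => -[].
- move=> [u w]; rewrite pE /=; split=> [->|[t]]; first by exists u; rewrite iE.
  by rewrite iE => -[].
- by move=> m; exists (0, m); rewrite pE.
Qed.

Lemma presentable_projective P : projective P -> presentable P.
Proof.
move=> pP; have [z zE] := exists_zero (zero_rep k Q) P; have [i iE] := exists_id P.
exists (zero_rep k Q), P, z, i; split=> //; first by exists [::]; apply: rep_iso_refl.
move=> x; split.
- by move=> u w _; rewrite (zero_rep_is_zero u) (zero_rep_is_zero w).
- by move=> u; rewrite iE; split=> [->|[w <-]]; [exists 0|]; rewrite zE.
- by move=> m; exists m; rewrite iE.
Qed.

Lemma presentable_zero Z : is_zero_rep Z -> presentable Z.
Proof.
move=> zZ; apply: presentable_projective; exists [::].
have [z zE] := exists_zero (zero_rep k Q) Z.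
apply: (rep_iso_of (f := z) (g := fun x u => 0)) => x u.
  by rewrite (zero_rep_is_zero u).
by rewrite zE (zZ x u).
Qed.

End Homs.

(** * Presentations by cutting edges *)

Section FirstArrow.
Variable Q : quiver.

Fixpoint qpath_prepend x b (E : src b = x) z (q : qpath (tgt b) z) : qpath x z :=
  match q in qpath _ z return qpath x z with
  | qpath_nil => match E in _ = y return qpath y (tgt b) with
                 | erefl => @qpath_cons Q (src b) b qpath_nil end
  | qpath_cons c q => @qpath_cons Q x c (qpath_prepend E q)
  end.

(** An injective invariant free of dependent types, by which first arrows of paths are compared. *)
Fixpoint arrows_of x z (p : qpath x z) : seq (arrow Q) :=
  match p with
  | qpath_nil => [::]
  | qpath_cons c q => rcons (arrows_of q) c
  end.

Lemma arrows_of_prepend x b (E : src b = x) z (q : qpath (tgt b) z) :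
  arrows_of (qpath_prepend E q) = b :: arrows_of q.
Proof. by elim: q => [|c q /= ->] //; case: x / E. Qed.

Lemma arrows_of_inj x z : injective (@arrows_of x z).
Proof.
have inj2 (P : vertex Q -> Type) y (p q : P y) : existT P y p = existT P y q -> p = q.
  apply: Eqdep_dec.inj_pair2_eq_dec => u w.
  by case: (pselect (u = w)); [left|right].
suff H y (p : qpath x y) y' (q : qpath x y') : arrows_of p = arrows_of q ->
    existT (qpath x) y p = existT (qpath x) y' q.
  by move=> p q /H; apply: inj2.
elim: p y' q => [|b p IH] y' [|c q] //=.
- by case: (arrows_of q).
- by case: (arrows_of p).
move=> /rcons_inj[/IH E bc]; subst c.
by have := inj2 _ _ _ _ E => ->.
Qed.

Lemma qpath_front x z (p : qpath x z) :
  (exists E : x = z, p = eq_rect x (qpath x) qpath_nil z E) \/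
  (exists b (E : src b = x) (q : qpath (tgt b) z), p = qpath_prepend E q).
Proof.
elim: p => [|c p IH]; first by left; exists erefl.
right; case: IH => [[E ->]|[b [E [q ->]]]].
  by subst x; exists c, erefl, qpath_nil.
by exists b, E, (@qpath_cons Q (tgt b) c q).
Qed.

End FirstArrow.

Section Presentations.
Variables (k : fieldType) (Q : quiver).
Implicit Types (D : vertex Q -> nat).

Local Notation mats D := (forall b : arrow Q, 'M[k]_(D (src b), D (tgt b))).
Local Notation "[path p ]" := (<< (p : {classic @qpath Q _ _}) >>) (at level 0,
  format "[path  p ]").

Lemma prepend_hom (x : vertex Q) (b : arrow Q) (E : src b = x) :
  exists f : rep_hom (proj_rep k (tgt b)) (proj_rep k x),
    forall z (q : qpath (tgt b) z), hmap f z [path q] = [path qpath_prepend E q].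
Proof.
have [f fE] := @yoneda k Q (tgt b) (proj_rep k x) [path qpath_prepend E qpath_nil].
exists f => z q; rewrite fE; elim: q => //= c q ->.
by rewrite freeg_mapU.
Qed.

(** It reads off the part supported on paths beginning with [b], and so separates the summands of
    the radical. *)
Lemma prepend_retraction (x : vertex Q) (b : arrow Q) (E : src b = x) (z : vertex Q) :
  exists r : {linear {freeg {classic qpath x z} / k} ->
    {freeg {classic qpath (tgt b) z} / k}},
    (forall q : qpath (tgt b) z, r [path qpath_prepend E q] = [path q]) /\
    forall b' (E' : src b' = x) (q : qpath (tgt b') z), b' <> b ->
      r [path qpath_prepend E' q] = 0.
Proof.
pose R (p : {classic qpath x z}) : {freeg {classic qpath (tgt b) z} / k} :=
  if pselect (exists q : qpath (tgt b) z, p = qpath_prepend E q) is left h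
  then [path sval (cid h)] else 0.
have [r rE] := freeg_lift R; exists r; split=> [q|b' E' q nb]; rewrite rE /R.
  case: pselect => [h|[]]; last by exists q.
  case: cid => q' /= e; congr (<< _ >>); apply: arrows_of_inj.
  by move/(congr1 (@arrows_of Q x z)): e; rewrite !arrows_of_prepend => -[].
case: pselect => [h|//]; exfalso; case: h => q' e; apply: nb.
by move: (congr1 (@arrows_of Q x z) e); rewrite !arrows_of_prepend => -[].
Qed.

(* The radical of P_x is the direct sum of the P_y over the arrows x -> y. *)
Lemma radical_hom (x : vertex Q) (T : eqType) (a : T -> arrow Q) (s : seq T) :
  injective a -> uniq s ->
  {in s, forall e, src (a e) = x} ->
  exists f : rep_hom (proj_sum k [seq tgt (a e) | e <- s]) (proj_rep k x),
    [/\ forall z, injective (hmap f z),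
        forall e (E : src (a e) = x) z (q : qpath (tgt (a e)) z), e \in s ->
          exists u, hmap f z u = [path qpath_prepend E q],
        forall e z (r : {linear {freeg {classic qpath x z} / k} ->
              {freeg {classic qpath (tgt (a e)) z} / k}}), e \notin s ->
          (forall b (E : src b = x) (q : qpath (tgt b) z), b <> a e ->
            r [path qpath_prepend E q] = 0) -> forall u, r (hmap f z u) = 0 &
        forall M (g : rep_hom (proj_rep k x) M),
          (forall e, e \in s -> forall w : space M (tgt (a e)), w = 0) ->
          forall z u, hmap g z (hmap f z u) = 0].
Proof.
move=> a_inj; elim: s => [|e s IH] /=.
  move=> _ _; have [f fE] := exists_zero (zero_rep k Q) (proj_rep k x).
  exists f; split=> //.
  - by move=> z u w _; rewrite (@zero_rep_is_zero k Q z u) (@zero_rep_is_zero k Q z w).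
  - by move=> e z r _ _ u; rewrite fE linear0.
  - by move=> M g _ z u; rewrite fE linear0.
move=> /andP[es us] sx.
have [|fs [fi fr fz fg]] := IH us; first by move=> e' es'; apply: sx;
  rewrite inE es' orbT.
have E : src (a e) = x by apply: sx; rewrite mem_head.
have [f1 f1E] := prepend_hom E.
(* The retraction for [a e] recovers the first component and, by the third clause for [s],
   annihilates the contribution of the others. *)
have inj0 z u : hmap (copair f1 fs) z u = 0 -> u = 0.
  have [r [r1 r0]] := prepend_retraction E z.
  case: u => u1 u2; rewrite /= /copair_fun /= => e0.
  have ru : r (hmap f1 z u1) = u1.
    apply: (freeg_linear_ext (f := r \o hmap f1 z) (g := idfun)) => q.
    by rewrite /= f1E r1.
  have u10 : u1 = 0.
    by rewrite -ru -(linear0 r) -e0 linearD (fz e z r es) ?addr0 //.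
  congr (_, _) => //; apply: (fi z); rewrite linear0 -e0 u10 linear0 add0r //.
exists (copair f1 fs); split.
- move=> z u w uw; apply/eqP; rewrite -subr_eq0; apply/eqP/inj0.
  by rewrite linearB uw subrr.
- move=> e' E' z q; rewrite inE => /orP[/eqP e'e|e's].
    subst e'; exists ([path q], 0); rewrite /= /copair_fun /= linear0 addr0 f1E.
    by rewrite (Prop_irrelevance E' E).
  have [u uE] := fr e' E' z q e's; exists (0, u).
  by rewrite /= /copair_fun /= linear0 add0r.
- move=> e' z r; rewrite inE negb_or => /andP[e'e e's] rb [u1 u2].
  rewrite /= /copair_fun /= linearD (fz e' z r e's) // addr0.
  have linZ : linear (fun _ : {freeg {classic qpath (tgt (a e)) z} / k} =>
    0 : {freeg {classic qpath (tgt (a e')) z} / k}).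
    by move=> c u w; rewrite scaler0 addr0.
  apply: (freeg_linear_ext (f := r \o hmap f1 z) (g := linear_of linZ)) => q.
  rewrite /= f1E rb // => /a_inj ee.
  by move: e'e; rewrite ee eqxx.
- move=> M g gM z [u1 u2]; rewrite /= /copair_fun /= linearD fg; last first.
    by move=> e' e's; apply: gM; rewrite inE e's orbT.
  have [o oE] := exists_zero (proj_rep k (tgt (a e))) M.
  rewrite addr0 -(oE z u1); apply: (@yoneda_ext k Q (tgt (a e)) M (hcomp g f1) o).
  by rewrite oE; apply: gM; rewrite mem_head.
Qed.

(** The simple at [x] is [P_x] modulo its radical, a finite sum of projectives because [s] lists all
    arrows leaving [x]. *)
Lemma simple_presentable (x : vertex Q) (T : eqType) (a : T -> arrow Q) (s :
  seq T) (M : rep k Q) :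
  injective a -> uniq s -> (forall b, src b = x -> exists2 e, e \in s & b = a e) ->
  {in s, forall e, src (a e) = x} -> (forall b, src b = x -> tgt b <> x) ->
  has_dim (space M x) 1 -> (forall z, z <> x -> forall w : space M z, w = 0) ->
  presentable M.
Proof.
move=> a_inj us sb sx loop [phi bphi] M0.
have [phi' [phiK phiK']] := linear_inverse bphi.
pose m := phi' (const_mx 1).
have mE w : w = (phi w) 0 0 *: m.
  apply: (can_inj phiK); rewrite linearZ phiK'; apply/rowP=> i.
  by rewrite !mxE ord1 mulr1.
have nm : m != 0.
  apply/negP => /eqP m0; have /rowP/(_ 0) : phi m = 0 by rewrite m0 linear0.
  by rewrite phiK' !mxE => /eqP; rewrite oner_eq0.
have comb (V : lmodType k) c c1 c2 (n p q : V) :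
    c *: (c1 *: n + p) + (c2 *: n + q) = (c * c1 + c2) *: n + (c *: p + q).
  by rewrite scalerDl scalerDr scalerA addrACA.
have [f [fi fr _ fg]] := radical_hom a_inj us sx.
have [g gE] := yoneda m.
exists (proj_sum k [seq tgt (a e) | e <- s]), (proj_rep k x), f, g; split.
- exact: projective_proj_sum.
- exact: projective_proj_rep.
move=> z; have gf u : hmap g z (hmap f z u) = 0.
  by apply: fg => e es; apply: M0; apply: loop; apply: sx.
have rad b (E : src b = x) (q : qpath (tgt b) z) :
    exists u, hmap f z u = [path qpath_prepend E q].
  by have [e es be] := sb b E; subst b; apply: fr.
split; first exact: fi.
  move=> u; split=> [gu|[w <-]]; last exact: gf.
  have [zx|zx] := pselect (z = x).
    (* At [x] every element is a multiple of the trivial path plus an element of the radical, and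
       [g] only sees the coefficient. *)
    subst z; suff [w [c uE]] : exists w c, u = c *: [path qpath_nil] + hmap f x w.
      move: gu; rewrite uE linearD linearZ /= gE /= gf addr0 => /eqP.
      by rewrite scaler_eq0 (negPf nm) orbF => /eqP->; exists w; rewrite scale0r add0r.
    move: u {gu}; apply: freeg_ind => [|c D E [w [c1 ->]] [w' [c2 ->]]|p].
    - by exists 0, 0; rewrite scale0r linear0 addr0.
    - exists (c *: w + w'), (c * c1 + c2).
      by rewrite (linearP (hmap f x)); exact: (comb (space (proj_rep k x) x)).
    have [[E ->]|[b [E [q ->]]]] := qpath_front p.
      exists 0, 1; rewrite linear0 addr0 scale1r.
      by rewrite (Prop_irrelevance E erefl).
    have [w wE] := rad b E q; exists w, 0.
    by rewrite scale0r add0r wE.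
  move: u {gu}; apply: freeg_ind => [|c D E [w <-] [w' <-]|p].
  - by exists 0; rewrite linear0.
  - by exists (c *: w + w'); rewrite linearP.
  by have [[E _]|[b [E [q ->]]]] := qpath_front p; [case: zx|apply: rad].
move=> w; have [zx|zx] := pselect (z = x); last by exists 0;
  rewrite linear0 (M0 z zx w).
subst z; exists ((phi w) 0 0 *: [path qpath_nil]).
by rewrite linearZ /= gE /= -mE.
Qed.

Lemma has_dim_prod (V W : lmodType k) m n : has_dim V m -> has_dim W n ->
  has_dim (V * W)%type (m + n).
Proof.
move=> [f [f' fK fK']] [g [g' gK gK']].
have lin : linear (fun u : V * W => row_mx (f u.1) (g u.2)).
  by move=> c u w; rewrite /= !linearP /= scale_row_mx add_row_mx.
exists (linear_of lin); exists (fun w => (f' (lsubmx w), g' (rsubmx w))) =>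
  [[u w]|w] /=.
  by rewrite row_mxKl row_mxKr fK gK.
by rewrite fK' gK' hsubmxK.
Qed.

Section Labelled.
Variables (v : nat -> vertex Q) (a : nat -> arrow Q).
Hypotheses (v_bij : bijective v) (a_bij : bijective a).
Hypothesis a_joins : forall e,
  joins (a e) (v (Dinf_edge e).1) (v (Dinf_edge e).2).

Let v_inj : injective v. Proof. exact: bij_inj. Qed.
Let a_inj : injective a. Proof. exact: bij_inj. Qed.

Lemma no_loop (b : arrow Q) : src b <> tgt b.
Proof.
have [e ->] := arrowE a_bij b; have := a_joins e; rewrite /Dinf_edge.
by case: (eqVneq e 0%N) => [_|ne] [] [/= -> ->] /v_inj; lia.
Qed.

Lemma simple_presentable_label y (M : rep k Q) :
  has_dim (space M (v y)) 1 -> (forall z, z <> v y -> forall w : space M z, w = 0) ->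
  presentable M.
Proof.
(* The number of an edge is its smaller end, so all edges at the vertex [y] have number at most
   [y]. *)
apply: (@simple_presentable (v y) nat a [seq e <- iota 0 y.+1 | `[< src (a e) = v y
  >]]) => //.
- exact/filter_uniq/iota_uniq.
- move=> b; have [e ->] := arrowE a_bij b => se; exists e => //.
  rewrite mem_filter; apply/andP; split; first exact/asboolP.
  rewrite mem_iota; have := a_joins e; rewrite /Dinf_edge.
  by case: (eqVneq e 0%N) => [e0|ne] [] [/= s' t']; move: s'; rewrite se => /v_inj; lia.
- by move=> e; rewrite mem_filter => /andP[/asboolP].
- by move=> b <- /esym; apply: no_loop.
Qed.

Lemma single_vertex_unique D (F F' : mats D) y :
  (forall z, z <> v y -> D z = 0%N) -> F = F'.
Proof.
move=> D0; apply/functional_extensionality_dep => b; apply/matrixP => i j.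
have [E|ns] := pselect (src b = v y); last by have := ltn_ord i; rewrite {2}(D0 _ ns).
have nt : tgt b <> v y by rewrite -E => /esym; apply: no_loop.
by have := ltn_ord j; rewrite {2}(D0 _ nt).
Qed.

(** Induction on the dimension, splitting off one simple summand. Without loops all matrices are
    empty, so dimensions alone identify the sum with [mxrep F]. *)
Lemma single_vertex_presentable y D (F : mats D) :
  (forall z, z <> v y -> D z = 0%N) -> presentable (mxrep F).
Proof.
move: {2}(D (v y)) (erefl (D (v y))) => d; elim: d D F => [|d IH] D F Dd D0.
  apply: presentable_zero => z u; apply/rowP => i.
  have Dz : D z = 0%N by have [->|/D0] := pselect (z = v y).
  by have := ltn_ord i; rewrite {2}Dz.
pose E n z := if `[< z = v y >] then n else 0%N.
have Ey n : E n (v y) = n by rewrite /E asboolT.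
have E0 n z : z <> v y -> E n z = 0%N by move=> nz; rewrite /E asboolF.
pose M n : rep k Q := @mxrep k Q (E n) (fun b => 0).
have p1 : presentable (M 1%N).
  apply: (@simple_presentable_label y).
    by rewrite -[X in has_dim _ X](Ey 1%N); apply: has_dim_mxrep.
  move=> z nz w; apply/rowP => i; have := ltn_ord i.
  by rewrite {2}(E0 1%N z nz).
have pd : presentable (M d) by apply: IH => // z; apply: E0.
have dims z : has_dim (space (dsum (M 1%N) (M d)) z) (E 1%N z + E d z)%N.
  by apply: has_dim_prod; apply: has_dim_mxrep.
have [D' [F' iso]] := @mxrepP k Q (dsum (M 1%N) (M d)) (fun z => ex_intro _ _ (dims z)).
have DD : D' = D.
  apply/funext => z; apply: (has_dim_unique (has_dim_mxrep F' z)).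
  have -> : D z = (E 1%N z + E d z)%N.
    have [->|nz] := pselect (z = v y); first by rewrite !Ey Dd.
    by rewrite !E0 // D0.
  exact: rep_iso_dim (rep_iso_sym iso) (dims z).
subst D'; rewrite (single_vertex_unique F F' D0).
exact: presentable_iso iso (presentable_dsum p1 pd).
Qed.

Definition restr_dim (A : pred (vertex Q)) D z := (A z * D z)%N.
Definition restr_in (A : pred (vertex Q)) D z : 'M[k]_(restr_dim A D z, D z) :=
  pid_mx (D z).
Definition restr_out (A : pred (vertex Q)) D z : 'M[k]_(D z, restr_dim A D z) :=
  pid_mx (D z).
Definition restr (A : pred (vertex Q)) D (F : mats D) : mats (restr_dim A D) :=
  fun b => restr_in A D (src b) *m F b *m restr_out A D (tgt b).

Lemma restr_inK (A : pred (vertex Q)) D z : restr_in A D z *m restr_out A D z = 1%:M.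
Proof.
rewrite /restr_in /restr_out /restr_dim; case: (A z); rewrite ?mul1n ?mul0n.
  by rewrite mul_pid_mx !minnn pid_mx_1.
by apply/matrixP => -[].
Qed.

Lemma restr_outK (A : pred (vertex Q)) D z : A z ->
  restr_out A D z *m restr_in A D z = 1%:M.
Proof.
by rewrite /restr_in /restr_out /restr_dim => ->;
  rewrite mul1n mul_pid_mx !minnn pid_mx_1.
Qed.

Lemma restr_dim0 (A : pred (vertex Q)) D z : ~~ A z -> restr_dim A D z = 0%N.
Proof. by rewrite /restr_dim => /negPf->. Qed.

Lemma mx_rows0 m n (X Y : 'M[k]_(m, n)) : m = 0%N -> X = Y.
Proof. by move=> m0; apply/matrixP => i; have := ltn_ord i; rewrite {2}m0. Qed.

Lemma mx_cols0 m n (X Y : 'M[k]_(m, n)) : n = 0%N -> X = Y.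
Proof. by move=> n0; apply/matrixP => i j; have := ltn_ord j; rewrite {2}n0. Qed.

Lemma mxrep_hom_of D D' (F : mats D) (F' : mats D') (f : forall x, 'M[k]_(D x, D' x)) :
  mxrep_hom F F' f ->
  exists h : rep_hom (mxrep F) (mxrep F'), forall x u, hmap h x u = u *m f x.
Proof.
move=> hf; have com b (u : 'rV_(D (src b))) :
    mulmxr (f (tgt b)) (rmap (mxrep F) b u) = rmap (mxrep F') b (mulmxr (f (src b)) u).
  by rewrite /= -!mulmxA hf.
by exists (@RepHom k Q (mxrep F) (mxrep F') (fun x => mulmxr (f x)) com).
Qed.

(** The restriction to a set closed under arrows is a subrepresentation, with the restriction to the
    complement as quotient. *)
Lemma closed_presentable (A : pred (vertex Q)) D (F : mats D) :
  (forall b, A (src b) -> A (tgt b)) ->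
  presentable (mxrep (restr A F)) -> presentable (mxrep (restr (predC A) F)) ->
  presentable (mxrep F).
Proof.
move=> clA pA pB.
have [|i iE] := @mxrep_hom_of _ _ (restr A F) F (restr_in A D).
  move=> b; have [Ab|nA] := boolP (A (tgt b)); last first.
    have nAs : ~~ A (src b) by apply: contra nA => /clA.
    exact/mx_rows0/restr_dim0.
  by rewrite /restr -!mulmxA restr_outK // mulmx1.
have [|p pE] := @mxrep_hom_of _ _ F (restr (predC A) F) (restr_out (predC A) D).
  move=> b; have [Ab|nA] := boolP (A (src b)).
    by apply/mx_cols0/restr_dim0; rewrite /= negbK clA.
  by rewrite /restr !mulmxA restr_outK // mul1mx.
apply: (@presentable_extension _ _ _ _ _ i p _ pA pB) => z; split.
- move=> u w; rewrite !iE => /(congr1 (mulmx^~ (restr_out A D z))).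
  by rewrite -!mulmxA restr_inK !mulmx1.
- move=> u; rewrite pE; have [Az|nA] := boolP (A z).
    split=> _; last by apply/mx_cols0/restr_dim0; rewrite /= negbK.
    by exists (u *m restr_out A D z); rewrite iE -mulmxA restr_outK ?mulmx1.
  split=> [e|[w <-]].
    exists 0; rewrite linear0 -[u]mulmx1 -(@restr_outK (predC A)) // mulmxA e.
    by rewrite mul0mx.
  rewrite iE; suff -> : w = 0 by rewrite !mul0mx.
  exact/mx_cols0/restr_dim0.
- by move=> m; exists (m *m restr_in (predC A) D z);
  rewrite pE -mulmxA restr_inK mulmx1.
Qed.

Lemma restr_predCK (A : pred (vertex Q)) D (F : mats D) :
  presentable (mxrep (restr A F)) -> presentable (mxrep (restr (predC (predC A)) F)).
Proof.
have -> : (predC (predC A) : pred (vertex Q)) = A by apply/funext => z;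
  rewrite /= negbK.
by [].
Qed.

(** Only [e0] can join [A] to its complement, and whichever way it points, one of the two sets is
    closed under arrows. *)
Lemma cut_presentable (A : pred nat) e0 D (F : mats D) (w : vertex Q -> nat) :
  cancel v w -> cancel w v ->
  (forall e, e != e0 -> A (Dinf_edge e).1 = A (Dinf_edge e).2) ->
  presentable (mxrep (restr (A \o w) F)) ->
    presentable (mxrep (restr (predC (A \o w)) F)) ->
  presentable (mxrep F).
Proof.
move=> vK wK cut pA pB.
have other b : b <> a e0 -> A (w (src b)) = A (w (tgt b)).
  have [e ->] := arrowE a_bij b => ne; have {}ne : e != e0 by apply/eqP => ee; case:
    ne; rewrite ee.
  by have := cut e ne; have [[-> ->]|[-> ->]] := a_joins e; rewrite !vK => ->.
have [As|nAs] := boolP (A (w (src (a e0))) ==> A (w (tgt (a e0)))).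
  apply: (closed_presentable _ pA pB) => b /=.
  by have [->|/other ->//] := pselect (b = a e0); apply/implyP.
apply: (closed_presentable _ pB (restr_predCK pA)) => b /=.
have [->|/other ->//] := pselect (b = a e0).
by move: nAs; rewrite negb_imply => /andP[->].
Qed.

Lemma finite_presentable n D (F : mats D) :
  (forall y, (n <= y)%N -> D (v y) = 0%N) -> presentable (mxrep F).
Proof.
have [w vK wK] := v_bij.
have single y D' (F' : mats D') : (forall x, x <> y -> D' (v x) = 0%N) ->
  presentable (mxrep F').
  move=> h; apply: (@single_vertex_presentable y) => z nz; rewrite -(wK z); apply:
    h => e.
  by apply: nz; rewrite -(wK z) e.
suff H m D' (F' : mats D') : (forall y, (m.+3 <= y)%N -> D' (v y) = 0%N) ->
  presentable (mxrep F').
  by move=> h; apply: (H n) => y; move=> hy; apply: h; lia.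
elim: m D' F' => [|m IH] D' F' D0.
  (* With support in 0, 1, 2, both leaves are cut off and the vertex 2 remains. *)
  apply: (@cut_presentable (pred1 0%N) 0 _ _ w) => //.
  - by case=> [|[|e]].
  - apply: (single 0%N) => x nx; apply: restr_dim0.
    by rewrite /= vK; apply/eqP.
  apply: (@cut_presentable (pred1 1%N) 1 _ _ w) => //.
  - by case=> [|[|e]].
  - apply: (single 1%N) => x nx; apply: restr_dim0.
    by rewrite /= vK; apply/eqP.
  apply: (single 2%N) => x nx; rewrite /restr_dim /= vK.
  by case: x nx => [|[|[|x]]] // _; rewrite ?D0.
(* The edge [m.+2] leads to [m.+3], the last vertex where [D'] may be nonzero. *)
apply: (@cut_presentable (fun y => y < m.+3)%N m.+2 _ _ w) => //.
- by case=> [|e] // ne; rewrite /Dinf_edge /=; move: ne; rewrite eqE /=; lia.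
- by apply: IH => y my; apply: restr_dim0; rewrite /= vK -leqNgt.
apply: (single m.+3) => x nx; rewrite /restr_dim /= vK.
have [xm|mx] := ltnP x m.+3; first by rewrite mul0n.
by rewrite D0 ?muln0 // ltn_neqAle mx andbT; apply/eqP => e; apply: nx.
Qed.

(** The hypothesis begins with the edge [n.-1], the only possible exit towards the root. *)
Lemma outward_stays n y z : (2 < n)%N -> (forall x, (n <= x.+1)%N -> outward v a x) ->
  (n <= y)%N -> qpath (v y) z -> exists2 y', (y <= y')%N & z = v y'.
Proof.
move=> n2 o ny; elim=> [|b p [y' yy' sb]]; first by exists y.
have [e E] := arrowE a_bij b; subst b; have := a_joins e; rewrite /Dinf_edge.
case: (eqVneq e 0%N) => [e0|ne] [] [/= s' t'].
- by move: s'; rewrite sb => /v_inj; lia.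
- by move: s'; rewrite sb => /v_inj; lia.
- by exists e.+1 => //; move: s'; rewrite sb => /v_inj; lia.
- move: (s'); rewrite sb => /v_inj y'e.
  have [|s _] := o e; first by lia.
  by move: s'; rewrite s => /v_inj; lia.
Qed.

(** A generator at [v n] defines a map from one [P_a]. It is bijective at [v n], where only the
    trivial path ends, and remains so outwards since the maps of both representations are bijective
    there. *)
Lemma tail_projective n D (F : mats D) : (2 < n)%N ->
  (forall x, (n <= x.+1)%N -> outward v a x) ->
  (forall y, (y < n)%N -> D (v y) = 0%N) -> D (v n) = 1%N ->
  (forall x, (n <= x)%N -> bijective (rmap (mxrep F) (a x))) ->
  projective (mxrep F).
Proof.
move=> n2 o Dl Dn bF.
pose m : space (mxrep F) (v n) := const_mx 1.
have mE (u : 'rV[k]_(D (v n))) (j : 'I_(D (v n))) : u = u 0 j *: m.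
  apply/rowP => i; rewrite !mxE mulr1; congr (u _ _); apply/val_inj => /=.
  by have := ltn_ord i; have := ltn_ord j; rewrite {2 4}Dn; lia.
have [g gE] := yoneda m.
suff bg : forall x, bijective (hmap g x).
  apply: (@rep_iso_projective _ _ (proj_rep k (v n))); last exact: projective_proj_rep.
  by exists g.
apply: (all_vertices v_bij) => y; have [yn|ny] := ltnP y n.
  have P0 := @freeg_empty k {classic qpath (v n) (v y)}.
  exists (fun _ => 0) => u.
    by apply/esym/P0 => p; have [y' ny' /v_inj] := outward_stays n2 o (leqnn n) p; lia.
  by apply/rowP => i; have := ltn_ord i; rewrite {2}Dl.
elim: y ny => [|y IH]; first by lia.
rewrite leq_eqVlt => /orP[/eqP ny|ny].
  rewrite -ny {y ny IH}.
  have nilE (p : qpath (v n) (v n)) : p = qpath_nil.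
    have [[E ->]|[b [q [E _]]]] := qpathP p;
      first by rewrite (Prop_irrelevance E erefl).
    exfalso; have [y' ny' sb] := outward_stays n2 o (leqnn n) q.
    have [e Ee] := arrowE a_bij b; subst b; have := a_joins e; rewrite /Dinf_edge.
    case: (eqVneq e 0%N) => [e0|ne] [] [/= s' t'].
    - by move: s'; rewrite sb => /v_inj; lia.
    - by move: s'; rewrite sb => /v_inj; lia.
    - by move: s' t'; rewrite sb E => /v_inj ? /v_inj; lia.
    - move: (s'); rewrite sb => /v_inj y'e.
      have [|s _] := o e; first by lia.
      by move: s'; rewrite s => /v_inj; lia.
  have j : 'I_(D (v n)) by rewrite Dn; exact: ord0.
  apply: bijective_of.
    suff H u : hmap g (v n) u = 0 -> u = 0.
      by move=> u w uw; apply/eqP; rewrite -subr_eq0; apply/eqP/H;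
        rewrite linearB uw subrr.
    have [c ->] : exists c, u = c *: [path @qpath_nil Q (v n)].
      move: u; apply: freeg_ind => [|c E E' [c1 ->] [c2 ->]|p].
      - by exists 0; rewrite scale0r.
      - by exists (c * c1 + c2); rewrite scalerDl scalerA.
      - by exists 1; rewrite (nilE p) scale1r.
    rewrite linearZ gE /= => /rowP/(_ j); rewrite !mxE mulr1 => ->.
    by rewrite scale0r.
  move=> u; exists (u 0 j *: [path qpath_nil]).
  by rewrite linearZ gE /= -mE.
have oy : outward v a y by apply: o; lia.
have bP := @outward_bij k Q v a v_bij a_bij a_joins _ _ (leq_trans (ltnW n2) ny) oy ny.
have bM := bF y ny; have {}IH := IH ny.
case: oy => s t; move: bP bM (hmapE g (a := a y)).
rewrite -t; move: IH; rewrite -s => bs bP bM com.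
have [P' PK PK'] := bP; have [M' MK MK'] := bM; have [G' GK GK'] := bs.
exists (fun u => rmap (proj_rep k (v n)) (a y) (G' (M' u))) => u.
  by rewrite -[u]PK' com MK GK.
by rewrite com GK' MK'.
Qed.

(** Cutting the edge [n.-1] leaves a finite dimensional piece and a tail isomorphic to one [P_a]. *)
Lemma tail_rep_plus n D (F : mats D) : (2 < n)%N ->
  (forall x, (n <= x.+1)%N -> outward v a x) -> D (v n) = 1%N ->
  (forall x, (n <= x)%N -> row_full (F (a x)) && row_free (F (a x))) ->
  rep_plus (mxrep F).
Proof.
move=> n2 o Dn bF; have [w vK wK] := v_bij.
apply: presentable_rep_plus; first by move=> x; exists (D x); apply: has_dim_mxrep.
apply: (@cut_presentable (fun y => y < n)%N n.-1 _ _ w) => //.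
- by case=> [|e] //=; rewrite /Dinf_edge /=; lia.
- apply: (@finite_presentable n) => y ny; apply: restr_dim0.
  by rewrite /= vK -leqNgt.
apply/presentable_projective/(@tail_projective n) => //.
- by move=> y yn; apply: restr_dim0; rewrite /= vK negbK.
- by rewrite /restr_dim /= vK ltnn Dn.
move=> x nx; have [ox1 ox2] : outward v a x by apply: o; lia.
pose B := predC ((fun y => y < n)%N \o w).
have [Bs Bt] : B (src (a x)) /\ B (tgt (a x)).
  by rewrite ox1 ox2 /B /= !vK -!leqNgt; split=> //; apply: leqW.
have /andP[fu fr] := bF x nx.
have := mulmxVp fr; have := mulVpmx fu; move: (pinvmx _) => P PF FP.
exists (fun u => u *m restr_in B D (tgt (a x)) *m P *m restr_out B D (src (a x))) =>
  u /=.
  rewrite /restr -!mulmxA (mulmxA (restr_out _ _ _)) restr_outK // mul1mx.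
  by rewrite (mulmxA (F _)) FP mul1mx restr_inK mulmx1.
rewrite /restr -!mulmxA (mulmxA (restr_out _ _ _)) restr_outK // mul1mx.
by rewrite (mulmxA P) PF mul1mx restr_inK mulmx1.
Qed.

End Labelled.
End Presentations.

(** * The representations N_{i,j} and N_{i,infty} *)

Definition nonincreasing_from r (d : nat -> nat) :=
  forall x y, (r <= x <= y)%N -> (d y <= d x)%N.

Lemma thin_profile r (d : nat -> nat) : nonincreasing_from r d -> d r = 1%N ->
  (forall x, (r <= x)%N -> d x = 1%N) \/
  (exists l, forall x, (r <= x)%N -> d x = (x <= r + l)%N).
Proof.
move=> mono dr; have [[z rz dz]|no] := pselect (exists2 z, (r <= z)%N & d z == 0%N);
  last first.
  left=> x rx; have := mono r x; rewrite leqnn rx dr => /(_ isT).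
  by case E : (d x) => [|[]] // _; case: no; exists x; rewrite ?E.
right; have exz : exists z, (r <= z)%N && (d z == 0%N) by exists z; rewrite rz.
case: (ex_minnP exz) => m /andP[rm /eqP dm] min; have rm' : (r < m)%N.
  by rewrite ltn_neqAle rm andbT; apply/eqP => rm'; move: dm; rewrite -rm' dr.
exists (m - r.+1)%N => x rx; have := mono r x; rewrite leqnn rx dr => /(_ isT) dx.
have [xm|mx] := ltnP x m; last first.
  by have := mono m x; rewrite rm mx dm => /(_ isT); rewrite leqn0 => /eqP ->; lia.
have := min x; rewrite rx /=; case: (d x) dx => [|[]] // _; last by lia.
by move/(_ isT); lia.
Qed.

Lemma plane_profile (d : nat -> nat) : nonincreasing_from 2 d -> d 0 = 1%N ->
  d 1 = 1%N ->
  (d 2 <= 2)%N -> (exists2 x, (2 <= x)%N & d x = 1%N) ->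
  (exists i j, (1 <= j)%N /\ forall x, d x = dimN i j x) \/
  (exists i, forall x, d x = dimN_infty i x).
Proof.
move=> mono d0 d1 d2 [z z2 dz].
have exr : exists x, (2 <= x)%N && (d x <= 1)%N by exists z; rewrite z2 dz.
case: (ex_minnP exr) => r /andP[r2 dr] min.
have rz : (r <= z)%N by apply: min; rewrite z2 dz.
have dr1 : d r = 1%N.
  by apply/eqP; rewrite eqn_leq dr /= -dz; apply: mono; rewrite r2.
have dl x : (2 <= x < r)%N -> d x = 2%N.
  move=> /andP[x2 xr]; have := mono 2%N x; rewrite x2 => /(_ isT) dx.
  apply/eqP; rewrite eqn_leq (leq_trans dx d2) ltnNge; apply/negP => dx1.
  by have := min x; rewrite x2 dx1 => /(_ isT); lia.
have mono' : nonincreasing_from r d by move=> x y; move=> h; apply: mono; lia.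
have [h|[l h]] := thin_profile mono' dr1; [right|left].
  (* [r] is the first vertex of the tail of dimension one, so [i] counts the vertices from 2 to
     [r.-1]. *)
  exists (r - 2)%N => -[|[|x]]; rewrite /dimN_infty //=.
  by case: ifP => xr; [apply: dl|apply: h]; lia.
exists (r - 2)%N, l.+1; split=> // -[|[|x]]; rewrite /dimN //=.
case: ifP => xr; first by apply: dl; lia.
by rewrite h; last lia; case: ifP; lia.
Qed.

(** * Isomorphism from equality of dimension vectors *)

Section Uniqueness.
Variables (k : fieldType) (Q : quiver).
Variables (v : nat -> vertex Q) (a : nat -> arrow Q).
Hypotheses (v_bij : bijective v) (a_bij : bijective a).
Hypothesis a_joins : forall e,
  joins (a e) (v (Dinf_edge e).1) (v (Dinf_edge e).2).

Local Notation mats D := (forall b : arrow Q, 'M[k]_(D (src b), D (tgt b))).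
Implicit Types (D : vertex Q -> nat).

(** Nonzero spaces at both leaves rule out support at one leaf or on the tail, and the dimension at
    2 then puts both systems in the same remaining case. *)
Lemma same_dims_iso n D (F F' : mats D) :
  rigid (rep_system v a F) -> rigid (rep_system v a F') ->
  bij_from (rep_system v a F) n -> bij_from (rep_system v a F') n ->
  D (v 0) <> 0%N -> D (v 1) <> 0%N -> rep_iso (mxrep F) (mxrep F').
Proof.
move=> R R' b b' n0 n1.
have nz : exists x, D (v x) != 0%N by exists 0%N; apply/eqP.
have oS : same_orientation (rep_system v a F) (rep_system v a F') by apply:
  rep_system_orientation.
have [r r2 dr dl|r r2 dr dl gS|gS d2|u0 u1 gS L] := rigidP R nz b.
- by case: r r2 dl dr => [|[|r]] // _ dl _; [case: n1|case: n0]; apply: dl.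
- by case: n0; apply: dl; lia.
- have [r' r2 dr dl|r' r2 dr dl gS'|gS' _|u0' u1' gS' L'] := rigidP R' nz b'.
  + by case: r' r2 dl dr => [|[|r']] // _ dl _; [case: n1|case: n0]; apply: dl.
  + by case: n0; apply: dl; lia.
  + by have [f hf uf] := thin_iso gS gS' b b' oS d2; apply:
    (system_iso v_bij a_bij a_joins hf).
  + by have [e _ _] := three_lines_dim L'; move: e; rewrite d2.
- have [r' r2 dr dl|r' r2 dr dl gS'|gS' d2|u0' u1' gS' L'] := rigidP R' nz b'.
  + by case: r' r2 dl dr => [|[|r']] // _ dl _; [case: n1|case: n0]; apply: dl.
  + by case: n0; apply: dl; lia.
  + by have [e _ _] := three_lines_dim L; move: e; rewrite d2.
  + by have [f hf uf] := plane_iso gS gS' b b' oS L L'; apply: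
    (system_iso v_bij a_bij a_joins hf).
Qed.

Lemma some_repP (P : rep k Q -> Prop) : (exists N, P N) -> P (some_rep P).
Proof. by move=> h; rewrite /some_rep; case: pselect => // h'; case: cid. Qed.

Lemma bij_from_leq d (S : system k d) m n : (m <= n)%N -> bij_from S m -> bij_from S n.
Proof. by move=> mn b x nx; apply: b; apply: leq_trans nx. Qed.

Lemma mxrep_same_dims (N : rep k Q) D : locally_finite_dim N ->
  (forall x, has_dim (space N (v x)) (D (v x))) ->
  exists F : mats D, rep_iso N (mxrep F).
Proof.
move=> lN dN; have [D' [F' iso]] := mxrepP lN.
suff DD : D' = D by subst D'; exists F'.
apply/funext; apply: (all_vertices v_bij) => x.
apply: (has_dim_unique (has_dim_mxrep F' (v x))).
exact: rep_iso_dim (rep_iso_sym iso) (dN x).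
Qed.

Lemma has_dim_vector_mxrep D (F : mats D) dv : (forall x, D (v x) = dv x) ->
  has_dim_vector v (mxrep F) dv.
Proof. by move=> h x; rewrite -h; apply: has_dim_mxrep. Qed.

(** [mxrep F] witnesses that the specification of [N_rep] can be met, so the chosen representation
    meets it and uniqueness applies. *)
Lemma N_rep_iso i j D (F : mats D) : (1 <= j)%N -> rep_plus (mxrep F) ->
  indecomposable (mxrep F) -> (forall x, D (v x) = dimN i j x) ->
  rep_iso (mxrep F) (N_rep k v i j).
Proof.
move=> j1 pF iF dF.
have [pN iN dN] : [/\ rep_plus (N_rep k v i j), indecomposable (N_rep k v i j) &
                  has_dim_vector v (N_rep k v i j) (dimN i j)].
  apply: (some_repP (P := fun N => [/\ rep_plus N,
    indecomposable N & has_dim_vector v N (dimN i j)])).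
  by exists (mxrep F); split=> //; apply: has_dim_vector_mxrep.
have [|F' iso] := @mxrep_same_dims (N_rep k v i j) D (proj1 pN).
  by move=> x; rewrite dF; apply: dN.
apply: rep_iso_trans (rep_iso_sym iso).
have pF' := rep_plus_iso iso pN; have iF' := indecomposable_iso iso iN.
have [n [_ b _]] := rep_plus_bij_from v_bij a_bij a_joins pF.
have [n' [_ b' _]] := rep_plus_bij_from v_bij a_bij a_joins pF'.
apply: (@same_dims_iso (maxn n n')).
- exact: (indecomposable_rigid v_bij a_bij a_joins iF).
- exact: (indecomposable_rigid v_bij a_bij a_joins iF').
- exact: bij_from_leq (leq_maxl _ _) b.
- exact: bij_from_leq (leq_maxr _ _) b'.
- by rewrite dF.
- by rewrite dF.
Qed.

(** A map between lines that is not bijective is zero and disconnects the system: the identity up to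
    [x] and zero beyond is a nontrivial idempotent. This serves for [N_infty], whose specification
    mentions no presentation. *)
Lemma rigid_bij_from d (S : system k d) n : rigid S -> (2 <= n)%N ->
  (forall x, (n <= x)%N -> d x = 1%N) -> bij_from S n.
Proof.
move=> R n2 d1 x nx; apply/negPn/negP => nb.
have dx : d x = 1%N by apply: d1.
have dx1 : d x.+1 = 1%N by apply/d1/leqW.
pose f y : 'M[k]_(d y) := if (y <= x)%N then 1%:M else 0.
have one m n' (G : 'M[k]_(m, n')) : m = 1%N -> n' = 1%N ->
    ~~ (row_full G && row_free G) -> G = 0.
  move=> m1 n1; subst m n'; rewrite -row_leq_rank -col_leq_rank => h; apply/eqP.
  by rewrite -mxrank_eq0; move: h; rewrite andbb; lia.
have hx : step_hom (tail S x) (tail S x) (f x) (f x.+1).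
  rewrite /f leqnn ltnn; case: (tail S x) nb => G /= nb.
    by rewrite (one _ _ G dx dx1 nb) !mulmx0.
  by rewrite (one _ _ G dx1 dx nb) !mul0mx.
have hf : system_hom S S f.
  have fle y : (y <= x)%N -> f y = 1%:M by rewrite /f => ->.
  have fgt y : (x < y)%N -> f y = 0 by rewrite /f ltnNge => /negPf->.
  split=> [y y2||].
  - have [->|] := eqVneq y x; first exact: hx.
    case: (ltngtP y x) => // yx _.
      by rewrite (fle y) ?(fle y.+1) // 1?ltnW //; apply: step_hom_scalar.
    by rewrite (fgt y) // (fgt y.+1) 1?ltnW //; apply: step_hom0.
  - by rewrite (fle 2%N) ?(fle 0%N); try lia; apply: step_hom_scalar.
  - by rewrite (fle 2%N) ?(fle 1%N); try lia; apply: step_hom_scalar.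
have [y||f0|f1] := R f.
- by rewrite /f; case: ifP; rewrite ?mulmx1 ?mulmx0.
- exact: hf.
- by have := f0 x; rewrite /f leqnn => /dim_eq0; rewrite dx.
- by have := f1 x.+1; rewrite /f ltnn => /esym /dim_eq0; rewrite dx1.
Qed.

Lemma N_infty_iso i D (F : mats D) : indecomposable (mxrep F) ->
  (forall x, D (v x) = dimN_infty i x) -> rep_iso (mxrep F) (N_infty k v i).
Proof.
move=> iF dF.
have [lN iN dN] : [/\ locally_finite_dim (N_infty k v i),
  indecomposable (N_infty k v i) &
                  has_dim_vector v (N_infty k v i) (dimN_infty i)].
  apply: (some_repP (P := fun N => [/\ locally_finite_dim N, indecomposable N &
    has_dim_vector v N (dimN_infty i)])).
  exists (mxrep F); split=> //; last exact: has_dim_vector_mxrep.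
  by move=> z; exists (D z); apply: has_dim_mxrep.
have [|F' iso] := @mxrep_same_dims (N_infty k v i) D lN.
  by move=> x; rewrite dF; apply: dN.
apply: rep_iso_trans (rep_iso_sym iso).
have iF' := indecomposable_iso iso iN.
have R := indecomposable_rigid v_bij a_bij a_joins iF.
have R' := indecomposable_rigid v_bij a_bij a_joins iF'.
have d1 x : (i + 2 <= x)%N -> D (v x) = 1%N.
  move=> ix; rewrite dF /dimN_infty.
  by have [-> ->] : (x < 2)%N = false /\ (x < i + 2)%N = false by lia.
apply: (@same_dims_iso (i + 2)) => //.
- by apply: rigid_bij_from => //; lia.
- by apply: rigid_bij_from => //; lia.
- by rewrite dF.
- by rewrite dF.
Qed.

End Uniqueness.

(** * An explicit model of N_{i,infty} *)

Section Explicit.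
Variable k : fieldType.

(** [o] tells that the arrow of the edge [e] starts at the vertex [e]. For positive [i], the arms
    and the edge [i.+1] single out the lines of (1,0), (0,1) and (1,1), as the image of a row or the
    kernel of a column according to the orientation. All other maps are identities. *)
Definition Ninf_coef (i e : nat) (o : bool) (r c : nat) : k :=
  if i == 0%N then (r == c)%:R
  else if e == 0%N then (if o then c == 0%N else r == 1%N)%:R
  else if e == 1%N then (if o then c == 1%N else r == 0%N)%:R
  else if e == i.+1 then (if o && (r == 1%N) then -1 else 1)
  else (r == c)%:R.

Definition id_like m n (G : 'M[k]_(m, n)) := forall r c, G r c = (r == c :> nat)%:R.

Lemma id_like_hom m n (em : m = 2%N) (en : n = 2%N) (G : 'M[k]_(m, n)) X Y :
  id_like G -> X *m G = G *m Y -> castmx (em, em) X = castmx (en, en) Y.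
Proof.
subst m n; rewrite !castmx_id => h.
have -> : G = 1%:M by apply/matrixP => r c; rewrite h mxE.
by rewrite mulmx1 mul1mx.
Qed.

Lemma id_like_bij m n (G : 'M[k]_(m, n)) : m = n -> id_like G ->
  row_full G && row_free G.
Proof.
move=> mn; subst m => h.
have -> : G = 1%:M by apply/matrixP => r c; rewrite h mxE.
by rewrite row_full_unit row_free_unit unitmx1.
Qed.

Lemma row_free1 m n (G : 'M[k]_(m, n)) : m = 1%N -> G != 0 -> row_free G.
Proof. by move=> m1; subst m; rewrite -row_leq_rank rank_rV lt0b. Qed.

Lemma row_full1 m n (G : 'M[k]_(m, n)) : n = 1%N -> G != 0 -> row_full G.
Proof. by move=> m1; subst n; rewrite -col_leq_rank lt0n mxrank_eq0. Qed.

(** Commutation makes the row [g] an eigenvector of [X]; [mx2_col] is the dual for columns. *)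
Lemma mx2_row m (em : m = 1%N) n (en : n = 2%N) (G : 'M[k]_(m, n)) (g : nat -> k) Y X :
  (forall r c, G r c = g c) -> Y *m G = G *m X ->
  exists y, forall c : 'I_2, y * g c = g 0%N * castmx (en,
    en) X ord0 c + g 1%N * castmx (en, en) X ord_max c.
Proof.
subst m n => h E; exists (Y 0 0) => c; rewrite castmx_id.
have := congr1 (fun A : 'M_(1, 2) => A 0 c) E.
by rewrite !mxE !big_ord_recl !big_ord0 !addr0 !h => ->; congr (_ + _ * X _ _);
  apply/val_inj.
Qed.

Lemma mx2_col m (em : m = 2%N) n (en : n = 1%N) (G : 'M[k]_(m, n)) (g : nat -> k) X Y :
  (forall r c, G r c = g r) -> X *m G = G *m Y ->
  exists y, forall r : 'I_2, castmx (em, em) X r ord0 * g 0%N + castmx (em,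
    em) X r ord_max * g 1%N = g r * y.
Proof.
subst m n => h E; exists (Y 0 0) => r; rewrite castmx_id.
have := congr1 (fun A : 'M_(2, 1) => A r 0) E.
by rewrite !mxE !big_ord_recl !big_ord0 !addr0 !h => <-; congr (_ + X _ _ * _);
  apply/val_inj.
Qed.

Lemma nonzero_entry m n (G : 'M[k]_(m, n)) (g : nat -> nat -> k) r c :
  (forall r c, G r c = g r c) -> (r < m)%N -> (c < n)%N -> g r c != 0 -> G != 0.
Proof.
move=> h rm cn; apply: contra => /eqP G0.
by rewrite -(h (Ordinal rm) (Ordinal cn)) G0 mxE.
Qed.

Variables (Q : quiver) (v : nat -> vertex Q) (a : nat -> arrow Q).
Hypotheses (v_bij : bijective v) (a_bij : bijective a).
Hypothesis a_joins : forall e,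
  joins (a e) (v (Dinf_edge e).1) (v (Dinf_edge e).2).

Local Notation mats D := (forall b : arrow Q, 'M[k]_(D (src b), D (tgt b))).
Implicit Types (D : vertex Q -> nat).

Lemma joins_id_like D (F : mats D) (f : forall z, 'M[k]_(D z)) b p q
    (ep : D p = 2%N) (eq : D q = 2%N) : joins b p q ->
  f (src b) *m F b = F b *m f (tgt b) -> id_like (F b) ->
  castmx (ep, ep) (f p) = castmx (eq, eq) (f q).
Proof.
case=> -[E1 E2] h idF; subst p q; first exact: id_like_hom h.
exact/esym/(id_like_hom _ _ idF h).
Qed.

Section Construction.
Variables (i : nat) (w : vertex Q -> nat) (w' : arrow Q -> nat).
Hypotheses (vK : cancel v w) (wK : cancel w v) (aK : cancel a w') (wK' : cancel w' a).

Definition NinfD z := dimN_infty i (w z).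
Definition NinfF : mats NinfD :=
  fun b => \matrix_(r, c) Ninf_coef i (w' b) `[< src b = v (w' b) >] r c.

Lemma NinfDE x : NinfD (v x) = dimN_infty i x.
Proof. by rewrite /NinfD vK. Qed.

Lemma NinfFE e r c : NinfF (a e) r c = Ninf_coef i e `[< src (a e) = v e >] r c.
Proof. by rewrite mxE aK. Qed.

Lemma Ninf_id_like e : i = 0%N \/ ((2 <= e)%N /\ e <> i.+1) -> id_like (NinfF (a e)).
Proof.
move=> h r c; rewrite NinfFE /Ninf_coef; case: eqP => // i0.
by case: h => // -[e2 ei]; rewrite !ifN //; apply/eqP => //; lia.
Qed.

Lemma Ninf_tail_bij e : (2 <= e)%N -> i = 0%N \/ e <> i.+1 ->
  row_full (NinfF (a e)) && row_free (NinfF (a e)).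
Proof.
move=> e2 h; apply: id_like_bij; last by apply: Ninf_id_like; tauto.
have De : NinfD (v e) = NinfD (v e.+1).
  by rewrite !NinfDE /dimN_infty; do !case: ifP; lia.
by have [[-> ->]|[-> ->]] := tail_joins a_joins e2; rewrite De.
Qed.

Lemma Ninf_good : good_system (rep_system v a NinfF).
Proof.
have v_inj : injective v by apply: bij_inj.
have D0 : NinfD (v 0) = 1%N by rewrite NinfDE.
have D1 : NinfD (v 1) = 1%N by rewrite NinfDE.
have D2 : NinfD (v 2) = if i == 0%N then 1%N else 2%N.
  by rewrite NinfDE /dimN_infty /=; do !case: ifP; lia.
have nz e r c : (r < NinfD (src (a e)))%N -> (c < NinfD (tgt (a e)))%N ->
    Ninf_coef i e `[< src (a e) = v e >] r c != 0 -> NinfF (a e) != 0.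
  by apply: nonzero_entry => r' c'; apply: NinfFE.
have n0 : 1 != 0 :> k by apply: oner_neq0.
split=> [x x2||].
- have [/andP[i0 /eqP xi]|xi] := boolP ((i != 0%N) && (x == i.+1)); last first.
    apply: edge_step_good_bij; first exact: tail_joins.
    by right; apply: Ninf_tail_bij => //; move: xi; lia.
  have Dx : NinfD (v x) = 2%N by rewrite NinfDE /dimN_infty; do !case: ifP; lia.
  have Dx1 : NinfD (v x.+1) = 1%N by rewrite NinfDE /dimN_infty; do !case: ifP; lia.
  have c0 o : Ninf_coef i x o 0 0 != 0.
    by rewrite /Ninf_coef (negPf i0) xi /= eqSS (negPf i0) eqxx andbF.
  apply: edge_step_good; first exact: tail_joins.
    by move=> s t; apply: row_full1; [rewrite t|apply: (nz x 0 0);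
      rewrite ?s ?t ?Dx ?Dx1].
  by move=> s t; apply: row_free1; [rewrite s|apply: (nz x 0 0);
    rewrite ?s ?t ?Dx ?Dx1].
- have [i0|i0] := eqVneq i 0%N.
    have c0 o : Ninf_coef i 0 o 0 0 != 0 by rewrite /Ninf_coef i0.
    apply: edge_step_good; first exact: arm0_joins.
      by move=> s t; apply: row_full1; [rewrite t|apply: (nz 0 0 0)%N;
        rewrite ?s ?t ?D2 ?D0 // i0].
    by move=> s t; apply: row_free1; [rewrite s|apply: (nz 0 0 0)%N;
      rewrite ?s ?t ?D2 ?D0 // i0].
  rewrite (negPf i0) in D2; apply: edge_step_good; first exact: arm0_joins.
    move=> s t; apply: row_full1; [by rewrite t|apply: (nz 0 1 0)%N;
      rewrite ?s ?t ?D2 ?D0 //].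
    by rewrite /Ninf_coef (negPf i0) asboolF // => /v_inj.
  move=> s t; apply: row_free1; [by rewrite s|apply: (nz 0 0 0)%N;
    rewrite ?s ?t ?D2 ?D0 //].
  by rewrite /Ninf_coef (negPf i0) asboolT.
- have [i0|i0] := eqVneq i 0%N.
    have c0 o : Ninf_coef i 1 o 0 0 != 0 by rewrite /Ninf_coef i0.
    apply: edge_step_good; first exact: arm1_joins.
      by move=> s t; apply: row_full1; [rewrite t|apply: (nz 1 0 0)%N;
        rewrite ?s ?t ?D2 ?D1 // i0].
    by move=> s t; apply: row_free1; [rewrite s|apply: (nz 1 0 0)%N;
      rewrite ?s ?t ?D2 ?D1 // i0].
  rewrite (negPf i0) in D2; apply: edge_step_good; first exact: arm1_joins.
    move=> s t; apply: row_full1; [by rewrite t|apply: (nz 1 0 0)%N;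
      rewrite ?s ?t ?D2 ?D1 //].
    by rewrite /Ninf_coef (negPf i0) asboolF // => /v_inj.
  move=> s t; apply: row_free1; [by rewrite s|apply: (nz 1 0 1)%N;
    rewrite ?s ?t ?D2 ?D1 //].
  by rewrite /Ninf_coef (negPf i0) asboolT.
Qed.

Lemma castmx_family D (f : forall z, 'M[k]_(D z)) z z' m (e : D z = m) (e' : D z' = m) :
  z = z' -> castmx (e, e) (f z) = castmx (e', e') (f z').
Proof. by move=> E; subst z'; rewrite (eq_irrelevance e e'). Qed.

Lemma castmx_scalar m n (e : m = n) (X : 'M[k]_m) c : castmx (e, e) X = c%:M ->
  X = c%:M.
Proof. by subst n; rewrite castmx_id. Qed.

(** For positive [i] the map at 2 preserves both coordinate lines, so it is diagonal, and the line
    of (1,1), so its diagonal entries agree. *)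
Lemma Ninf_root_scalar (f : forall z, 'M[k]_(NinfD z)) :
  mxrep_hom NinfF NinfF f -> exists c, f (v 2) = c%:M.
Proof.
have v_inj : injective v by apply: bij_inj.
move=> hf; have [i0|i0] := eqVneq i 0%N.
  have D2 : NinfD (v 2) = 1%N by rewrite NinfDE /dimN_infty i0.
  move: (f (v 2)); rewrite D2 => A; exists (A 0 0); exact: mx11_scalar.
have E y : (2 <= y <= i.+1)%N -> NinfD (v y) = 2%N.
  by rewrite NinfDE /dimN_infty; do !case: ifP; lia.
have E2 : NinfD (v 2) = 2%N by apply: E; lia.
set X := castmx (E2, E2) (f (v 2)).
(* Identity maps carry the matrix at 2 to the vertex [i.+1], where the third line is given. *)
have trans y : (2 <= y <= i.+1)%N -> forall Ey : NinfD (v y) = 2%N, castmx (Ey,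
  Ey) (f (v y)) = X.
  elim: y => [|y IH]; first by lia.
  have [->|y1] := eqVneq y 1%N; first by move=> _ Ey; apply: castmx_family.
  move=> yi Ey1; have Ey : NinfD (v y) = 2%N by apply: E; lia.
  rewrite -(IH _ Ey); last by lia.
  apply/esym/(joins_id_like _ _ (tail_joins a_joins (x := y) _) (hf (a y)));
    first by lia.
  by apply: Ninf_id_like; right; lia.
have D0 : NinfD (v 0) = 1%N by rewrite NinfDE.
have D1 : NinfD (v 1) = 1%N by rewrite NinfDE.
have toX z (e : NinfD z = 2%N) : z = v 2 -> castmx (e, e) (f z) = X.
  exact: castmx_family.
have X01 : X ord0 ord_max = 0.
  have [[s t]|[s t]] := arm0_joins a_joins.
    have es : NinfD (src (a 0)) = 2%N by rewrite s.
    have et : NinfD (tgt (a 0)) = 1%N by rewrite t.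
    have [|y /(_ ord0)] := mx2_col es et (g := fun r => (r == 1%N)%:R) _ (hf (a 0)).
      by move=> r c; rewrite NinfFE /Ninf_coef (negPf i0) asboolF // s => /v_inj.
    by rewrite (toX _ es s) /= mulr0 mulr1 add0r mul0r.
  have es : NinfD (src (a 0)) = 1%N by rewrite s.
  have et : NinfD (tgt (a 0)) = 2%N by rewrite t.
  have [|y /(_ ord_max)] := mx2_row es et (g := fun r => (r == 0%N)%:R) _ (hf (a 0)).
    by move=> r c; rewrite NinfFE /Ninf_coef (negPf i0) asboolT.
  by rewrite (toX _ et t) /= mulr0 mul1r mul0r addr0.
have X10 : X ord_max ord0 = 0.
  have [[s t]|[s t]] := arm1_joins a_joins.
    have es : NinfD (src (a 1)) = 2%N by rewrite s.
    have et : NinfD (tgt (a 1)) = 1%N by rewrite t.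
    have [|y /(_ ord_max)] := mx2_col es et (g := fun r => (r == 0%N)%:R) _ (hf (a 1)).
      by move=> r c; rewrite NinfFE /Ninf_coef (negPf i0) asboolF // s => /v_inj.
    by rewrite (toX _ es s) /= mulr0 mulr1 addr0 mul0r.
  have es : NinfD (src (a 1)) = 1%N by rewrite s.
  have et : NinfD (tgt (a 1)) = 2%N by rewrite t.
  have [|y /(_ ord0)] := mx2_row es et (g := fun r => (r == 1%N)%:R) _ (hf (a 1)).
    by move=> r c; rewrite NinfFE /Ninf_coef (negPf i0) asboolT.
  by rewrite (toX _ et t) /= mulr0 mul1r mul0r add0r.
have Ei : NinfD (v i.+1) = 2%N by apply: E; lia.
have Ei1 : NinfD (v i.+2) = 1%N by rewrite NinfDE /dimN_infty; do !case: ifP; lia.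
have toXi z (e : NinfD z = 2%N) : z = v i.+1 -> castmx (e, e) (f z) = X.
  by move=> ze; rewrite -(trans i.+1 _ Ei) ?castmx_family //; [apply:
    castmx_family|lia].
have X11 : X ord_max ord_max = X ord0 ord0.
  have coefE o r c : Ninf_coef i i.+1 o r c = if o && (r == 1%N) then -1 else 1.
    by rewrite /Ninf_coef (negPf i0) /= eqSS (negPf i0) eqxx.
  have i2 : (1 < i.+1)%N by lia.
  have [[s t]|[s t]] := tail_joins a_joins i2.
    have es : NinfD (src (a i.+1)) = 2%N by rewrite s.
    have et : NinfD (tgt (a i.+1)) = 1%N by rewrite t.
    have [|y H] := mx2_col es et (g := fun r =>
      if r == 1%N then -1 else 1) _ (hf (a i.+1)).
      by move=> r c; rewrite NinfFE coefE asboolT.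
    move: (H ord0) (H ord_max);
      rewrite (toXi _ es s) /= X01 X10 !mul0r addr0 add0r mulr1 mul1r => ->.
    by rewrite mulN1r mulrN1 => /oppr_inj.
  have es : NinfD (src (a i.+1)) = 1%N by rewrite s.
  have et : NinfD (tgt (a i.+1)) = 2%N by rewrite t.
  have [|y H] := mx2_row es et (g := fun r => 1) _ (hf (a i.+1)).
    by move=> r c; rewrite NinfFE coefE asboolF // s => /v_inj; lia.
  move: (H ord0) (H ord_max);
    rewrite (toXi _ et t) /= X01 X10 mulr0 mulr1 addr0 add0r !mul1r => ->.
  by [].
exists (X ord0 ord0); apply: (@castmx_scalar _ _ E2); rewrite -/X.
apply/matrixP => r c; rewrite mxE.
have ord2 (j : 'I_2) : j = ord0 \/ j = ord_max.
  by case: j => [[|[|j]] hj] //; [left|right]; apply/val_inj.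
by have [->|->] := ord2 r; have [->|->] := ord2 c;
  rewrite ?X01 ?X10 ?X11 ?mulr0n ?mulr1n.
Qed.

(** A scalar at 2 extends only to the same scalar everywhere, and an idempotent scalar is 0 or 1. *)
Lemma Ninf_indecomposable : indecomposable (mxrep NinfF).
Proof.
apply: idempotent_indecomposable; first by exists (v 0); rewrite NinfDE.
move=> f ff hf; have [c fc] := Ninf_root_scalar hf.
have fcE : forall z, f z = c%:M.
  apply: (all_vertices v_bij); apply: (system_hom_uniq Ninf_good Ninf_good
    (g := fun x => c%:M) _ _ fc); first by apply/rep_system_hom.
  by split=> [x _||]; apply: step_hom_scalar.
have cc : c * c = c.
  have j : 'I_(NinfD (v 0)) by rewrite NinfDE; exact: ord0.
  have /matrixP/(_ j j) := ff (v 0); rewrite fcE -scalar_mxM !mxE eqxx.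
  by rewrite !mulr1n.
have /eqP : c * (c - 1) = 0 by rewrite mulrBr cc mulr1 subrr.
rewrite mulf_eq0 subr_eq0 => /orP[] /eqP c01; [left|right] => z; rewrite fcE c01 //.
by apply/matrixP => r s; rewrite !mxE mul0rn.
Qed.

Lemma Ninf_rep_plus n : (forall x, (n <= x)%N -> outward v a x) ->
  rep_plus (mxrep NinfF).
Proof.
move=> o; apply: (@tail_rep_plus k Q v a v_bij a_bij a_joins (n + i).+4); first by lia.
- by move=> x nx; apply: o; lia.
- by rewrite NinfDE /dimN_infty; do !case: ifP; lia.
- by move=> x nx; apply: Ninf_tail_bij; lia.
Qed.

End Construction.

Lemma Ninf_exists i n : (forall x, (n <= x)%N -> outward v a x) ->
  exists D (F : mats D), [/\ rep_plus (mxrep F), indecomposable (mxrep F) &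
    forall x, D (v x) = dimN_infty i x].
Proof.
move=> o; have [w vK wK] := v_bij; have [w' aK wK'] := a_bij.
exists (NinfD i w), (@NinfF i w w'); split.
- exact: Ninf_rep_plus o.
- exact: Ninf_indecomposable.
- exact: NinfDE.
Qed.

End Explicit.

(** * Walks towards infinity *)

Local Open Scope classical_set_scope.
Local Open Scope ring_scope.

Definition next_vertex (e : nat) : nat := if e == 0%N then 2%N else e.+1.

Lemma Dinf_edgeE e : Dinf_edge e = (e, next_vertex e).
Proof. by rewrite /Dinf_edge /next_vertex; case: eqP => [->|]. Qed.

Lemma next_vertex_gt e : (e < next_vertex e)%N.
Proof. by rewrite /next_vertex; case: e. Qed.

(* The edge starting at the vertex e and leading towards infinity has number e. *)
Definition ray (s i : nat) : nat := iter i next_vertex s.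

Lemma ray_ltn s : {homo ray s : i j / (i < j)%N}.
Proof. by apply: homo_ltn => [j i l|i]; [apply: ltn_trans|apply: next_vertex_gt]. Qed.

Lemma ray_inj s : injective (ray s).
Proof.
by move=> i j e; case: (ltngtP i j) => // /(ray_ltn s); rewrite e ltnn.
Qed.

Lemma leq_ray s i : (i <= ray s i)%N.
Proof. by elim: i => //= i IH; apply: leq_ltn_trans IH (next_vertex_gt _). Qed.

(* None stands for an infinite number of edges. *)
Definition in_length (L : option nat) (i : nat) :=
  if L is Some l then (i < l)%N else true.
Definition in_vertices (L : option nat) (i : nat) :=
  if L is Some l then (i <= l)%N else true.

Section Walks.
Variables (Q : quiver) (v : nat -> vertex Q) (a : nat -> arrow Q).
Hypotheses (v_bij : bijective v) (a_bij : bijective a).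
Hypothesis a_joins : forall e,
  joins (a e) (v (Dinf_edge e).1) (v (Dinf_edge e).2).

Let v_inj : injective v. Proof. exact: bij_inj. Qed.
Let a_inj : injective a. Proof. exact: bij_inj. Qed.

Lemma next_joins e : joins (a e) (v e) (v (next_vertex e)).
Proof. by have := a_joins e; rewrite Dinf_edgeE. Qed.

Definition lower e := src (a e) = v e.

Lemma lowerP e : (lower e /\ tgt (a e) = v (next_vertex e)) \/
  (~ lower e /\ src (a e) = v (next_vertex e) /\ tgt (a e) = v e).
Proof.
have [[s t]|[s t]] := next_joins e; [by left|right; split=> //].
by rewrite /lower s => /v_inj e0; have := next_vertex_gt e; rewrite e0 ltnn.
Qed.

Definition ray_edge s i : edge Q :=
  if `[< lower (ray s i) >] then Fwd (a (ray s i)) else Inv (a (ray s i)).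

Lemma ray_edge_start s i : edge_start (ray_edge s i) = v (ray s i).
Proof. by rewrite /ray_edge; case: asboolP => //= h; have [[]|[_ []]] :=
  lowerP (ray s i). Qed.

Lemma ray_edge_end s i : edge_end (ray_edge s i) = v (ray s i.+1).
Proof. by rewrite /ray_edge; case: asboolP => //= h; have [[]|[? []]] :=
  lowerP (ray s i). Qed.

Lemma ray_edgeP s i b : ray_edge s i = Fwd b \/ ray_edge s i = Inv b <->
  b = a (ray s i).
Proof.
rewrite /ray_edge; case: asboolP => _; split.
- by case=> // -[->].
- by move=> ->; left.
- by case=> // -[->].
- by move=> ->; right.
Qed.

Definition ray_walk s (L : option nat) : walk Q :=
  match L with
  | None => RightInfWalk (ray_edge s)
  | Some 0 => TrivWalk (v s)
  | Some l.+1 => FinWalk (ray_edge s 0) [seq ray_edge s i | i <- iota 1 l]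
  end.

Lemma map_iota_split T (c : nat -> T) n s1 d s2 :
  [seq c i | i <- iota 0 n] = s1 ++ d :: s2 -> (size s1 < n)%N /\ d = c (size s1).
Proof.
move=> e; have sn : (size s1 < n)%N.
  by have := congr1 size e; rewrite size_map size_iota size_cat /= => ->; lia.
split=> //; have := congr1 (nth d ^~ (size s1)) e.
rewrite /= nth_cat ltnn subnn /= => <-.
by rewrite (nth_map 0%N) ?size_iota // nth_iota.
Qed.

Lemma edges_of_ray s L c : edges_of (ray_walk s L) c <->
  exists2 i, in_length L i & c = ray_edge s i.
Proof.
case: L => [[|l]|] /=.
- by split=> // -[].
- rewrite -[ray_edge s 0 :: _]/[seq ray_edge s i | i <- iota 0 l.+1]; split.
    by move=> [s1 [s2 e]]; have [sl ->] := map_iota_split e; exists (size s1).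
  move=> [i il ->]; exists (take i [seq ray_edge s i | i <- iota 0 l.+1]).
  exists (drop i.+1 [seq ray_edge s i | i <- iota 0 l.+1]).
  rewrite -{1}(cat_take_drop i [seq ray_edge s i | i <- iota 0 l.+1]); congr (_ ++ _).
  rewrite (drop_nth (ray_edge s 0)) ?size_map ?size_iota //; congr (_ :: _).
  by rewrite (nth_map 0%N) ?size_iota // nth_iota.
- by split=> [[i _ <-]|[i _ ->]]; exists i.
Qed.

Lemma consecutive_ray s L c d : consecutive (ray_walk s L) c d ->
  exists i, c = ray_edge s i /\ d = ray_edge s i.+1.
Proof.
case: L => [[|l]|] //=.
rewrite -[ray_edge s 0 :: _]/[seq ray_edge s i | i <- iota 0 l.+1].
move=> [s1 [s2 e]]; exists (size s1).
have [_ ->] := map_iota_split e; split=> //.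
have e' : [seq ray_edge s i | i <- iota 0 l.+1] = rcons s1 c ++ d ::
  s2 by rewrite e cat_rcons.
by have [_ ->] := map_iota_split e'; rewrite size_rcons.
Qed.

Lemma vertices_of_ray s L z : vertices_of (ray_walk s L) z <->
  exists2 i, in_vertices L i & z = v (ray s i).
Proof.
have key L' : L' <> Some 0%N ->
    ((exists2 c, edges_of (ray_walk s L') c & z = edge_start c \/ z = edge_end c) <->
     exists2 i, in_vertices L' i & z = v (ray s i)).
  move=> nL; split.
    move=> [c /edges_of_ray[i iL ->]]; rewrite ray_edge_start ray_edge_end.
    by case=> ->; [exists i|exists i.+1] => //; case: L' iL {nL} => //= l; apply: ltnW.
  move=> [[|i] iL ->].
    exists (ray_edge s 0); last by left; rewrite ray_edge_start.
    by apply/edges_of_ray; exists 0%N => //; case: L' nL {iL} => // -[|].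
  exists (ray_edge s i); last by right; rewrite ray_edge_end.
  by apply/edges_of_ray; exists i => //; case: L' iL {nL}.
case: L => [[|l]|]; [|exact: (key (Some l.+1))|exact: (key None)].
split=> [->|[[|i] // _ ->]] //; by exists 0%N.
Qed.

(** The edges of the tree between vertices of a ray are edges of the ray, so the full subquiver has
    no further arrows. *)
Lemma ray_arrows s L b : vertices_of (ray_walk s L) (src b) ->
  vertices_of (ray_walk s L) (tgt b) -> exists2 i, in_length L i & b = a (ray s i).
Proof.
move=> /vertices_of_ray[i iL si] /vertices_of_ray[j jL tj].
have [e be] := arrowE a_bij b; subst b.
have key p q : in_vertices L q -> e = ray s p -> next_vertex e = ray s q ->
    exists2 i, in_length L i & a e = a (ray s i).
  move=> qL ep nq; exists p; last by rewrite ep.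
  have qp : q = p.+1 by apply: (@ray_inj s); rewrite -nq ep.
  by subst q; case: L qL {iL jL}.
have := next_joins e; rewrite /joins si tj =>
  -[[/v_inj h1 /v_inj h2]|[/v_inj h1 /v_inj h2]].
  by apply: (key i j).
by apply: (key j i).
Qed.

Lemma sig_inj (A : set (vertex Q)) (x y : {z | A z}) : sval x = sval y -> x = y.
Proof.
case: x y => [x px] [y py] /= e; subst y; congr exist; exact: Prop_irrelevance.
Qed.

(** Within a ray a path cannot change direction. Read backwards, a left infinite path would descend
    towards [s] forever or use inward edges arbitrarily far out; the latter contradicts finiteness
    or the hypothesis. *)
Lemma ray_no_left_infinite s L :
  (L = None -> exists n, forall i, (n <= i)%N -> lower (ray s i)) ->
  no_left_infinite_path (ray_walk s L).
Proof.
move=> ev [p pE].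
have /choice[I IE] n : exists i, in_length L i /\ sval (p n) = a (ray s i).
  by case: (p n) => b [sb tb] /=; have [i iL ->] := ray_arrows sb tb; exists i.
have ends n : tgt (a (ray s (I n.+1))) = src (a (ray s (I n))).
  have := congr1 sval (pE n); rewrite /=.
  by rewrite -(proj2 (IE n)) -(proj2 (IE n.+1)).
have step n : (lower (ray s (I n)) -> lower (ray s (I n.+1)) /\ I n = (I n.+1).+1) /\
    (~ lower (ray s (I n)) -> ~ lower (ray s (I n.+1)) /\ I n.+1 = (I n).+1).
  have := ends n; have [[l1 t1]|[l1 [s1 t1]]] := lowerP (ray s (I n));
    have [[l2 t2]|[l2 [s2 t2]]] := lowerP (ray s (I n.+1)).
  - rewrite t2 l1 => /v_inj e; split=> // _; split=> //.
    by apply: (@ray_inj s).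
  - rewrite t2 l1 => /v_inj/ray_inj e; case: l2; by rewrite e.
  - rewrite t2 s1 => /v_inj e; case: l1.
    have /ray_inj/succn_inj <- // : ray s (I n.+1).+1 = ray s (I n).+1 by [].
  - rewrite t2 s1 => /v_inj e; split=> // _; split=> //.
    by apply: (@ray_inj s).
have [l0|l0] := pselect (lower (ray s (I 0%N))).
  have H n : lower (ray s (I n)) /\ (I n + n = I 0)%N.
    by elim: n => [|n [ln IH]]; [rewrite addn0|have [/(_ ln)[? ?] _] := step n;
      split=> //; lia].
  by have := proj2 (H (I 0%N).+1); lia.
have H n : ~ lower (ray s (I n)) /\ (I n = I 0 + n)%N.
  by elim: n => [|n [ln IH]]; [rewrite addn0|have [_ /(_ ln)[? ?]] := step n; split=>
    //; lia].
have {}IE n : in_length L (I n) := proj1 (IE n).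
clear pE p; case: L ev IE => [l _|/(_ erefl)[n nP]] IE.
  by have /= := IE l; have := proj2 (H l); lia.
by case: (proj1 (H n)); apply: nP; rewrite (proj2 (H n)); lia.
Qed.

Lemma ray_string s L :
  (L = None -> exists n, forall i, (n <= i)%N -> lower (ray s i)) ->
  is_string (ray_walk s L).
Proof.
move=> ev; split.
- by move=> c d /consecutive_ray[i [-> ->]]; rewrite ray_edge_start ray_edge_end.
- move=> c d /consecutive_ray[i [-> ->]] e.
  have : ray_edge s i = Fwd (a (ray s i.+1)) \/ ray_edge s i = Inv (a (ray s i.+1)).
    move: e; rewrite {1}/ray_edge; case: ifP => _; case: (ray_edge s i) => b //= [->];
      by [left|right].
  by move=> /ray_edgeP/a_inj/ray_inj; lia.
pose W := ray_walk s L.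
have v0 : vertices_of W (v s) by apply/vertices_of_ray; exists 0%N => //; case: (L).
split.
  (* The start of the ray has at most one edge in the subquiver, so it is a sink or a source. *)
  exists (exist _ (v s) v0).
  have H b : vertices_of W (src b) -> vertices_of W (tgt b) -> src b = v s \/
    tgt b = v s ->
      b = a s.
    move=> sb tb; have [i iL be] := ray_arrows sb tb; subst b.
    have i0 : v (ray s i) = v s -> i = 0%N by move/v_inj/(@ray_inj s i 0).
    have i1 : v (next_vertex (ray s i)) <> v s by move/v_inj/(@ray_inj s i.+1 0).
    by have [[-> ->]|[-> ->]] := next_joins (ray s i); case=> // /i0 ->.
  have [[ls ts]|[ls [ss ts]]] := lowerP s.
    right=> -[b [sb tb]] /(congr1 sval) /= e.
    have be := H b sb tb (or_intror e); move: e; rewrite be ts => /v_inj e.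
    by have := next_vertex_gt s; rewrite e ltnn.
  left=> -[b [sb tb]] /(congr1 sval) /= e.
  by have be := H b sb tb (or_introl e); apply: ls; rewrite /lower -be.
have fin m : finite_set [set x : vertex (walk_quiver W) | exists2 i,
  (i <= m)%N & sval x = v (ray s i)].
  have -> : [set x : vertex (walk_quiver W) | exists2 i,
    (i <= m)%N & sval x = v (ray s i)] =
      sval @^-1` ((fun i => v (ray s i)) @` `I_m.+1).
    apply/seteqP; split=> x /=; first by move=> [i im ->]; exists i.
    by move=> [i im <-]; exists i.
  apply: finite_preimage; first by move=> x y _ _; apply: sig_inj.
  exact/finite_image/finite_II.
have [[l Ll]|LN] : (exists l, L = Some l) \/ L = None.
    by case: (L) => [l|]; [left; exists l|right].
  apply: sub_finite_set (fin l) => -[z zW] _ /=.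
  by move/vertices_of_ray: zW => [i]; rewrite Ll => il ->; exists i.
have [n nP] := ev LN.
apply: sub_finite_set (fin n) => -[z zW] /= zS.
move/vertices_of_ray: (zW) => [i _ zi]; exists i => //.
(* Beyond [n] a vertex ends one outward arrow and starts the next, hence is neither a sink nor a
   source. *)
rewrite leqNgt; apply/negP => ni; case: i zi ni => // i zi ni.
have li : lower (ray s i) by apply: nP.
have li1 : lower (ray s i.+1) by apply: nP; lia.
have V j : vertices_of W (v (ray s j)) by apply/vertices_of_ray; exists j => //;
  rewrite LN.
have [[_ ti]|[]//] := lowerP (ray s i); have [[si1 ti1]|[]//] := lowerP (ray s i.+1).
have A j : lower (ray s j) -> tgt (a (ray s j)) = v (next_vertex (ray s j)) ->
    vertices_of W (src (a (ray s j))) /\ vertices_of W (tgt (a (ray s j))).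
  by move=> lj ->; rewrite lj; split; [apply: V|apply: (V j.+1)].
case: zS => [/(_ (exist _ (a (ray s i.+1)) (A i.+1 li1 ti1)))|/(_ (exist _ (a (ray s
  i)) (A i li ti)))]; apply.
  by apply: sig_inj; rewrite /= li1 zi.
by apply: sig_inj; rewrite /= ti zi.
Qed.

(** A path cannot run inwards forever, as the edge numbers decrease, nor continue after entering a
    leaf. Once it goes outwards from 2 or beyond, it must keep doing so. *)
Lemma has_right_infinite_pathP :
  has_right_infinite_path Q <-> exists n, forall x, (n <= x)%N -> outward v a x.
Proof.
split; last first.
  move=> [n nP]; exists (fun j => a (n + j)%N) => j.
  have [|_ ->] := nP (n + j)%N; first by lia.
  by have [|-> _] := nP (n + j.+1)%N; [lia|rewrite addnS].
move=> [p pE]; have /choice[E EE] n : exists e, p n = a e by apply: arrowE.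
have ends n : tgt (a (E n)) = src (a (E n.+1)) by rewrite -!EE.
(* an edge followed towards the leaf 0 or 1 leads to a dead end *)
have dead n : (E n < 2)%N -> ~ lower (E n) -> False.
  move=> En ln; have [[]//|[_ [_ t]]] := lowerP (E n).
  have := ends n; rewrite t; have [[l' _]|[_ [-> _]]] := lowerP (E n.+1).
    by rewrite l' => /v_inj e; apply: ln; rewrite e.
  by move/v_inj; rewrite /next_vertex; case: ifP; lia.
have from2 n : tgt (a (E n)) = v 2 -> E n.+1 = 2%N /\ lower 2.
  move=> t; have := ends n; rewrite t.
  have [[l' _]|[nl' [-> _]]] := lowerP (E n.+1).
    by rewrite l' => /v_inj e2; rewrite {2}e2.
  move/v_inj => e2; case: (@dead n.+1 _ nl'); move: e2; rewrite /next_vertex.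
  by case: ifP; lia.
have up m : forall n, E n = m -> exists2 e, (2 <= e)%N & exists n, E n = e /\ lower e.
  elim/ltn_ind: m => m IH n Em.
  have [En|En] := ltnP (E n) 2.
    have [[ln t]|[ln _]] := lowerP (E n); last by case: (dead n En ln).
    have [|e2 l2] := from2 n; last by exists 2%N => //; exists n.+1.
    by rewrite t; case: (E n) En => [|[]].
  have [[ln t]|[ln [_ t]]] := lowerP (E n); first by exists (E n) => //; exists n.
  have [E2|E3] := eqVneq (E n) 2%N.
    by have [|e2 l2] := from2 n; [rewrite t E2|exists 2%N => //; exists n.+1].
  have := ends n; rewrite t; have [[l' _]|[nl' [-> _]]] := lowerP (E n.+1).
    by rewrite l' => /v_inj e; case: ln; rewrite e.
  move/v_inj => e; apply: (IH (E n.+1) _ n.+1) => //.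
  by rewrite -Em e next_vertex_gt.
have [e e2 [n [En le]]] := up _ 0%N erefl.
have H j : E (n + j)%N = (e + j)%N /\ lower (e + j)%N.
  elim: j => [|j [Ej lj]]; first by rewrite !addn0.
  have next_e : next_vertex (e + j) = (e + j.+1)%N by rewrite /next_vertex; case:
    ifP; lia.
  have := ends (n + j)%N; rewrite Ej; have [[_ ->]|[]//] := lowerP (e + j)%N.
  rewrite -addnS next_e; have [[l' _]|[nl' [-> _]]] := lowerP (E (n + j.+1)%N).
    by rewrite l' => /v_inj e1; rewrite -{1}e1; split=> //; rewrite e1.
  move/v_inj => e1; case: nl'; suff -> : E (n + j.+1)%N = (e + j)%N by [].
  by move: e1; rewrite /next_vertex; case: ifP; lia.
exists e => x ex; have [_ lx] := H (x - e)%N; rewrite subnKC // in lx.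
have [[_ t]|[]//] := lowerP x; split=> //; rewrite t /next_vertex.
by case: ifP => //; lia.
Qed.

End Walks.

(** * Classification *)

Lemma ray_pos s i : (0 < s)%N -> ray s i = (s + i)%N.
Proof.
move=> s0; elim: i => [|i]; rewrite ?addn0 //= => ->.
by rewrite /next_vertex; case: ifP; lia.
Qed.

Lemma ray0S i : ray 0 i.+1 = i.+2.
Proof. by elim: i => // i IH; rewrite /ray iterS -/(ray 0 i.+1) IH. Qed.

(** * String representations along rays and the case analysis *)

Section Strings.
Variables (k : fieldType) (Q : quiver) (v : nat -> vertex Q) (a : nat -> arrow Q).
Hypotheses (v_bij : bijective v) (a_bij : bijective a).
Hypothesis a_joins : forall e,
  joins (a e) (v (Dinf_edge e).1) (v (Dinf_edge e).2).

Let v_inj : injective v. Proof. exact: bij_inj. Qed.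

Local Notation mats D := (forall b : arrow Q, 'M[k]_(D (src b), D (tgt b))).
Implicit Types (D : vertex Q -> nat).

Let ray_verticesP := vertices_of_ray v_bij a_joins.

Section Ray.
Variables (s : nat) (L : option nat).

Local Notation W := (ray_walk v a s L).

Definition ray_dim (z : vertex Q) : nat := `[< vertices_of W z >].

(** Written so that [string_rep] of the ray walk is convertible to [mxrep] of these matrices. *)
Definition ray_mats : mats ray_dim :=
  fun b => pid_mx `[< edges_of W (Fwd b) \/ edges_of W (Inv b) >].

Lemma ray_mats_bij i : in_length L i ->
  row_full (ray_mats (a (ray s i))) && row_free (ray_mats (a (ray s i))).
Proof.
move=> iL.
have V j : in_vertices L j -> ray_dim (v (ray s j)) = 1%N.
  by move=> jL; rewrite /ray_dim asboolT //; apply/ray_verticesP; exists j.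
have D1 : ray_dim (v (ray s i)) = 1%N by apply: V; case: L iL => //= l; apply: ltnW.
have D2 : ray_dim (v (ray s i.+1)) = 1%N by apply: V; case: L iL.
have [Ds Dt] : ray_dim (src (a (ray s i))) = 1%N /\ ray_dim (tgt (a (ray s i))) = 1%N.
  by have [[-> ->]|[-> ->]] := next_joins a_joins (ray s i).
apply: id_like_bij; first by rewrite Ds Dt.
move=> r c; rewrite /ray_mats asboolT; last first.
  have := (@ray_edgeP Q v a s i (a (ray s i))).2 erefl.
  by case=> <-; [left|right]; apply/edges_of_ray; exists i.
by rewrite mxE; have := ltn_ord r; rewrite {2}Ds ltnS leqn0 => /eqP ->; rewrite andbT.
Qed.

Lemma ray_good_tail x : (2 <= x)%N -> (s <= x)%N ->
  good (tail (rep_system v a ray_mats) x).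
Proof.
move=> x2 sx; apply: edge_step_good_bij; first exact: (tail_joins a_joins).
have [V|nV] := pselect (vertices_of W (v x.+1)); last by left; rewrite /ray_dim asboolF.
right; move/ray_verticesP: V => [[|j] jL /v_inj xj]; first by rewrite /= in xj; lia.
have -> : x = ray s j.
  by move: xj => /=; rewrite /next_vertex; case: ifP; lia.
by apply: ray_mats_bij; case: L jL.
Qed.

Lemma ray_good_system : (s <= 2)%N -> vertices_of W (v 2) ->
  good_system (rep_system v a ray_mats).
Proof.
move=> s2 /ray_verticesP[j jL /v_inj e2].
have L0 : s <> 2%N -> in_length L 0.
  by case: j jL e2 => [|j] jL e2; [rewrite e2|case: L jL => //= l; lia].
have first_edge e : e = s -> in_length L 0 ->
    row_full (ray_mats (a e)) && row_free (ray_mats (a e)).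
  by move=> -> L0'; apply: (@ray_mats_bij 0).
split=> [x x2||]; first by apply: ray_good_tail => //; apply: leq_trans s2 x2.
- apply: edge_step_good_bij; first exact: (arm0_joins a_joins).
  have [V|nV] := pselect (vertices_of W (v 0)); last by left; rewrite /ray_dim asboolF.
  right; move/ray_verticesP: V => [i _ /v_inj e0].
  have i0 : i = 0%N by have := leq_ray s i; rewrite -e0; lia.
  have s0 : s = 0%N by rewrite e0 i0.
  by apply: first_edge; rewrite ?s0 //; apply: L0; rewrite s0.
- apply: edge_step_good_bij; first exact: (arm1_joins a_joins).
  have [V|nV] := pselect (vertices_of W (v 1)); last by left; rewrite /ray_dim asboolF.
  right; move/ray_verticesP: V => [[|i] _ /v_inj e1].
    have s1 : s = 1%N by rewrite e1.
    by apply: first_edge; rewrite ?s1 //; apply: L0; rewrite s1.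
  by move: e1 => /=; rewrite /next_vertex; case: ifP; lia.
Qed.

End Ray.

Definition eventually_lower s (L : option nat) :=
  L = None -> exists n, forall i, (n <= i)%N -> lower v a (ray s i).

Definition is_string_rep D (F : mats D) := exists w : walk Q,
  is_string w /\ no_left_infinite_path w /\ rep_iso (mxrep F) (string_rep k w).

Lemma ray_dim_eq s L D :
  (forall x, D (v x) = `[< exists2 i, in_vertices L i & x = ray s i >] :> nat) ->
  D = ray_dim s L.
Proof.
move=> h; apply/funext; apply: (all_vertices v_bij) => x; rewrite h /ray_dim;
  congr nat_of_bool.
apply: asbool_equiv_eq; split.
  by move=> [i iL ->]; apply/ray_verticesP; exists i.
by move=> /ray_verticesP[i iL /v_inj ->]; exists i.
Qed.

Lemma string_of_ray s L (F : mats (ray_dim s L)) : eventually_lower s L ->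
  rep_iso (mxrep F) (mxrep (ray_mats s L)) -> is_string_rep F.
Proof.
move=> ev iso; exists (ray_walk v a s L); split; first exact: ray_string.
by split; first exact: ray_no_left_infinite.
Qed.

(** The maps of the string are good, and bijectivity of those of [F] makes the dimensions equal. *)
Lemma ray_bij_from s L n (F : mats (ray_dim s L)) : (2 <= n)%N ->
  bij_from (rep_system v a F) n ->
  bij_from (rep_system v a (ray_mats s L)) (maxn n s).
Proof.
move=> n2 b x nx; apply: good_bij; first by apply: ray_good_tail; lia.
by apply: bij_dim (b x _); lia.
Qed.

Lemma arm_string r D (F : mats D) : (r < 2)%N -> D (v r) = 1%N ->
  (forall x, x != r -> D (v x) = 0%N) -> is_string_rep F.
Proof.
move=> r2 dr dx.
have DE : D = ray_dim r (Some 0%N).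
  apply: ray_dim_eq => x; have [->|xr] := eqVneq x r.
    by rewrite dr asboolT //; exists 0%N.
  rewrite dx // asboolF // => -[[|i] // _ xe].
  by move: xr; rewrite xe /= eqxx.
subst D; apply: string_of_ray => //.
rewrite (single_vertex_unique v_bij a_bij a_joins F (ray_mats r (Some 0%N)) (y := r)).
  exact: rep_iso_refl.
apply: (all_vertices v_bij) => x xr; apply: dx; apply/eqP => e.
by apply: xr; rewrite e.
Qed.

Lemma tail_string r n L D (F : mats D) : (2 < r)%N -> (2 <= n)%N ->
  bij_from (rep_system v a F) n -> good_from (rep_system v a F) r ->
  (forall x, D (v x) = `[< exists2 i, in_vertices L i & x = ray r i >] :> nat) ->
  eventually_lower r L -> is_string_rep F.
Proof.
move=> r2 n2 b gS DE ev; have E := ray_dim_eq DE; subst D; apply: string_of_ray => //.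
have b' := ray_bij_from n2 b.
have dr : ray_dim r L (v r) = 1%N by rewrite DE asboolT //; exists 0%N => //; case: (L).
have dl x : (x < r)%N -> ray_dim r L (v x) = 0%N.
  move=> xr; rewrite DE asboolF // => -[i _ xi].
  by move: xr; rewrite xi ray_pos; lia.
have [|f hf uf] := tail_iso r2 dr dl gS _ (bij_from_leq (leq_maxl n r) b) b'
  (rep_system_orientation _ _ _ _).
  by move=> x rx; apply: ray_good_tail; lia.
exact: (system_iso v_bij a_bij a_joins hf).
Qed.

Lemma thin_string s n L D (F : mats D) : (s <= 2)%N -> (2 <= n)%N ->
  bij_from (rep_system v a F) n -> good_system (rep_system v a F) -> D (v 2) = 1%N ->
  (forall x, D (v x) = `[< exists2 i, in_vertices L i & x = ray s i >] :> nat) ->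
  eventually_lower s L -> is_string_rep F.
Proof.
move=> s2 n2 b gS d2 DE ev; have E := ray_dim_eq DE; subst D; apply: string_of_ray =>
  //.
have b' := ray_bij_from n2 b.
have [||f hf uf] := thin_iso gS _ (bij_from_leq (leq_maxl n s) b) b'
  (rep_system_orientation _ _ _ _) _.
- apply: ray_good_system => //; apply/asboolP.
  by move: d2; rewrite /ray_dim; case: asboolP.
- exact: d2.
exact: (system_iso v_bij a_bij a_joins hf).
Qed.

Lemma classification D (F : mats D) : rep_plus (mxrep F) -> indecomposable (mxrep F) ->
  is_string_rep F \/
  (exists i j, (1 <= j)%N /\ rep_iso (mxrep F) (N_rep k v i j)) \/
  (exists i, iso_N_infty v i (mxrep F)).
Proof.
move=> pF iF; have R := indecomposable_rigid v_bij a_bij a_joins iF.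
have [n [n2 b tailF]] := rep_plus_bij_from v_bij a_bij a_joins pF.
have nz : exists x, D (v x) != 0%N.
  apply: contrapT => no; case: iF => + _; apply => z u; apply/rowP => i.
  have Dz : D z = 0%N.
    have [w _ wK] := v_bij; rewrite -(wK z); apply/eqP/negPn/negP => h.
    by apply: no; exists (w z).
  by have := ltn_ord i; rewrite {2}Dz.
(* Dimension one far out excludes the alternative of vanishing there, so the tail points
   outwards. *)
have out r : (forall x, (r <= x)%N -> D (v x) = 1%N) ->
    forall x, (n <= x)%N -> outward v a x.
  by case: tailF => // h /(_ (maxn n r)); rewrite h ?leq_maxl // leq_maxr => /(_ isT).
have ev s r L : (L = None -> forall x, (r <= x)%N -> D (v x) = 1%N) ->
  eventually_lower s L.
  move=> h LN; exists n => i ni; have [||] := out r _ (ray s i) => //; first exact: h.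
  exact: leq_trans ni (leq_ray s i).
have mono r : good_from (rep_system v a F) r -> nonincreasing_from r (fun x => D (v x)).
  move=> g x y /andP[rx xy]; apply: (@good_dim_le k _ (rep_system v a F) x y _ xy) =>
    z xz.
  by apply: g; apply: leq_trans xz.
have ray_profile r : (0 < r)%N -> nonincreasing_from r (fun x => D (v x)) ->
  D (v r) = 1%N ->
    (forall x, (x < r)%N -> D (v x) = 0%N) ->
    exists L, (forall x, D (v x) = `[< exists2 i,
      in_vertices L i & x = ray r i >] :> nat) /\
      eventually_lower r L.
  move=> r0 g dr dl.
  have [h|[l h]] := thin_profile g dr.
    exists None; split; last exact: (ev r r None (fun _ => h)).
    move=> x; have [xr|rx] := ltnP x r.
      by rewrite dl // asboolF // => -[i _]; rewrite ray_pos //; lia.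
    by rewrite h // asboolT //; exists (x - r)%N => //; rewrite ray_pos //; lia.
  exists (Some l); split=> [x|//].
  have [xr|rx] := ltnP x r.
    by rewrite dl // asboolF // => -[i _]; rewrite ray_pos //; lia.
  rewrite h //; congr nat_of_bool; apply/idP/asboolP.
    by move=> xl; exists (x - r)%N; rewrite ?ray_pos //=; lia.
  by move=> [i /= il]; rewrite ray_pos //; lia.
have big_case : good_system (rep_system v a F) -> D (v 0) = 1%N -> D (v 1) = 1%N ->
    (D (v 2) <= 2)%N -> (exists2 x, (2 <= x)%N & D (v x) = 1%N) ->
    (exists i j, (1 <= j)%N /\ rep_iso (mxrep F) (N_rep k v i j)) \/
    (exists i, iso_N_infty v i (mxrep F)).
  move=> [g _ _] d0 d1 d2 dx.
  have [[i [j [j1 h]]]|[i h]] := plane_profile (mono 2%N g) d0 d1 d2 dx; [left|right].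
    by exists i, j; split=> //; apply: (N_rep_iso v_bij a_bij a_joins).
  exists i; split; last exact: (N_infty_iso v_bij a_bij a_joins).
  left; apply/(has_right_infinite_pathP v_bij a_bij a_joins); exists n.
  apply: (out (i + 2)%N) => x ix; rewrite h /dimN_infty.
  by have [-> ->] : (x < 2)%N = false /\ (x < i + 2)%N = false by lia.
have [r r2 dr dl|r r2 dr dl g|gS d2|u0 u1 gS P] := rigidP R nz b.
- by left; apply: (@arm_string r).
- have [L [DE evL]] := ray_profile r (ltnW (ltnW r2)) (mono r g) dr dl.
  by left; apply: (@tail_string r n L).
- have [g g0 g1] := gS.
  have := good_dim g0; have := good_dim g1; rewrite d2.
  have thin0 s : (s <= 2)%N -> (exists L,
      (forall x, D (v x) = `[< exists2 i, in_vertices L i & x = ray s i >] :> nat) /\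
      eventually_lower s L) -> is_string_rep F.
    by move=> s2 [L [DE evL]]; apply: (@thin_string s n L).
  (* Good arms leave dimension at most one at each leaf. If both are zero the string starts at 2, if
     one is nonzero it starts there, and if both are nonzero the representation is an N. *)
  case d1 : (D (v 1)) => [|[|]] // _; case d0 : (D (v 0)) => [|[|]] // _.
  + left; apply: (thin0 2%N) => //; apply: ray_profile => //; first exact: mono.
    by case=> [|[|]].
  + left; apply: (thin0 0%N) => //.
    have [h|[l h]] := thin_profile (mono 2%N g) d2.
      exists None; split; last exact: (ev 0%N 2%N None (fun _ => h)).
      move=> [|[|x]].
      * by rewrite d0 asboolT //; exists 0%N.
      * by rewrite d1 asboolF // => -[[|i] // _]; rewrite ray0S.
      * by rewrite h // asboolT //; exists x.+1 => //; rewrite ray0S.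
    exists (Some l.+1); split; last by [].
    move=> [|[|x]].
    * by rewrite d0 asboolT //; exists 0%N.
    * by rewrite d1 asboolF // => -[[|i] // _]; rewrite ray0S.
    * rewrite h //; congr nat_of_bool; apply/idP/asboolP.
        by move=> xl; exists x.+1; rewrite ?ray0S //=; lia.
      by move=> [[|i] // il]; rewrite ray0S; move: il => /=; lia.
  + left; apply: (thin0 1%N) => //; apply: ray_profile => //; last by case.
    move=> [|[|x]] // [|[|y]] //= xy; last by apply: (mono 2%N g).
    by rewrite d1 -d2; apply: (mono 2%N g).
  + by right; apply: big_case => //; rewrite ?d2 //; exists 2%N.
have [d0 d1 d2 dx] := plane_dims gS b P.
by right; apply: big_case => //; rewrite d2.
Qed.

End Strings.

Theorem proposition5p19 (k : fieldType) (Q : quiver) (v : nat -> vertex Q)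
    (hQ : Dinf_labelling v) :
  (forall M : rep k Q, rep_plus M -> indecomposable M ->
     (exists w : walk Q,
        is_string w /\ no_left_infinite_path w /\ rep_iso M (string_rep k w))
     \/ (exists i j : nat, (1 <= j)%N /\ rep_iso M (N_rep k v i j))
     \/ (exists i : nat, iso_N_infty v i M))
  /\
  (forall i : nat,
     (exists M : rep k Q,
        rep_plus M /\ indecomposable M /\ iso_N_infty v i M)
     <-> has_right_infinite_path Q).
Proof.
have [v_bij [a a_bij ends]] := hQ.
have a_joins e : joins (a e) (v (Dinf_edge e).1) (v (Dinf_edge e).2).
  by have := ends e; case: (Dinf_edge e).
split=> [M pM iM|i].
  have [D [F MF]] := mxrepP (proj1 pM).
  have := classification v_bij a_bij a_joins (rep_plus_iso MF pM) (indecomposable_iso MF iM).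
  case=> [[w [sw [lw iso]]]|[[i [j [j1 iso]]]|[i [inf iso]]]].
  - by left; exists w; split=> //; split=> //; apply: rep_iso_trans iso.
  - by right; left; exists i, j; split=> //; apply: rep_iso_trans iso.
  - by right; right; exists i; split=> //; apply: rep_iso_trans iso.
have rightP := has_right_infinite_pathP v_bij a_bij a_joins.
split=> [[M [pM [iM [_ MN]]]]|]; last first.
  move=> r; have [n out] := rightP.1 r.
  have [D [F [pF iF dF]]] := @Ninf_exists k Q v a v_bij a_bij a_joins i n out.
  exists (mxrep F); split=> //; split=> //; split; first by left.
  exact: (N_infty_iso v_bij a_bij a_joins).
have [D [F MF]] := mxrepP (proj1 pM).
have dN : has_dim_vector v (N_infty k v i) (dimN_infty i).
  (* If the specification could not be met, [N_infty] would be the default zero representation, to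
     which the indecomposable [M] is not isomorphic. *)
  move: MN; rewrite /N_infty /some_rep; case: pselect => [h _|_ MZ].
    by case: cid => N [].
  case: iM => + _; case=> x u; have [f /(_ x) bf] := MZ.
  by apply: (bij_inj bf); apply/rowP => -[].
have dF x : D (v x) = dimN_infty i x.
  apply: (has_dim_unique (has_dim_mxrep F (v x))).
  exact: rep_iso_dim (rep_iso_trans (rep_iso_sym MF) MN) (dN x).
have [n [_ _ [Z|out]]] := rep_plus_bij_from v_bij a_bij a_joins (rep_plus_iso MF pM).
  (* The representation does not vanish far out, since its dimension is positive at every vertex. *)
  by have := Z n (leqnn n); rewrite dF /dimN_infty; do !case: ifP.
by apply/rightP; exists n.
Qed.
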